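(* Let $\mu\in\mathbb{C}$ with $\Re\mu>-1$, $\ell\in\mathbb{N}_0$, $j\in\mathbb{N}_0$. For $x>0$ the function $$x^{2\ell+1}\int_0^\pi\int_0^\infty e^{-x(\cosh\phi-1)}L_j^{\ell+\frac{\mu+1}{2}}\big(x(\cos\psi+\cosh\phi)\big)\sin^\mu\psi\,\sinh^{2\ell+1}\phi\,d\phi\,d\psi$$ is a polynomial in $x$ of degree $j+\ell$, and it equals $$\frac{2^\mu\,\ell!\,\Gamma(\frac{\mu+1}{2})\,\Gamma(j+\frac{\mu+1}{2})}{\Gamma(j+\mu+1)}M_j^{\mu,\ell}(2x).$$
   Context: $L_n^\alpha$ denotes the Laguerre polynomial $L_n^\alpha(x)=\sum_{k=0}^n\frac{(-1)^k}{k!}\binom{n+\alpha}{n-k}x^k$. Let $I_\alpha$, $K_\alpha$ be the modified Bessel functions and set $\widetilde I_\alpha(z)=(z/2)^{-\alpha}I_\alpha(z)$, $\widetilde K_\alpha(z)=(z/2)^{-\alpha}K_\alpha(z)$. For $\mu\in\mathbb{C}$, $\ell\in\mathbb{N}_0$, $x>0$ and $t$ near $0$ define $$G^{\mu,\ell}(t,x)=\frac{1}{(1-t)^{\ell+\frac{\mu+3}{2}}}\left(\frac x2\right)^{2\ell+1}e^{\frac x2}\,\widetilde I_{\frac\mu2}\!\left(\frac{tx}{2(1-t)}\right)\widetilde K_{\ell+\frac12}\!\left(\frac{x}{2(1-t)}\right),$$ and $M_j^{\mu,\ell}(x)=\frac{\Gamma(j+\mu+1)}{j!\,2^\mu\,\Gamma(j+\frac{\mu+1}{2})}\left.\frac{\partial^j}{\partial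 t^j}\right|_{t=0}G^{\mu,\ell}(t,x)$. *)

(* Defs.v *)
From Stdlib Require Import Reals Factorial.
From Coquelicot Require Import Coquelicot.
Open Scope R_scope.

Notation CC := Complex.C.

Definition Cexp (z : CC) : CC :=
  (exp (Re z) * cos (Im z), exp (Re z) * sin (Im z)).

Definition rpowC (x : R) (s : CC) : CC := Cexp (Cmult s (RtoC (ln x))).

Definition CInt_gen (f : R -> CC) (Fa Fb : (R -> Prop) -> Prop) : CC :=
  @RInt_gen C_R_CompleteNormedModule f Fa Fb.

(** Euler's Gamma function, Gamma(s) = int_0^oo u^(s-1) e^(-u) du
    (used only for Re s > 0, where this integral converges). *)
Definition CGamma (s : CC) : CC :=
  CInt_gen (fun u => Cmult (rpowC u (Cminus s 1)) (RtoC (exp (- u))))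
           (at_right 0) (Rbar_locally p_infty).

Definition CSeries (a : nat -> CC) : CC :=
  (Series (fun k => Re (a k)), Series (fun k => Im (a k))).

Fixpoint Csum (a : nat -> CC) (n : nat) : CC :=
  match n with
  | O => a O
  | S m => Cplus (Csum a m) (a (S m))
  end.

Definition CDerive_n (f : R -> CC) (n : nat) (t : R) : CC :=
  (Derive_n (fun s => Re (f s)) n t, Derive_n (fun s => Im (f s)) n t).

Fixpoint fallC (z : CC) (m : nat) : CC :=
  match m with
  | O => RtoC 1
  | S k => Cmult (fallC z k) (Cminus z (RtoC (INR k)))
  end.

Definition binomC (z : CC) (m : nat) : CC :=
  Cdiv (fallC z m) (RtoC (INR (fact m))).

Definition Laguerre (n : nat) (alpha : CC) (y : R) : CC :=
  Csum (fun k => Cmult (RtoC ((-1) ^ k / INR (fact k) * y ^ k))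
                       (binomC (Cplus (RtoC (INR n)) alpha) (n - k))) n.

(** tilde I_alpha(z) = (z/2)^(-alpha) I_alpha(z)
                     = sum_k (z/2)^(2k) / (k! Gamma(k+alpha+1)),
    the entire function of z given by the defining power series of I_alpha. *)
Definition Itilde (alpha : CC) (z : R) : CC :=
  CSeries (fun k => Cdiv (RtoC ((z / 2) ^ (2 * k)))
                         (Cmult (RtoC (INR (fact k)))
                                (CGamma (Cplus (RtoC (INR k + 1)) alpha)))).

(** Modified Bessel function of the second kind, for real order nu and z > 0:
    K_nu(z) = int_0^oo exp(-z cosh s) cosh(nu s) ds   (DLMF 10.32.9). *)
Definition BesselK (nu : R) (z : R) : R :=
  RInt_gen (fun s => exp (- z * cosh s) * cosh (nu * s))
           (at_point 0) (Rbar_locally p_infty).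

Definition Ktilde (nu : R) (z : R) : R := Rpower (z / 2) (- nu) * BesselK nu z.

Definition Gfun (mu : CC) (l : nat) (t x : R) : CC :=
  Cmult (Cinv (rpowC (1 - t) (Cplus (RtoC (INR l)) (Cdiv (Cplus mu 3) 2))))
   (Cmult (RtoC ((x / 2) ^ (2 * l + 1) * exp (x / 2)))
     (Cmult (Itilde (Cdiv mu 2) (t * x / (2 * (1 - t))))
            (RtoC (Ktilde (INR l + / 2) (x / (2 * (1 - t))))))).

Definition Mfun (mu : CC) (l j : nat) (x : R) : CC :=
  Cmult (Cdiv (CGamma (Cplus (RtoC (INR j)) (Cplus mu 1)))
              (Cmult (RtoC (INR (fact j)))
                     (Cmult (rpowC 2 mu)
                            (CGamma (Cplus (RtoC (INR j)) (Cdiv (Cplus mu 1) 2))))))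
        (CDerive_n (fun t => Gfun mu l t x) j 0).

Definition Ffun (mu : CC) (l j : nat) (x : R) : CC :=
  Cmult (RtoC (x ^ (2 * l + 1)))
   (CInt_gen (fun psi =>
      CInt_gen (fun phi =>
        Cmult (RtoC (exp (- x * (cosh phi - 1)) * (sinh phi) ^ (2 * l + 1)))
         (Cmult (Laguerre j (Cplus (RtoC (INR l)) (Cdiv (Cplus mu 1) 2))
                          (x * (cos psi + cosh phi)))
                (rpowC (sin psi) mu)))
        (at_point 0) (Rbar_locally p_infty))
      (at_right 0) (at_left PI)).

(* Main.v *)
Require Import Defs.
From Stdlib Require Import Reals Factorial Lra Lia ZArith.
From Coquelicot Require Import Coquelicot.

(** With [beta = l + (mu+1)/2], expanding the Laguerre polynomial at
    [x (cos psi + cosh phi) = x (u + v)], [u = 1 + cos psi], [v = cosh phi - 1],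
    separates the variables.  The [phi]-integrals become Laplace transforms of
    [(v (v+2))^l v^p], the [psi]-integrals are
    [V_n = int (1 + cos psi)^n sin^mu psi], and a binomial convolution gives
    [sum_i c_i (l+i)! x^(l-i) sum_n (-x)^n V_n / n! binom(j+beta-l-i-1, j-n)],
    [c_i] being the coefficient of [v^(l+i)] in [(v (v+2))^l].
    On the other side K-tilde of half-integer order is elementary, and
    [e^(-w) Itilde_(mu/2)(w)] has exponential coefficients proportional to
    [int (cos psi - 1)^n sin^mu psi = (-1)^n V_n], so the [t]-derivatives of [G] at [0]
    give the same sum.  The [x^(j+l)] coefficient is a nonzero multiple of [V_j],
    which is nonzero by a first order recursion.
    The constants match by
    [Gamma(a+1/2) int_0^pi sin^(2a-1) = Gamma(a) Gamma(1/2)]: the quotient of the two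
    sides is 1-periodic in [a], and the concentration of [u^(n-1) e^(-u) du] at [u = n]
    and of [sin^(2n-1)] at [pi/2] shows that it tends to the same limit along [a + n]
    for all [a].  The same concentration shows that Gamma has no zero in [Re a > 0]. *)

(** The double integral is treated as two successive one-dimensional integrals: for each fixed [psi]
    the [phi]-integral is evaluated in closed form, and only finite sums are then integrated in
    [psi]. The Beta identity is usually read off a product of two integrals rewritten as a double
    integral; the asymptotic argument keeps everything in one variable. The condition [-1 < Re mu]
    allows integrands that are unbounded at the endpoints. Domination is therefore applied only
    where the exponent makes the integrand bounded there, and an integration by parts, which raises
    the exponent by 1 for Gamma and by 2 for the sine, transfers convergence to the remaining
    exponents. The same integration by parts yields the recursions. Integrals and iterated
    derivatives are total functions with junk values, so a value is used only after convergence or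
    differentiability has been established. Gamma at 1/2 stays symbolic: it enters once through
    K-tilde, once through the normalization of I-tilde, and cancels. *)

Lemma C_eq_parts (z w : CC) : Re z = Re w -> Im z = Im w -> z = w.
Proof. destruct z, w; simpl; intros; subst; reflexivity. Qed.

Lemma norm_Cmod (a : C_R_NormedModule) : norm a = Cmod a.
Proof.
  unfold norm; simpl; unfold prod_norm, Cmod, norm; simpl; unfold abs; simpl.
  f_equal. change (Rabs (fst a) ^ 2 + Rabs (snd a) ^ 2 = fst a ^ 2 + snd a ^ 2).
  now rewrite !pow2_abs.
Qed.

Lemma im_le_Cmod (c : CC) : Rabs (Im c) <= Cmod c.
Proof. eapply Rle_trans; [apply Rmax_r | apply (Rmax_Cmod c)]. Qed.

Lemma Cmod_le_parts (c : CC) : Cmod c <= Rabs (Re c) + Rabs (Im c).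
Proof.
  replace c with (RtoC (Re c) + Ci * RtoC (Im c))%C at 1
    by (apply C_eq_parts; simpl; ring).
  eapply Rle_trans; [apply Cmod_triangle|].
  rewrite Cmod_mult, !Cmod_R, Cmod_Ci. lra.
Qed.

Lemma RtoC_neq0 (x : R) : x <> 0 -> RtoC x <> RtoC 0.
Proof. intros H E; apply H; exact (f_equal fst E). Qed.

Lemma Cneq0_Re (z : CC) : Re z <> 0 -> z <> RtoC 0.
Proof. intros H E; apply H; rewrite E; reflexivity. Qed.

(** * Derivatives of complex-valued functions of a real variable *)

(** Componentwise, because [CDerive_n] is built from real derivatives of the two parts; the complex
    product rule is recovered below in this form. *)
Definition is_Cderive (f : R -> CC) (x : R) (d : CC) : Prop :=
  is_derive (fun t => Re (f t)) x (Re d) /\ is_derive (fun t => Im (f t)) x (Im d).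

Lemma is_Cderive_const (c : CC) (x : R) : is_Cderive (fun _ => c) x 0.
Proof. split; apply (is_derive_const (K:=R_AbsRing) (V:=R_NormedModule)). Qed.

Lemma is_Cderive_eq (f : R -> CC) (x : R) (d d' : CC) :
  is_Cderive f x d -> d = d' -> is_Cderive f x d'.
Proof. now intros H <-. Qed.

Lemma is_Cderive_RtoC (f : R -> R) (x d : R) :
  is_derive f x d -> is_Cderive (fun t => RtoC (f t)) x (RtoC d).
Proof. intros H; split; [exact H | exact (is_derive_const (K:=R_AbsRing) (V:=R_NormedModule) 0 x)]. Qed.

Lemma is_Cderive_plus (f g : R -> CC) (x : R) (df dg : CC) :
  is_Cderive f x df -> is_Cderive g x dg ->
  is_Cderive (fun t => (f t + g t)%C) x (df + dg)%C.
Proof.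
  intros [H1 H2] [H3 H4]; split.
  - exact (is_derive_plus _ _ _ _ _ H1 H3).
  - exact (is_derive_plus _ _ _ _ _ H2 H4).
Qed.

Lemma is_Cderive_opp (f : R -> CC) (x : R) (d : CC) :
  is_Cderive f x d -> is_Cderive (fun t => (- f t)%C) x (- d)%C.
Proof.
  intros [H1 H2]; split.
  - exact (is_derive_opp (V:=R_NormedModule) _ _ _ H1).
  - exact (is_derive_opp (V:=R_NormedModule) _ _ _ H2).
Qed.

Lemma is_Cderive_minus (f g : R -> CC) (x : R) (df dg : CC) :
  is_Cderive f x df -> is_Cderive g x dg ->
  is_Cderive (fun t => (f t - g t)%C) x (df - dg)%C.
Proof. intros H1 H2. apply is_Cderive_plus; [exact H1 | apply is_Cderive_opp, H2]. Qed.

Lemma is_Cderive_mult (f g : R -> CC) (x : R) (df dg : CC) :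
  is_Cderive f x df -> is_Cderive g x dg ->
  is_Cderive (fun t => (f t * g t)%C) x (df * g x + f x * dg)%C.
Proof.
  intros [H1 H2] [H3 H4]; split.
  - apply (is_derive_ext (fun t => minus (mult (Re (f t)) (Re (g t))) (mult (Im (f t)) (Im (g t))))).
    { intros t; reflexivity. }
    evar_last.
    { apply (is_derive_minus (V:=R_NormedModule)).
      - apply (is_derive_mult (fun t => Re (f t)) (fun t => Re (g t))); eauto; intros; apply Rmult_comm.
      - apply (is_derive_mult (fun t => Im (f t)) (fun t => Im (g t))); eauto; intros; apply Rmult_comm. }
    unfold minus, plus, opp, mult; simpl; unfold Re, Im; ring.
  - apply (is_derive_ext (fun t => plus (mult (Re (f t)) (Im (g t))) (mult (Im (f t)) (Re (g t))))).
    { intros t; reflexivity. }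
    evar_last.
    { apply (is_derive_plus (V:=R_NormedModule)).
      - apply (is_derive_mult (fun t => Re (f t)) (fun t => Im (g t))); eauto; intros; apply Rmult_comm.
      - apply (is_derive_mult (fun t => Im (f t)) (fun t => Re (g t))); eauto; intros; apply Rmult_comm. }
    unfold minus, plus, opp, mult; simpl; unfold Re, Im; ring.
Qed.

Lemma is_Cderive_mult_l (z : CC) (f : R -> CC) (x : R) (d : CC) :
  is_Cderive f x d -> is_Cderive (fun t => (z * f t)%C) x (z * d)%C.
Proof.
  intros H. apply is_Cderive_eq with (0 * f x + z * d)%C; [|ring].
  apply (is_Cderive_mult (fun _ => z)); [apply is_Cderive_const | exact H].
Qed.

Lemma is_Cderive_comp (f : R -> CC) (g : R -> R) (x : R) (df : CC) (dg : R) :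
  is_Cderive f (g x) df -> is_derive g x dg ->
  is_Cderive (fun t => f (g t)) x (RtoC dg * df)%C.
Proof.
  intros [H1 H2] H3; split.
  - evar_last. { apply (is_derive_comp (fun t => Re (f t)) g); eauto. }
    unfold scal; simpl; unfold mult; simpl; unfold Re, Im; ring.
  - evar_last. { apply (is_derive_comp (fun t => Im (f t)) g); eauto. }
    unfold scal; simpl; unfold mult; simpl; unfold Re, Im; ring.
Qed.

Lemma is_derive_exp_cos (u v : R -> R) (x du dv : R) :
  is_derive u x du -> is_derive v x dv ->
  is_derive (fun t => exp (u t) * cos (v t)) x
    (du * (exp (u x) * cos (v x)) - dv * (exp (u x) * sin (v x))).
Proof.
  intros H1 H2. auto_derive.
  - repeat split; eexists; eauto.
  - apply is_derive_unique in H1, H2. simpl in H1, H2.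
    change (Derive (fun x0 : R => u x0) x) with (Derive u x).
    change (Derive (fun x0 : R => v x0) x) with (Derive v x). rewrite H1, H2. ring.
Qed.

Lemma is_derive_exp_sin (u v : R -> R) (x du dv : R) :
  is_derive u x du -> is_derive v x dv ->
  is_derive (fun t => exp (u t) * sin (v t)) x
    (du * (exp (u x) * sin (v x)) + dv * (exp (u x) * cos (v x))).
Proof.
  intros H1 H2. auto_derive.
  - repeat split; eexists; eauto.
  - apply is_derive_unique in H1, H2. simpl in H1, H2.
    change (Derive (fun x0 : R => u x0) x) with (Derive u x).
    change (Derive (fun x0 : R => v x0) x) with (Derive v x). rewrite H1, H2. ring.
Qed.

Lemma is_Cderive_Cexp (f : R -> CC) (x : R) (d : CC) :
  is_Cderive f x d -> is_Cderive (fun t => Cexp (f t)) x (d * Cexp (f x))%C.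
Proof.
  intros [H1 H2]; split.
  - exact (is_derive_exp_cos _ _ _ _ _ H1 H2).
  - exact (is_derive_exp_sin _ _ _ _ _ H1 H2).
Qed.

Lemma Cexp_plus (z w : CC) : Cexp (z + w)%C = (Cexp z * Cexp w)%C.
Proof.
  unfold Cexp; apply C_eq_parts; unfold Re, Im; simpl; rewrite exp_plus, ?cos_plus, ?sin_plus; ring.
Qed.

Lemma Cexp_RtoC (x : R) : Cexp (RtoC x) = RtoC (exp x).
Proof. unfold Cexp; apply C_eq_parts; simpl; rewrite ?cos_0, ?sin_0; ring. Qed.

Lemma Cmod_Cexp (z : CC) : Cmod (Cexp z) = exp (Re z).
Proof.
  unfold Cmod, Cexp; simpl.
  replace (_ + _) with (Rsqr (exp (Re z)) * (Rsqr (sin (Im z)) + Rsqr (cos (Im z))))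
    by (unfold Rsqr; ring).
  rewrite sin2_cos2, Rmult_1_r. apply sqrt_Rsqr. left; apply exp_pos.
Qed.

Lemma rpowC_plus (x : R) (s w : CC) : rpowC x (s + w)%C = (rpowC x s * rpowC x w)%C.
Proof. unfold rpowC. rewrite <- Cexp_plus. f_equal. ring. Qed.

Lemma rpowC_0 (x : R) : rpowC x 0 = RtoC 1.
Proof. unfold rpowC. rewrite Cmult_0_l, Cexp_RtoC, exp_0. reflexivity. Qed.

Lemma rpowC_RtoC (x y : R) : rpowC x (RtoC y) = RtoC (Rpower x y).
Proof. unfold rpowC, Rpower. rewrite <- RtoC_mult. apply Cexp_RtoC. Qed.

Lemma rpowC_INR (x : R) (n : nat) : 0 < x -> rpowC x (RtoC (INR n)) = RtoC (x ^ n).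
Proof. intros H. rewrite rpowC_RtoC, Rpower_pow; auto. Qed.

Lemma rpowC_1 (x : R) : 0 < x -> rpowC x 1 = RtoC x.
Proof. intros H. rewrite rpowC_RtoC, Rpower_1; auto. Qed.

Lemma rpowC_add1 (x : R) (s : CC) : 0 < x -> rpowC x (s + 1)%C = (RtoC x * rpowC x s)%C.
Proof. intros H. rewrite rpowC_plus, rpowC_1 by auto. ring. Qed.

Lemma rpowC_sub1 (x : R) (s : CC) : 0 < x -> rpowC x s = (RtoC x * rpowC x (s - 1))%C.
Proof. intros H. rewrite <- rpowC_add1 by auto. f_equal. ring. Qed.

Lemma Cmod_rpowC (x : R) (s : CC) : Cmod (rpowC x s) = Rpower x (Re s).
Proof. unfold rpowC. rewrite Cmod_Cexp. unfold Rpower. f_equal. unfold Re; simpl. ring. Qed.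

Lemma rpowC_neq0 (x : R) (s : CC) : rpowC x s <> 0.
Proof.
  intros E. apply (f_equal Cmod) in E. rewrite Cmod_rpowC, Cmod_0 in E.
  pose proof (exp_pos (Re s * ln x)). unfold Rpower in E. lra.
Qed.

Lemma is_Cderive_rpowC (x : R) (s : CC) :
  0 < x -> is_Cderive (fun u => rpowC u s) x (s * rpowC x (s - 1))%C.
Proof.
  intros H. unfold rpowC at 1. eapply is_Cderive_eq.
  { apply is_Cderive_Cexp, is_Cderive_mult; [apply is_Cderive_const|].
    apply is_Cderive_RtoC, is_derive_ln, H. }
  rewrite Cmult_0_l, Cplus_0_l. change (Cexp (s * RtoC (ln x))%C) with (rpowC x s).
  rewrite (rpowC_sub1 x s H), RtoC_inv by lra.
  field. apply RtoC_neq0; lra.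
Qed.

Lemma is_Cderive_is_derive (f : R -> C_R_NormedModule) (x : R) (d : CC) :
  is_Cderive f x d -> is_derive f x (d : C_R_NormedModule).
Proof.
  intros [[_ H1] [_ H2]]. split.
  { apply is_linear_scal_l. }
  intros y Hy eps.
  assert (P : 0 < eps / 2) by (destruct eps; simpl; lra).
  specialize (H1 y Hy (mkposreal _ P)); specialize (H2 y Hy (mkposreal _ P)).
  generalize (filter_and _ _ H1 H2); apply filter_imp; intros t [A B].
  rewrite norm_Cmod. eapply Rle_trans; [apply Cmod_le_parts|].
  simpl in A, B.
  replace (pos eps) with (eps / 2 + eps / 2) by field.
  rewrite Rmult_plus_distr_r. apply Rplus_le_compat; [exact A | exact B].
Qed.

Lemma is_Cderive_continuous (f : R -> C_R_NormedModule) (x : R) (d : CC) :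
  is_Cderive f x d -> continuous f x.
Proof.
  intros H. apply ex_derive_continuous. eexists. apply is_Cderive_is_derive, H.
Qed.

(** * Improper integrals of complex-valued functions *)

Notation is_Cint f Fa Fb l := (@is_RInt_gen C_R_NormedModule f Fa Fb l).

(** [D] is the open set on which an integrand is regular. The filters at its ends contain [D], so
    the hypotheses never concern the endpoints, where complex powers may blow up. *)
Definition is_interval (D : R -> Prop) : Prop :=
  forall a b x, D a -> D b -> Rmin a b <= x <= Rmax a b -> D x.

Lemma is_interval_lt_lt (a b : R) : is_interval (fun x => a < x < b).
Proof. intros u v x. unfold Rmin, Rmax; destruct (Rle_dec u v); lra. Qed.

Lemma is_interval_gt (a : R) : is_interval (fun x => a < x).
Proof. intros u v x. unfold Rmin, Rmax; destruct (Rle_dec u v); lra. Qed.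

Lemma is_interval_True : is_interval (fun _ => True).
Proof. now intros u v x. Qed.

Lemma is_Cint_unique {Fa Fb} {FFa : ProperFilter Fa} {FFb : ProperFilter Fb} (f : R -> CC) (l : CC) :
  is_Cint f Fa Fb l -> CInt_gen f Fa Fb = l.
Proof. intros H. apply (is_RInt_gen_unique (V:=C_R_CompleteNormedModule) f l). exact H. Qed.

(** The primitive needs only limits along the two filters, not values at the endpoints; every
    integration by parts in the development goes through this lemma or its complex version. *)
Lemma is_RInt_gen_ftc {V : CompleteNormedModule R_AbsRing} {Fa Fb} {FFa : Filter Fa} {FFb : Filter Fb}
  (D : R -> Prop) (F f : R -> V) (la lb : V) :
  is_interval D -> Fa D -> Fb D ->
  (forall x, D x -> is_derive F x (f x)) -> (forall x, D x -> continuous f x) ->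
  filterlim F Fa (locally la) -> filterlim F Fb (locally lb) ->
  is_RInt_gen f Fa Fb (minus lb la).
Proof.
  intros HD Ha Hb HF Hf La Lb P HP.
  assert (L : filterlim (fun ab : R * R => minus (F (snd ab)) (F (fst ab)))
                (filter_prod Fa Fb) (locally (minus lb la))).
  { unfold minus. eapply filterlim_comp_2.
    - eapply filterlim_comp; [apply filterlim_snd | exact Lb].
    - eapply filterlim_comp.
      + eapply filterlim_comp; [apply filterlim_fst | exact La].
      + apply (filterlim_opp la).
    - apply (filterlim_plus lb (opp la)). }
  specialize (L P HP). unfold filtermap in L.
  assert (K : filter_prod Fa Fb (fun ab : R * R => D (fst ab) /\ D (snd ab))).
  { exists D D; auto. }
  unfold filtermapi. generalize (filter_and _ _ L K). apply filter_imp.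
  intros [a b] [L1 [Da Db]]; simpl in *. eexists; split; [|exact L1].
  apply is_RInt_derive; intros x Hx; [apply HF | apply Hf]; apply (HD a b x); auto.
Qed.

Lemma is_Cint_ftc {Fa Fb} {FFa : Filter Fa} {FFb : Filter Fb}
  (D : R -> Prop) (F f : R -> CC) (la lb : CC) :
  is_interval D -> Fa D -> Fb D ->
  (forall x, D x -> is_Cderive F x (f x)) ->
  (forall x, D x -> exists d, is_Cderive f x d) ->
  filterlim F Fa (locally (la : C_R_NormedModule)) ->
  filterlim F Fb (locally (lb : C_R_NormedModule)) ->
  is_Cint f Fa Fb (lb - la)%C.
Proof.
  intros HD Ha Hb HF Hf La Lb.
  apply (is_RInt_gen_ftc (V:=C_R_CompleteNormedModule) D F f la lb); auto.
  - intros x Hx. apply (is_Cderive_is_derive F), HF, Hx.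
  - intros x Hx. destruct (Hf x Hx) as [d Hd]. apply (is_Cderive_continuous f x d Hd).
Qed.

Lemma filterlim_C0 {F : (R -> Prop) -> Prop} {FF : Filter F} (f : R -> CC) (g : R -> R) :
  F (fun x => Cmod (f x) <= g x) -> filterlim g F (locally 0) ->
  filterlim f F (locally (RtoC 0 : C_R_NormedModule)).
Proof.
  intros H G P [eps HP].
  assert (K : locally 0 (ball (0:R) eps)) by (exists eps; auto).
  specialize (G _ K). unfold filtermap in *.
  generalize (filter_and _ _ H G). apply filter_imp. intros x [A B]. apply HP.
  assert (B' : g x < eps).
  { unfold ball in B; simpl in B; unfold AbsRing_ball, abs, minus, plus, opp in B; simpl in B.
    apply Rle_lt_trans with (2:=B). replace (g x + - 0) with (g x) by ring. apply Rle_abs. }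
  split; unfold ball; simpl; unfold AbsRing_ball, abs, minus, plus, opp; simpl.
  - rewrite Ropp_0, Rplus_0_r. eapply Rle_lt_trans; [apply (re_le_Cmod (f x))|lra].
  - rewrite Ropp_0, Rplus_0_r. eapply Rle_lt_trans; [apply (im_le_Cmod (f x))|lra].
Qed.

(** The indefinite integral [Phi] of [f] varies no more than the primitive [H] of the dominating
    function. As [H] converges along both filters, [Phi] is Cauchy along them, and completeness
    gives its limits. *)
Lemma is_Cint_dominated {Fa Fb} {FFa : ProperFilter Fa} {FFb : ProperFilter Fb}
  (D : R -> Prop) (f : R -> CC) (H h : R -> R) (la lb : R) :
  is_interval D -> Fa D -> Fb D ->
  (forall x, D x -> exists d, is_Cderive f x d) ->
  (forall x, D x -> Cmod (f x) <= h x) ->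
  (forall x, D x -> is_derive H x (h x)) -> (forall x, D x -> continuous h x) ->
  filterlim H Fa (locally la) -> filterlim H Fb (locally lb) ->
  exists l, is_Cint f Fa Fb l.
Proof.
  intros HD Ha Hb Hf Hle HH Hh La Lb.
  destruct (filter_ex _ Ha) as [c Dc].
  assert (Cf : forall x, D x -> continuous (f : R -> C_R_NormedModule) x).
  { intros x Hx. destruct (Hf x Hx) as [d Hd]. apply (is_Cderive_continuous f x d Hd). }
  assert (Ex : forall a b, D a -> D b -> ex_RInt (V:=C_R_CompleteNormedModule) f a b).
  { intros a b Da Db. apply (ex_RInt_continuous (V:=C_R_CompleteNormedModule)). intros z Hz. apply Cf.
    apply (HD a b z); auto. }
  set (Phi := fun x => RInt (V:=C_R_CompleteNormedModule) f c x).
  assert (Int : forall u v, D u -> D v -> is_RInt (V:=C_R_CompleteNormedModule) f u v (Phi v - Phi u)%C).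
  { intros u v Du Dv.
    replace (Phi v - Phi u)%C with (RInt (V:=C_R_CompleteNormedModule) f u v).
    { apply (RInt_correct (V:=C_R_CompleteNormedModule)), Ex; auto. }
    unfold Phi. rewrite <- (RInt_Chasles (V:=C_R_CompleteNormedModule) f c u v) by auto.
    assert (E : forall p q : CC, q = ((p + q) - p)%C) by (intros; ring).
    apply E. }
  assert (Bd : forall u v, D u -> D v -> Cmod (Phi v - Phi u)%C <= Rabs (H v - H u)).
  { assert (Bd0 : forall u v, D u -> D v -> u <= v -> Cmod (Phi v - Phi u)%C <= H v - H u).
    { intros u v Du Dv Huv. pose proof (Int u v Du Dv) as E.
      rewrite <- norm_Cmod. eapply norm_RInt_le; [exact Huv | | exact E |].
      - intros x Hx. rewrite norm_Cmod. apply Hle. apply (HD u v x); auto.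
        rewrite Rmin_left, Rmax_right; auto.
      - apply (is_RInt_derive (V:=R_CompleteNormedModule)); intros x Hx; [apply HH|apply Hh]; apply (HD u v x); auto. }
    intros u v Du Dv. destruct (Rle_dec u v) as [L|L].
    - eapply Rle_trans; [apply Bd0; auto | apply Rle_abs].
    - replace (Phi v - Phi u)%C with (- (Phi u - Phi v))%C by ring.
      rewrite Cmod_opp, Rabs_minus_sym. eapply Rle_trans; [apply Bd0; auto; lra | apply Rle_abs]. }
  assert (Lim : forall (F : (R -> Prop) -> Prop) (FF : ProperFilter F) lh, F D -> filterlim H F (locally lh) ->
            exists y, filterlim Phi F (locally (y : C_R_NormedModule))).
  { intros F FF lh FD LH.
    apply (filterlim_locally_cauchy (U:=C_R_CompleteNormedModule)). intros eps.
    assert (CH : exists y, filterlim H F (locally (y:R))) by (exists lh; auto).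
    apply (proj2 (filterlim_locally_cauchy (U:=R_CompleteSpace) H)) with (eps:=eps) in CH.
    destruct CH as [P [FP HP]].
    exists (fun x => P x /\ D x). split; [apply filter_and; auto|].
    intros u v [Pu Du] [Pv Dv]. specialize (HP u v Pu Pv).
    specialize (Bd u v Du Dv).
    assert (B : Cmod (Phi v - Phi u)%C < eps).
    { eapply Rle_lt_trans; [exact Bd | exact HP]. }
    split.
    - eapply Rle_lt_trans; [|exact B]. apply (re_le_Cmod (Phi v - Phi u)%C).
    - eapply Rle_lt_trans; [|exact B]. apply (im_le_Cmod (Phi v - Phi u)%C). }
  destruct (Lim Fa _ la Ha La) as [ya Ya]. destruct (Lim Fb _ lb Hb Lb) as [yb Yb].
  exists (yb - ya)%C.
  intros P HP.
  assert (L : filterlim (fun ab : R * R => minus (Phi (snd ab)) (Phi (fst ab)))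
                (filter_prod Fa Fb) (locally (minus (yb : C_R_NormedModule) ya))).
  { unfold minus. eapply filterlim_comp_2.
    - eapply filterlim_comp; [apply filterlim_snd | exact Yb].
    - eapply filterlim_comp.
      + eapply filterlim_comp; [apply filterlim_fst | exact Ya].
      + apply (filterlim_opp (V:=C_R_NormedModule) ya).
    - apply (filterlim_plus (V:=C_R_NormedModule) yb (opp ya)). }
  specialize (L P HP). unfold filtermap in L.
  assert (K : filter_prod Fa Fb (fun ab : R * R => D (fst ab) /\ D (snd ab))) by (exists D D; auto).
  unfold filtermapi. generalize (filter_and _ _ L K). apply filter_imp.
  intros [a b] [L1 [Da Db]]; simpl in *. exists (Phi b - Phi a)%C; split; [|exact L1].
  apply Int; auto.
Qed.

Lemma is_Cint_norm {Fa Fb} {FFa : ProperFilter Fa} {FFb : ProperFilter Fb}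
  (D : R -> Prop) (f : R -> CC) (g : R -> R) (lf : CC) (lg : R) :
  is_interval D -> Fa D -> Fb D ->
  filter_prod Fa Fb (fun ab : R * R => fst ab <= snd ab) ->
  (forall x, D x -> Cmod (f x) <= g x) ->
  is_Cint f Fa Fb lf -> is_RInt_gen g Fa Fb lg -> Cmod lf <= lg.
Proof.
  intros HD Ha Hb Hab Hle If Ig.
  rewrite <- norm_Cmod.
  apply (RInt_gen_norm (V:=C_R_CompleteNormedModule) (Fa:=Fa) (Fb:=Fb) f g lf lg); auto.
  assert (K : filter_prod Fa Fb (fun ab : R * R => D (fst ab) /\ D (snd ab))) by (exists D D; auto).
  generalize (filter_and _ _ K Hab). apply filter_imp. intros [a b] [[Da Db] L] x Hx; simpl in *.
  rewrite norm_Cmod. apply Hle. apply (HD a b x); auto. rewrite Rmin_left, Rmax_right; auto.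
Qed.

Lemma is_Cint_ext {Fa Fb} {FFa : Filter Fa} {FFb : Filter Fb}
  (D : R -> Prop) (f g : R -> CC) (l : CC) :
  is_interval D -> Fa D -> Fb D -> (forall x, D x -> f x = g x) ->
  is_Cint f Fa Fb l -> is_Cint g Fa Fb l.
Proof.
  intros HD Ha Hb E. apply is_RInt_gen_ext.
  exists D D; auto. intros a b Da Db x Hx; simpl in Hx. apply E, (HD a b x); auto. lra.
Qed.

Lemma is_Cint_plus {Fa Fb} {FFa : Filter Fa} {FFb : Filter Fb} (f g : R -> CC) (lf lg : CC) :
  is_Cint f Fa Fb lf -> is_Cint g Fa Fb lg -> is_Cint (fun x => (f x + g x)%C) Fa Fb (lf + lg)%C.
Proof. intros A B. exact (is_RInt_gen_plus (V:=C_R_NormedModule) f g lf lg A B). Qed.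

(** [C_R_NormedModule] has real scalars, so a complex factor has to be distributed over the two
    components. *)
Lemma is_RInt_Cmult (c : CC) (f : R -> CC) (a b : R) (l : CC) :
  is_RInt (V:=C_R_NormedModule) f a b l ->
  is_RInt (V:=C_R_NormedModule) (fun x => (c * f x)%C) a b (c * l)%C.
Proof.
  intros H.
  pose proof (is_RInt_fct_extend_fst (U:=R_NormedModule) (V:=R_NormedModule) _ _ _ _ H) as H1.
  pose proof (is_RInt_fct_extend_snd (U:=R_NormedModule) (V:=R_NormedModule) _ _ _ _ H) as H2.
  apply (is_RInt_fct_extend_pair (U:=R_NormedModule) (V:=R_NormedModule)); simpl.
  - apply (is_RInt_minus (V:=R_NormedModule) (fun t => fst c * fst (f t)) (fun t => snd c * snd (f t))).
    + apply (is_RInt_scal (V:=R_NormedModule) (fun t => fst (f t))); auto.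
    + apply (is_RInt_scal (V:=R_NormedModule) (fun t => snd (f t))); auto.
  - apply (is_RInt_plus (V:=R_NormedModule) (fun t => fst c * snd (f t)) (fun t => snd c * fst (f t))).
    + apply (is_RInt_scal (V:=R_NormedModule) (fun t => snd (f t))); auto.
    + apply (is_RInt_scal (V:=R_NormedModule) (fun t => fst (f t))); auto.
Qed.

Lemma filterlim_Cmult_l {T} {F : (T -> Prop) -> Prop} {FF : Filter F} (c l : CC) (f : T -> CC) :
  filterlim f F (locally (l : C_R_NormedModule)) ->
  filterlim (fun x => (c * f x)%C) F (locally ((c * l)%C : C_R_NormedModule)).
Proof.
  intros H. eapply filterlim_comp; [exact H|].
  intros P [eps HP].
  (* The [+ 1] covers the case [c = 0]. *)
  assert (K : 0 < eps / (Cmod c + 1)).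
  { apply Rdiv_lt_0_compat; [apply cond_pos | pose proof (Cmod_ge_0 c); lra]. }
  assert (K2 : 0 < eps / (Cmod c + 1) / 2) by lra.
  exists (mkposreal _ K2). intros y [Y1 Y2]. apply HP.
  assert (Cmod (c * y - c * l)%C < eps).
  { replace (c * y - c * l)%C with (c * (y - l))%C by ring. rewrite Cmod_mult.
    assert (Cmod (y - l)%C < eps / (Cmod c + 1)).
    { eapply Rle_lt_trans; [apply Cmod_le_parts|].
      apply Rlt_le_trans with (eps / (Cmod c + 1) / 2 + eps / (Cmod c + 1) / 2); [|lra].
      apply Rplus_lt_compat; [exact Y1 | exact Y2]. }
    pose proof (Cmod_ge_0 c). pose proof (Cmod_ge_0 (y - l)%C).
    apply Rle_lt_trans with ((Cmod c + 1) * Cmod (y - l)%C); [nra|].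
    replace (pos eps) with ((Cmod c + 1) * (eps / (Cmod c + 1))) by (field; lra).
    apply Rmult_lt_compat_l; lra. }
  split.
  - eapply Rle_lt_trans; [|exact H0]. apply (re_le_Cmod (c * y - c * l)%C).
  - eapply Rle_lt_trans; [|exact H0]. apply (im_le_Cmod (c * y - c * l)%C).
Qed.

Lemma is_Cint_mult {Fa Fb} {FFa : Filter Fa} {FFb : Filter Fb} (c : CC) (f : R -> CC) (l : CC) :
  is_Cint f Fa Fb l -> is_Cint (fun x => (c * f x)%C) Fa Fb (c * l)%C.
Proof.
  intros H P HP.
  pose proof (filterlim_Cmult_l (F:=locally (l : C_R_NormedModule)) c l (fun x => x)
                (filterlim_id _ _) P HP) as K.
  specialize (H _ K). unfold filtermapi in *. revert H. apply filter_imp.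
  intros ab [y [Y1 Y2]]. exists (c * y)%C; split; [apply is_RInt_Cmult, Y1 | exact Y2].
Qed.

Lemma is_Cint_Re {Fa Fb} {FFa : Filter Fa} {FFb : Filter Fb} (f : R -> CC) (l : CC) :
  is_Cint f Fa Fb l -> is_RInt_gen (fun x => Re (f x)) Fa Fb (Re l).
Proof.
  intros H P HP.
  pose proof (continuous_fst (U:=R_UniformSpace) (V:=R_UniformSpace) (fst l) (snd l) P HP) as K.
  replace (fst l, snd l) with l in K by now destruct l.
  specialize (H _ K). unfold filtermapi in *. revert H. apply filter_imp.
  intros ab [y [Y1 Y2]]. exists (Re y); split; [|exact Y2].
  exact (is_RInt_fct_extend_fst (U:=R_NormedModule) (V:=R_NormedModule) _ _ _ _ Y1).
Qed.

Lemma is_Cint_RtoC {Fa Fb} {FFa : Filter Fa} {FFb : Filter Fb} (f : R -> R) (l : R) :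
  is_RInt_gen f Fa Fb l -> is_Cint (fun x => RtoC (f x)) Fa Fb (RtoC l).
Proof.
  intros H P [eps HP].
  assert (K : locally l (fun y => P (RtoC y))).
  { exists eps. intros y Hy. apply HP. split; [exact Hy|]. apply (ball_center (M:=R_UniformSpace)). }
  specialize (H _ K). unfold filtermapi in *. revert H. apply filter_imp.
  intros ab [y [Y1 Y2]]. exists (RtoC y); split; [|exact Y2].
  apply (is_RInt_fct_extend_pair (U:=R_NormedModule) (V:=R_NormedModule)); simpl; auto.
  evar_last. { apply (is_RInt_const (V:=R_NormedModule)). }
  unfold scal; simpl; unfold mult; simpl; ring.
Qed.

(** * Elementary growth bounds and limits *)

Lemma nat_bound (x : R) : exists N : nat, x <= INR N.
Proof.
  destruct (Rle_lt_dec 0 x) as [H|H].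
  - destruct (archimed x) as [A _].
    assert (0 <= up x)%Z by (apply le_IZR; lra).
    exists (Z.to_nat (up x)). rewrite INR_IZR_INZ, Z2Nat.id by auto. lra.
  - exists O. simpl. lra.
Qed.

Lemma pow_le_fact_exp (x : R) (n : nat) : 0 <= x -> x ^ n <= INR (fact n) * exp x.
Proof.
  intros H. pose proof (exp_ge_taylor x n H) as T.
  assert (L : x ^ n / INR (fact n) <= exp x).
  { eapply Rle_trans; [|exact T]. destruct n; [unfold Re in *; simpl; lra|]; simpl sum_f_R0.
    assert (0 <= sum_f_R0 (fun k : nat => x ^ k / INR (fact k)) n).
    { apply cond_pos_sum. intros k. apply Rdiv_le_0_compat; [apply pow_le; auto | apply INR_fact_lt_0]. }
    change (INR (fact n + n * fact n)) with (INR (fact (S n))). change (x * x ^ n) with (x ^ S n). lra. }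
  pose proof (INR_fact_lt_0 n).
  replace (x ^ n) with (INR (fact n) * (x ^ n / INR (fact n))) by (field; lra).
  apply Rmult_le_compat_l; lra.
Qed.

Lemma filterlim_Rpower_0 (s : R) :
  0 < s -> filterlim (fun u => Rpower u s) (at_right 0) (locally 0).
Proof.
  intros Hs P [eps HP].
  assert (D : 0 < Rpower eps (/ s)) by apply exp_pos.
  exists (mkposreal _ D). intros u Hu Hu0. apply HP.
  unfold ball in *; simpl in *; unfold AbsRing_ball, abs, minus, plus, opp in *; simpl in *.
  rewrite Ropp_0, Rplus_0_r in *. rewrite Rabs_pos_eq in Hu by lra.
  rewrite Rabs_pos_eq by (left; apply exp_pos).
  replace (pos eps) with (Rpower (Rpower eps (/ s)) s).
  - apply Rlt_Rpower_l; lra.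
  - rewrite Rpower_mult, Rinv_l, Rpower_1 by (try lra; apply cond_pos). reflexivity.
Qed.

Lemma filterlim_at_right_continuous (f : R -> R) (a : R) :
  continuous f a -> filterlim f (at_right a) (locally (f a)).
Proof. intros H P HP. specialize (H P HP). unfold filtermap, at_right, at_left, within in *. revert H. apply filter_imp. auto. Qed.

Lemma filterlim_at_left_continuous (f : R -> R) (a : R) :
  continuous f a -> filterlim f (at_left a) (locally (f a)).
Proof. intros H P HP. specialize (H P HP). unfold filtermap, at_right, at_left, within in *. revert H. apply filter_imp. auto. Qed.

Lemma filterlim_inv_p_infty : filterlim (fun u => / u) (Rbar_locally p_infty) (locally 0).
Proof. apply (filterlim_Rbar_inv p_infty). easy. Qed.

Lemma at_right_pos : at_right 0 (fun x => 0 < x).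
Proof. exists (mkposreal 1 Rlt_0_1). now intros. Qed.

Lemma p_infty_pos (a : R) : Rbar_locally p_infty (fun x => a < x).
Proof. exists a. now intros. Qed.

Lemma filterlim_scal_0 {F : (R -> Prop) -> Prop} {FF : Filter F} (c : R) (g : R -> R) :
  filterlim g F (locally 0) -> filterlim (fun x => c * g x) F (locally 0).
Proof.
  intros H. rewrite <- (Rmult_0_r c) at 1. eapply filterlim_comp; [exact H|].
  apply (filterlim_scal_r (V:=R_NormedModule) c 0).
Qed.

(** From [x^(s+1) <= x^n <= n! e^x]. The factor [/ x] on the right is what makes the limit at
    infinity vanish. *)
Lemma Rpower_exp_le (x s : R) (n : nat) :
  1 <= x -> s + 1 <= INR n -> Rpower x s * exp (- x) <= INR (fact n) * / x.
Proof.
  intros Hx Hs.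
  assert (E : Rpower x s * x <= INR (fact n) * exp x).
  { eapply Rle_trans; [|apply pow_le_fact_exp; lra].
    rewrite <- (Rpower_1 x) at 2 by lra. rewrite <- Rpower_plus, <- Rpower_pow by lra.
    apply Rle_Rpower; lra. }
  rewrite exp_Ropp. apply Rmult_le_reg_r with (x * exp x).
  { apply Rmult_lt_0_compat; [lra | apply exp_pos]. }
  pose proof (exp_pos x).
  replace (Rpower x s * / exp x * (x * exp x)) with (Rpower x s * x) by (field; lra).
  replace (INR (fact n) * / x * (x * exp x)) with (INR (fact n) * exp x) by (field; lra).
  exact E.
Qed.

(** * The Gamma function *)

Definition gint (s : CC) (u : R) : CC := (rpowC u (s - 1) * RtoC (exp (- u)))%C.

Lemma Cmod_gint (s : CC) (u : R) : Cmod (gint s u) = Rpower u (Re s - 1) * exp (- u).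
Proof.
  unfold gint. rewrite Cmod_mult, Cmod_rpowC, Cmod_R, Rabs_pos_eq by (left; apply exp_pos).
  reflexivity.
Qed.

(** The derivative stays within the family [gint]; integrating it is the functional equation of
    Gamma. *)
Lemma is_Cderive_gint (s : CC) (u : R) :
  0 < u -> is_Cderive (gint s) u ((s - 1) * gint (s - 1) u - gint s u)%C.
Proof.
  intros H. unfold gint. eapply is_Cderive_eq.
  { apply is_Cderive_mult; [apply is_Cderive_rpowC, H |].
    apply is_Cderive_RtoC. instantiate (1 := - exp (- u)).
    auto_derive; auto. ring. }
  rewrite RtoC_opp. ring.
Qed.

Lemma gint_lim_0 (s : CC) : 1 < Re s ->
  filterlim (gint s) (at_right 0) (locally (RtoC 0 : C_R_NormedModule)).
Proof.
  intros H. apply filterlim_C0 with (fun u => Rpower u (Re s - 1)).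
  - apply filter_imp with (2 := at_right_pos). intros u Hu. rewrite Cmod_gint.
    rewrite <- (Rmult_1_r (Rpower u (Re s - 1))) at 2. apply Rmult_le_compat_l; [left; apply exp_pos|].
    rewrite <- exp_0. left. apply exp_increasing. lra.
  - apply filterlim_Rpower_0. lra.
Qed.

Lemma gint_lim_infty (s : CC) :
  filterlim (gint s) (Rbar_locally p_infty) (locally (RtoC 0 : C_R_NormedModule)).
Proof.
  destruct (nat_bound (Re s - 1 + 1)) as [n Hn].
  apply filterlim_C0 with (fun u => INR (fact n) * / u).
  - apply filter_imp with (2 := p_infty_pos 1). intros u Hu. rewrite Cmod_gint.
    apply Rpower_exp_le; lra.
  - apply filterlim_scal_0, filterlim_inv_p_infty.
Qed.

Lemma is_Cint_gint_ge1 (s : CC) :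
  1 <= Re s -> exists l, is_Cint (gint s) (at_right 0) (Rbar_locally p_infty) l.
Proof.
  intros H. destruct (nat_bound (Re s - 1)) as [n Hn].
  (* [C] comes from [x^(Re s - 1) <= (1 + x)^n = 2^n ((1 + x)/2)^n <= 2^n n! e^((1 + x)/2)]. The
     first inequality uses [1 <= Re s]. Half of the exponential decay is left for domination. *)
  set (C := INR (fact n) * 2 ^ n * exp (/ 2)).
  apply (is_Cint_dominated (fun x => 0 < x) (gint s) (fun u => - (2 * C) * exp (- u / 2)) (fun u => C * exp (- u / 2)) (- (2 * C)) 0).
  - apply is_interval_gt.
  - apply at_right_pos.
  - apply p_infty_pos.
  - intros x Hx. eexists. apply is_Cderive_gint, Hx.
  - intros x Hx. rewrite Cmod_gint.
    assert (A : Rpower x (Re s - 1) <= C * exp (x / 2)).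
    { apply Rle_trans with ((1 + x) ^ n).
      - apply Rle_trans with (Rpower (1 + x) (Re s - 1)).
        + apply Rle_Rpower_l; lra.
        + rewrite <- Rpower_pow by lra. apply Rle_Rpower; lra.
      - replace (1 + x) with (2 * ((1 + x) / 2)) by field. rewrite Rpow_mult_distr.
        unfold C. replace (INR (fact n) * 2 ^ n * exp (/ 2) * exp (x / 2))
          with (2 ^ n * (INR (fact n) * exp ((1 + x) / 2))).
        + apply Rmult_le_compat_l; [apply pow_le; lra|]. apply pow_le_fact_exp. lra.
        + replace ((1 + x) / 2) with (/ 2 + x / 2) by field. rewrite exp_plus. ring. }
    replace (C * exp (- x / 2)) with (C * exp (x / 2) * exp (- x)).
    + apply Rmult_le_compat_r; [left; apply exp_pos | exact A].
    + rewrite Rmult_assoc, <- exp_plus. f_equal. f_equal. field.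
  - intros x Hx. auto_derive; auto. unfold Rdiv. field.
  - intros x Hx. apply (ex_derive_continuous (V:=R_NormedModule)). auto_derive; auto.
  - assert (L : filterlim (fun u => - (2 * C) * exp (- u / 2)) (at_right 0) (locally (- (2 * C) * exp (- 0 / 2)))).
    { apply (filterlim_at_right_continuous (fun u => - (2 * C) * exp (- u / 2)) 0).
      apply (ex_derive_continuous (V:=R_NormedModule) (fun u => - (2 * C) * exp (- u / 2)) 0). auto_derive; auto. }
    replace (- (2 * C) * exp (- 0 / 2)) with (- (2 * C)) in L; [exact L|].
    replace (- 0 / 2) with 0 by field. rewrite exp_0. ring.
  - apply filterlim_scal_0.
    intros P HP. pose proof (is_lim_exp_m P HP) as [M HM].
    exists (- 2 * M). intros x Hx. apply HM. lra.
Qed.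

(** The integral of the derivative of [gint (s + 1)] vanishes because both boundary terms do. This
    gives convergence at [s] from convergence at [s + 1], which covers [0 < Re s < 1], together with
    the functional equation. *)
Lemma is_Cint_gint_step (s l : CC) :
  0 < Re s -> is_Cint (gint (s + 1)) (at_right 0) (Rbar_locally p_infty) l ->
  is_Cint (gint s) (at_right 0) (Rbar_locally p_infty) (l / s)%C.
Proof.
  intros H I.
  assert (Hs : s <> 0) by (apply Cneq0_Re; lra).
  assert (J : is_Cint (fun u => (s * gint (s + 1 - 1) u - gint (s + 1) u)%C) (at_right 0) (Rbar_locally p_infty) (0 - 0)%C).
  { apply (is_Cint_ftc (fun x => 0 < x) (gint (s + 1))).
    - apply is_interval_gt.
    - apply at_right_pos.
    - apply p_infty_pos.
    - intros x Hx. eapply is_Cderive_eq; [apply is_Cderive_gint, Hx|].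
      replace (s + 1 - 1)%C with s by ring. reflexivity.
    - intros x Hx. eexists. apply is_Cderive_minus.
      + apply is_Cderive_mult; [apply is_Cderive_const | apply is_Cderive_gint, Hx].
      + apply is_Cderive_gint, Hx.
    - apply gint_lim_0. unfold Re in *; simpl. lra.
    - apply gint_lim_infty. }
  pose proof (is_Cint_mult (/ s)%C _ _ (is_Cint_plus _ _ _ _ J I)) as K.
  replace (l / s)%C with (/ s * (0 - 0 + l))%C by (field; auto).
  revert K. apply is_Cint_ext with (fun x => 0 < x).
  - apply is_interval_gt.
  - apply at_right_pos.
  - apply p_infty_pos.
  - intros x Hx. replace (s + 1 - 1)%C with s by ring. field; auto.
Qed.

Lemma is_Cint_gint (s : CC) :
  0 < Re s -> is_Cint (gint s) (at_right 0) (Rbar_locally p_infty) (CGamma s).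
Proof.
  intros H.
  assert (E : exists l, is_Cint (gint s) (at_right 0) (Rbar_locally p_infty) l).
  { destruct (is_Cint_gint_ge1 (s + 1)) as [l Hl]; [unfold Re in *; simpl; lra|].
    exists (l / s)%C. apply is_Cint_gint_step; auto. }
  destruct E as [l Hl]. unfold CGamma. fold (gint s).
  change (fun u => (rpowC u (s - 1) * RtoC (exp (- u)))%C) with (gint s).
  rewrite (is_Cint_unique (gint s) l); auto.
Qed.

Lemma CGamma_S (s : CC) : 0 < Re s -> CGamma (s + 1)%C = (s * CGamma s)%C.
Proof.
  intros H. assert (Hs : s <> 0) by (apply Cneq0_Re; lra).
  assert (I : is_Cint (gint (s + 1)) (at_right 0) (Rbar_locally p_infty) (CGamma (s + 1))).
  { apply is_Cint_gint. unfold Re in *; simpl; lra. }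
  apply is_Cint_gint_step in I; auto.
  pose proof (is_Cint_unique _ _ I) as E.
  pose proof (is_Cint_unique _ _ (is_Cint_gint s H)) as E2. rewrite E in E2. rewrite <- E2.
  field; auto.
Qed.

Lemma CGamma_1 : CGamma 1 = RtoC 1.
Proof.
  unfold CGamma; apply is_Cint_unique.
  assert (E : is_RInt_gen (fun u => exp (- u)) (at_right 0) (Rbar_locally p_infty) (0 - (- 1))).
  { apply (is_RInt_gen_ftc (V:=R_CompleteNormedModule) (fun x => 0 < x) (fun u => - exp (- u))).
    - apply is_interval_gt.
    - apply at_right_pos.
    - apply p_infty_pos.
    - intros x Hx. auto_derive; auto. ring.
    - intros x Hx. apply (ex_derive_continuous (V:=R_NormedModule)). auto_derive; auto.
    - replace (- 1) with ((fun u => - exp (- u)) 0) by (simpl; rewrite Ropp_0, exp_0; ring).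
      apply (filterlim_at_right_continuous (fun u => - exp (- u)) 0).
      apply (ex_derive_continuous (V:=R_NormedModule) (fun u => - exp (- u)) 0). auto_derive; auto.
    - apply filterlim_ext with (fun u => -1 * exp (- u)); [intros; ring|].
      apply filterlim_scal_0.
      intros P HP. pose proof (is_lim_exp_m P HP) as [M HM].
      exists (- M). intros x Hx. apply HM. lra. }
  apply is_Cint_RtoC in E. replace (0 - - 1) with 1 in E by ring.
  revert E. apply is_Cint_ext with (fun x => 0 < x).
  - apply is_interval_gt.
  - apply at_right_pos.
  - apply p_infty_pos.
  - intros x Hx. replace (1 - 1)%C with (RtoC 0) by ring. rewrite rpowC_0. ring.
Qed.

Lemma CGamma_fact (n : nat) : CGamma (RtoC (INR n) + 1)%C = RtoC (INR (fact n)).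
Proof.
  induction n as [|n IH].
  - replace (RtoC (INR 0) + 1)%C with (RtoC 1) by (simpl; ring). rewrite CGamma_1. reflexivity.
  - rewrite CGamma_S.
    + rewrite S_INR, RtoC_plus, IH, <- RtoC_plus, <- RtoC_mult, <- S_INR, <- mult_INR. reflexivity.
    + rewrite S_INR. pose proof (pos_INR n). simpl. lra.
Qed.

Lemma is_RInt_gen_pow_exp (n : nat) :
  is_RInt_gen (fun u => u ^ n * exp (- u)) (at_right 0) (Rbar_locally p_infty) (INR (fact n)).
Proof.
  assert (H : 0 < Re (RtoC (INR n) + 1)%C) by (simpl; pose proof (pos_INR n); lra).
  pose proof (is_Cint_Re _ _ (is_Cint_gint _ H)) as E. rewrite CGamma_fact in E.
  revert E. apply is_RInt_gen_ext.
  exists (fun x => 0 < x) (fun x => 0 < x).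
  - apply at_right_pos.
  - apply p_infty_pos.
  - intros a b Ha Hb x Hx. simpl in Hx. assert (Hx0 : 0 < x) by (apply (is_interval_gt 0 a b); auto; lra).
    unfold gint. replace (RtoC (INR n) + 1 - 1)%C with (RtoC (INR n)) by ring.
    rewrite rpowC_INR, <- RtoC_mult by auto. reflexivity.
Qed.

(** * Distance of complex powers from 1, and limits of complex sequences *)

Lemma Rabs_sin_le (x : R) : Rabs (sin x) <= Rabs x.
Proof.
  assert (P : forall y, 0 <= y -> Rabs (sin y) <= y).
  { intros y [Hy| <-]; [|rewrite sin_0, Rabs_R0; lra].
    destruct (Rle_lt_dec y 1) as [L|L].
    - rewrite Rabs_pos_eq; [left; apply sin_lt_x; auto|].
      apply sin_ge_0; [lra|]. pose proof PI2_1. lra.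
    - eapply Rle_trans with 1; [|lra]. apply Rabs_le, SIN_bound. }
  destruct (Rle_lt_dec 0 x).
  - rewrite (Rabs_pos_eq x); auto.
  - rewrite (Rabs_left x), <- Rabs_Ropp, <- sin_neg by auto. apply P. lra.
Qed.

Lemma one_minus_cos_le (q : R) : 2 * (1 - cos q) <= q ^ 2.
Proof.
  replace q with (2 * (q / 2)) at 1 by field. rewrite cos_2a_sin.
  pose proof (Rabs_sin_le (q / 2)) as H. pose proof (Rabs_pos (sin (q / 2))).
  assert (E : Rabs (sin (q/2)) ^ 2 <= Rabs (q / 2) ^ 2) by (apply pow_incr; auto).
  rewrite !pow2_abs in E. nra.
Qed.

Lemma Cmod_sqr (z : CC) : Cmod z ^ 2 = Re z ^ 2 + Im z ^ 2.
Proof.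
  unfold Cmod. rewrite pow2_sqrt; [reflexivity|].
  pose proof (pow2_ge_0 (fst z)); pose proof (pow2_ge_0 (snd z)); lra.
Qed.

(** With [w = p + iq], the squared modulus splits as [(e^p - 1)^2 + 2 e^p (1 - cos q)]; the first
    term is at most [M^2 p^2] and the second at most [M^2 q^2]. *)
Lemma Cmod_Cexp_sub_1 (w : CC) (M : R) :
  1 <= M -> exp (Re w) <= M -> Cmod (Cexp w - 1)%C <= M * Cmod w.
Proof.
  intros HM HE.
  assert (Hw := Cmod_ge_0 w).
    assert (Sq : Cmod (Cexp w - 1)%C ^ 2 <= (M * Cmod w) ^ 2).
  { rewrite Rpow_mult_distr, !Cmod_sqr.
    set (p := Re w) in *. set (q := Im w) in *.
    replace (Re (Cexp w - 1)%C) with (exp p * cos q - 1) by (unfold Cexp; simpl; unfold p, q, Re, Im; ring).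
    replace (Im (Cexp w - 1)%C) with (exp p * sin q) by (unfold Cexp; simpl; unfold p, q, Re, Im; ring).
    pose proof (one_minus_cos_le q) as Hc. pose proof (exp_pos p) as Ep.
    pose proof (sin2_cos2 q) as SC. unfold Rsqr in SC.
    replace ((exp p * cos q - 1) ^ 2 + (exp p * sin q) ^ 2)
      with ((exp p - 1) ^ 2 + exp p * (2 * (1 - cos q))).
    2:{ replace ((exp p * cos q - 1) ^ 2 + (exp p * sin q) ^ 2) with
         (exp p ^ 2 * (sin q * sin q + cos q * cos q) - 2 * exp p * cos q + 1) by ring.
        rewrite SC. ring. }
    assert (A : (exp p - 1) ^ 2 <= M ^ 2 * p ^ 2).
    { rewrite <- Rpow_mult_distr, <- (pow2_abs (exp p - 1)), <- (pow2_abs (M * p)).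
      apply pow_incr. split; [apply Rabs_pos|]. rewrite Rabs_mult, (Rabs_pos_eq M) by lra.
      destruct (Rle_lt_dec 0 p) as [L|L].
      - assert (1 <= exp p) by (rewrite <- exp_0; destruct L as [L|<-]; [left; apply exp_increasing; auto | lra]).
        rewrite !Rabs_pos_eq by lra.
        pose proof (exp_ineq1_le (- p)) as Q. rewrite exp_Ropp in Q.
        assert ((1 + - p) * exp p <= 1).
        { replace 1 with (/ exp p * exp p) at 2 by (field; lra). apply Rmult_le_compat_r; lra. }
        nra.
      - assert (exp p < 1) by (rewrite <- exp_0; apply exp_increasing; auto).
        rewrite !Rabs_left by lra. pose proof (exp_ineq1_le p). nra. }
    assert (B : exp p * (2 * (1 - cos q)) <= M ^ 2 * q ^ 2).
    { apply Rmult_le_compat; try lra; [pose proof (COS_bound q); lra|]. nra. }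
    lra. }
  apply Rsqr_incr_0_var; [unfold Rsqr; nra | apply Rmult_le_pos; lra].
Qed.

(** Apply the previous bound to [w = a ln v], with [M = 1] and [|ln v| <= |v - 1| / v] for [v <= 1],
    and with [M = v^N] and [ln v <= v - 1] for [v > 1]. The sum [/ v + v ^ N] covers both cases at
    once and integrates to factorials against a Gamma weight. *)
Lemma Cmod_rpowC_sub_1 (v : R) (a : CC) (N : nat) :
  0 < v -> 0 <= Re a <= INR N ->
  Cmod (rpowC v a - 1)%C <= Cmod a * (Rabs (v - 1) * (/ v + v ^ N)).
Proof.
  intros Hv [Ha HN]. pose proof (Cmod_ge_0 a) as Ca.
  assert (Iv : 0 < / v) by (apply Rinv_0_lt_compat; auto).
  assert (Pv : 0 < v ^ N) by (apply pow_lt; auto).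
  assert (K : forall M, 1 <= M -> Rpower v (Re a) <= M -> M * Rabs (ln v) <= Rabs (v - 1) * (/ v + v ^ N) ->
     Cmod (rpowC v a - 1)%C <= Cmod a * (Rabs (v - 1) * (/ v + v ^ N))).
  { intros M HM H1 H2. unfold rpowC. eapply Rle_trans.
    - apply Cmod_Cexp_sub_1 with (M := M); auto.
      replace (Re (a * RtoC (ln v))%C) with (Re a * ln v) by (unfold Re; simpl; ring). exact H1.
    - rewrite Cmod_mult, Cmod_R. nra. }
  destruct (Rle_lt_dec v 1) as [L|L].
  - apply K with 1; [lra| |].
    + rewrite <- (Rpower_1 1) by lra. rewrite Rpower_1 by lra.
      replace 1 with (Rpower 1 (Re a)) at 1.
      * apply Rle_Rpower_l; lra.
      * unfold Rpower. rewrite ln_1, Rmult_0_r. apply exp_0.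
    + assert (Q : ln v <= 0) by (rewrite <- ln_1; apply ln_le; lra).
      rewrite (Rabs_left1 (ln v)), (Rabs_left1 (v - 1)), Rmult_1_l by lra.
      assert (- ln v <= / v - 1).
      { rewrite <- ln_Rinv by auto. pose proof (exp_ineq1_le (ln (/ v))) as X. rewrite exp_ln in X by auto. lra. }
      assert (/ v - 1 = - (v - 1) * / v) by (field; lra).
      nra.
  - apply K with (v ^ N).
    + apply pow_R1_Rle; lra.
    + rewrite <- Rpower_pow by auto. apply Rle_Rpower; lra.
    + assert (Q : 0 <= ln v) by (rewrite <- ln_1; apply ln_le; lra).
      rewrite (Rabs_pos_eq (ln v)), (Rabs_pos_eq (v - 1)) by lra.
      pose proof (exp_ineq1_le (ln v)) as X. rewrite exp_ln in X by auto. nra.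
Qed.

Definition is_Clim (x : nat -> CC) (c : CC) : Prop := is_lim_seq (fun n => Cmod (x n - c)%C) 0.

Lemma is_Clim_unique (x : nat -> CC) (c d : CC) : is_Clim x c -> is_Clim x d -> c = d.
Proof.
  intros Hc Hd. apply Ceq_minus, Cmod_eq_0.
  pose proof (is_lim_seq_plus' _ _ _ _ Hc Hd) as H. rewrite Rplus_0_r in H.
  assert (L : is_lim_seq (fun _ => Cmod (c - d)%C) 0).
  { apply is_lim_seq_le_le with (fun _ => 0) (fun n => Cmod (x n - c)%C + Cmod (x n - d)%C); auto.
    - intros n. split; [apply Cmod_ge_0|].
      replace (c - d)%C with (- (x n - c) + (x n - d))%C by ring.
      eapply Rle_trans; [apply Cmod_triangle|]. rewrite Cmod_opp. lra.
    - apply is_lim_seq_const. }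
  pose proof (is_lim_seq_unique _ _ L) as U. rewrite Lim_seq_const in U. now inversion U.
Qed.

Lemma is_Clim_const (c : CC) : is_Clim (fun _ => c) c.
Proof.
  apply is_lim_seq_ext with (fun _ => 0); [|apply is_lim_seq_const].
  intros n. replace (c - c)%C with (RtoC 0) by ring. now rewrite Cmod_0.
Qed.

Lemma is_Clim_mult (x y : nat -> CC) (c d : CC) :
  is_Clim x c -> is_Clim y d -> is_Clim (fun n => (x n * y n)%C) (c * d)%C.
Proof.
  intros Hx Hy. unfold is_Clim in *.
  pose proof (is_lim_seq_mult' _ _ _ _ Hx Hy) as H1.
  pose proof (is_lim_seq_scal_l _ (Cmod c) _ Hy) as H2.
  pose proof (is_lim_seq_scal_l _ (Cmod d) _ Hx) as H3.
  pose proof (is_lim_seq_plus' _ _ _ _ H1 (is_lim_seq_plus' _ _ (Cmod c * 0) (Cmod d * 0) H2 H3)) as H.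
  rewrite !Rmult_0_r, !Rplus_0_r in H.
  apply is_lim_seq_le_le with (3 := H) (2 := is_lim_seq_const 0).
  intros n. split; [apply Cmod_ge_0|].
  replace (x n * y n - c * d)%C with ((x n - c) * (y n - d) + (c * (y n - d) + d * (x n - c)))%C by ring.
  eapply Rle_trans; [apply Cmod_triangle|]. rewrite Cmod_mult. apply Rplus_le_compat_l.
  eapply Rle_trans; [apply Cmod_triangle|]. rewrite !Cmod_mult. lra.
Qed.

(** The parameter [d] is fixed first, to make the bounded part small, and then [n] is taken large.
    This is the form in which AM-GM delivers the concentration estimate. *)
Lemma is_lim_seq_le_delta (x A B : nat -> R) (l : R) :
  (forall n, 0 <= x n) -> (forall n d, 0 < d -> x n <= d * A n + / d * B n) ->
  is_lim_seq A l -> is_lim_seq B 0 -> is_lim_seq x 0.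
Proof.
  intros Hx Hle HA HB. apply is_lim_seq_spec. intros eps.
  (* Eventually [A n < |l| + 1] and [B n < d^2 / 2], so the bound is below [d (|l| + 1) + d / 2 < d
     (|l| + 2) = eps / 2]. *)
  set (d := eps / 2 / (Rabs l + 2)).
  pose proof (Rabs_pos l) as Pl. pose proof (cond_pos eps) as Pe.
  assert (Hd : 0 < d) by (unfold d; repeat apply Rdiv_lt_0_compat; lra).
  assert (Hd2 : 0 < d * (d / 2)) by (apply Rmult_lt_0_compat; lra).
  apply is_lim_seq_spec in HA. apply is_lim_seq_spec in HB.
  destruct (HA (mkposreal 1 Rlt_0_1)) as [n1 H1]. destruct (HB (mkposreal _ Hd2)) as [n2 H2].
  exists (n1 + n2)%nat. intros n Hn. specialize (H1 n ltac:(lia)). specialize (H2 n ltac:(lia)).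
  simpl in H1, H2. specialize (Hle n d Hd). rewrite Rminus_0_r in *.
  rewrite Rabs_pos_eq by auto.
  apply Rabs_def2 in H1. apply Rabs_def2 in H2. pose proof (Rle_abs l).
  assert (A1 : d * A n < d * (Rabs l + 1)) by (apply Rmult_lt_compat_l; lra).
  assert (B1 : / d * B n < / d * (d * (d / 2))).
  { apply Rmult_lt_compat_l; [apply Rinv_0_lt_compat; auto | lra]. }
  replace (/ d * (d * (d / 2))) with (d / 2) in B1 by (field; lra).
  assert (E : d * (Rabs l + 2) = eps / 2) by (unfold d; field; lra).
  nra.
Qed.

(** * Asymptotics and non-vanishing of the Gamma function *)

(* With n = p + 2, the moment of v^k for v = u / n and the normalized weight u^(n-1) e^(-u); [mom_m1] is the case k = -1. *)
Definition mom (k p : nat) : R := INR (fact (p + 1 + k)) / (INR (fact (p + 1)) * INR (p + 2) ^ k).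

Lemma mom_S (k p : nat) : mom (S k) p = mom k p * (1 + INR k * / INR (p + 2)).
Proof.
  unfold mom. replace (p + 1 + S k)%nat with (S (p + 1 + k)) by lia.
  rewrite fact_simpl, mult_INR.
  assert (INR (p + 2) <> 0) by (apply not_0_INR; lia).
  assert (E : INR (S (p + 1 + k)) = INR (p + 2) + INR k) by (rewrite <- plus_INR; f_equal; lia).
  rewrite E. pose proof (INR_fact_neq_0 (p + 1)). simpl pow. field. repeat split; auto. apply pow_nonzero; auto.
Qed.

Lemma is_lim_seq_inv_INR_2 : is_lim_seq (fun p => / INR (p + 2)) 0.
Proof.
  replace (Finite 0) with (Rbar_inv p_infty) by reflexivity.
  apply is_lim_seq_inv; [|easy].
  apply is_lim_seq_incr_n with (u := INR). apply is_lim_seq_INR.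
Qed.

Lemma is_lim_seq_mom (k : nat) : is_lim_seq (mom k) 1.
Proof.
  induction k as [|k IH].
  - apply is_lim_seq_ext with (fun _ => 1); [|apply is_lim_seq_const].
    intros n. unfold mom. rewrite Nat.add_0_r. simpl pow. field. apply INR_fact_neq_0.
  - apply is_lim_seq_ext with (fun p => mom k p * (1 + INR k * / INR (p + 2))).
    { intros p. symmetry. apply mom_S. }
    replace (Finite 1) with (Finite (1 * (1 + INR k * 0))) by (f_equal; ring).
    apply is_lim_seq_mult'; auto. apply is_lim_seq_plus'; [apply is_lim_seq_const|].
    apply (is_lim_seq_scal_l _ (INR k) 0), is_lim_seq_inv_INR_2.
Qed.

(** This is [n (n-2)! / (n-1)! = n / (n-1)] for [n = p + 2]; starting at [n = 2] keeps the exponent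
    [n - 2] nonnegative. *)
Definition mom_m1 (p : nat) : R := 1 + / INR (p + 1).

Lemma is_lim_seq_mom_m1 : is_lim_seq mom_m1 1.
Proof.
  replace (Finite 1) with (Finite (1 + 0)) by (f_equal; ring).
  apply is_lim_seq_plus'; [apply is_lim_seq_const|].
  replace (Finite 0) with (Rbar_inv p_infty) by reflexivity.
  apply is_lim_seq_inv; [|easy].
  apply is_lim_seq_incr_n with (u := INR). apply is_lim_seq_INR.
Qed.

Lemma is_RInt_gen_Rplus {Fa Fb} {FFa : Filter Fa} {FFb : Filter Fb} (f g : R -> R) (lf lg : R) :
  is_RInt_gen f Fa Fb lf -> is_RInt_gen g Fa Fb lg -> is_RInt_gen (fun x => f x + g x) Fa Fb (lf + lg).
Proof. exact (is_RInt_gen_plus (V:=R_NormedModule) f g lf lg). Qed.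

Lemma is_RInt_gen_Rscal {Fa Fb} {FFa : Filter Fa} {FFb : Filter Fb} (c : R) (f : R -> R) (l : R) :
  is_RInt_gen f Fa Fb l -> is_RInt_gen (fun x => c * f x) Fa Fb (c * l).
Proof. exact (is_RInt_gen_scal (V:=R_NormedModule) f c l). Qed.

Lemma is_RInt_gen_pow_exp_scal (c : R) (n : nat) :
  is_RInt_gen (fun u => c * (u ^ n * exp (- u))) (at_right 0) (Rbar_locally p_infty) (c * INR (fact n)).
Proof. apply (is_RInt_gen_scal (V:=R_NormedModule)), is_RInt_gen_pow_exp. Qed.

(** Normalized integrals of the coefficients of [d] and [1/d] in [(d + (v-1)^2 / d) (1/v + v^N)].
    All moments tend to 1, so [spread_A] tends to 2, while the second differences in [spread_B] tend
    to 0. *)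
Definition spread_A (N p : nat) : R := mom_m1 p + mom N p.
Definition spread_B (N p : nat) : R :=
  mom 1 p - 2 * mom 0 p + mom_m1 p + (mom (N + 2) p - 2 * mom (N + 1) p + mom N p).

(* AM-GM bounds |v - 1| by d + (v-1)^2 / d, whose integral is a combination of moments. *)
Lemma is_RInt_gen_spread (N p : nat) (d : R) :
  0 < d ->
  is_RInt_gen (fun u => (d + / d * (u / INR (p + 2) - 1) ^ 2) * (/ (u / INR (p + 2)) + (u / INR (p + 2)) ^ N)
                        * (u ^ (p + 1) * exp (- u)))
    (at_right 0) (Rbar_locally p_infty)
    (INR (fact (p + 1)) * (d * spread_A N p + / d * spread_B N p)).
Proof.
  intros Hd. set (y := INR (p + 2)).
  assert (Hy : 0 < y) by (apply lt_0_INR; lia).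
  pose proof (INR_fact_lt_0 (p + 1)) as Hf.
  pose proof (fun k => is_RInt_gen_pow_exp_scal (/ y ^ k) (p + 1 + k)) as M.
  pose proof (is_RInt_gen_pow_exp_scal y p) as M0.
  set (h := fun k u => / y ^ k * (u ^ (p + 1 + k) * exp (- u))) in *.
  set (h0 := fun u => y * (u ^ p * exp (- u))) in *.
  assert (EM : forall k, / y ^ k * INR (fact (p + 1 + k)) = INR (fact (p + 1)) * mom k p).
  { intros k. unfold mom. fold y. field. split; [apply pow_nonzero; lra | lra]. }
  assert (EM0 : y * INR (fact p) = INR (fact (p + 1)) * mom_m1 p).
  { unfold mom_m1, y. rewrite (Nat.add_1_r p), fact_simpl, mult_INR.
    replace (p + 2)%nat with (S (S p)) by lia. rewrite (S_INR (S p)).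
    field. apply not_0_INR; lia. }
  rewrite EM0 in M0.
  assert (T : is_RInt_gen (fun u => d * (h0 u + h N u) + / d * ((h 1%nat u + -2 * h 0%nat u + h0 u) + (h (N + 2)%nat u + -2 * h (N + 1)%nat u + h N u)))
     (at_right 0) (Rbar_locally p_infty)
     (d * (INR (fact (p + 1)) * mom_m1 p + / y ^ N * INR (fact (p + 1 + N)))
      + / d * ((/ y ^ 1 * INR (fact (p + 1 + 1)) + -2 * (/ y ^ 0 * INR (fact (p + 1 + 0))) + INR (fact (p + 1)) * mom_m1 p)
          + (/ y ^ (N+2) * INR (fact (p + 1 + (N+2))) + -2 * (/ y ^ (N+1) * INR (fact (p + 1 + (N+1)))) + / y ^ N * INR (fact (p + 1 + N)))))).
  { apply is_RInt_gen_Rplus; apply is_RInt_gen_Rscal.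
    - apply is_RInt_gen_Rplus; [exact M0 | apply M].
    - apply is_RInt_gen_Rplus; [apply is_RInt_gen_Rplus; [|exact M0] | apply is_RInt_gen_Rplus; [|exact (M N)]].
      + apply is_RInt_gen_Rplus; [exact (M 1%nat) | apply is_RInt_gen_Rscal, (M 0%nat)].
      + apply is_RInt_gen_Rplus; [exact (M (N + 2)%nat) | apply is_RInt_gen_Rscal, (M (N + 1)%nat)]. }
  rewrite !EM in T. unfold spread_A, spread_B.
  match type of T with is_RInt_gen _ _ _ ?a => match goal with |- is_RInt_gen _ _ _ ?b =>
    replace b with a by ring end end.
  revert T. apply is_RInt_gen_ext.
  exists (fun x => 0 < x) (fun x => 0 < x); [apply at_right_pos | apply p_infty_pos|].
  intros a b Ha Hb x Hx. simpl in Hx. assert (Hx0 : 0 < x) by (apply (is_interval_gt 0 a b); auto; lra).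
  unfold h, h0.
  match goal with |- @eq _ ?a ?b => change (@eq R a b) end.
  rewrite !pow_add. unfold Rdiv. rewrite (Rpow_mult_distr x (/ y) N), pow_inv. simpl pow. field. repeat split; try lra; apply pow_nonzero; lra.
Qed.

(** With [y = p + 2] and [u = y v], the difference is the integral of [y^a (v^a - 1)] against the
    weight [u^(p+1) e^(-u)], whose total mass is [(p+1)!]. *)
Lemma CGamma_spread (a : CC) (N p : nat) (d : R) :
  0 < Re a <= INR N -> 0 < d ->
  Cmod (CGamma (a + RtoC (INR (p + 2))) - rpowC (INR (p + 2)) a * RtoC (INR (fact (p + 1))))%C
  <= Rpower (INR (p + 2)) (Re a) * Cmod a * (INR (fact (p + 1)) * (d * spread_A N p + / d * spread_B N p)).
Proof.
  intros [Ha HN] Hd. set (y := INR (p + 2)).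
  assert (Hy : 0 < y) by (apply lt_0_INR; lia).
  assert (G1 : is_Cint (gint (a + RtoC y)) (at_right 0) (Rbar_locally p_infty) (CGamma (a + RtoC y))).
  { apply is_Cint_gint. unfold Re in *; simpl. lra. }
  pose proof (is_Cint_mult (- rpowC y a)%C _ _ (is_Cint_RtoC _ _ (is_RInt_gen_pow_exp (p + 1)))) as G2.
  pose proof (is_Cint_plus _ _ _ _ G1 G2) as G.
  replace (CGamma (a + RtoC y) - rpowC y a * RtoC (INR (fact (p + 1))))%C
    with (CGamma (a + RtoC y) + - rpowC y a * RtoC (INR (fact (p + 1))))%C by ring.
  pose proof (is_RInt_gen_Rscal (Rpower y (Re a) * Cmod a) _ _ (is_RInt_gen_spread N p d Hd)) as B.
  fold y in B.
  revert G B. apply (is_Cint_norm (fun x => 0 < x)).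
  - apply is_interval_gt.
  - apply at_right_pos.
  - apply p_infty_pos.
  - exists (fun x => x < 1) (fun x => 1 < x).
    + exists (mkposreal 1 Rlt_0_1). intros z Hz _. unfold ball in Hz; simpl in Hz.
      unfold AbsRing_ball, abs, minus, plus, opp in Hz; simpl in Hz. apply Rabs_def2 in Hz. lra.
    + apply p_infty_pos.
    + intros; simpl; lra.
  - intros u Hu. set (v := u / y).
    assert (Hv : 0 < v) by (apply Rdiv_lt_0_compat; auto).
    assert (Eu : u = y * v) by (unfold v; field; lra).
    assert (R1 : rpowC u a = (rpowC y a * rpowC v a)%C).
    { unfold rpowC. rewrite <- Cexp_plus. f_equal. rewrite Eu, ln_mult, RtoC_plus by auto. ring. }
    replace (gint (a + RtoC y) u + - rpowC y a * RtoC (u ^ (p + 1) * exp (- u)))%C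
      with (rpowC y a * (rpowC v a - 1) * RtoC (u ^ (p + 1) * exp (- u)))%C.
    2:{ unfold gint. replace (a + RtoC y - 1)%C with (a + RtoC (INR (p + 1)))%C.
        - rewrite rpowC_plus, rpowC_INR, R1, RtoC_mult by auto. ring.
        - unfold y. replace (p + 2)%nat with (S (p + 1)) by lia. rewrite S_INR, RtoC_plus. ring. }
    assert (Hw : 0 < u ^ (p + 1) * exp (- u)) by (apply Rmult_lt_0_compat; [apply pow_lt; auto | apply exp_pos]).
    fold v. set (w := u ^ (p + 1) * exp (- u)) in *.
    rewrite !Cmod_mult, Cmod_rpowC, Cmod_R, (Rabs_pos_eq w) by lra.
    rewrite !Rmult_assoc. apply Rmult_le_compat_l; [left; apply exp_pos|].
    rewrite <- !Rmult_assoc. apply Rmult_le_compat_r; [lra|].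
    eapply Rle_trans; [apply (Cmod_rpowC_sub_1 v a N); lra|].
    rewrite (Rmult_assoc (Cmod a)).
    apply Rmult_le_compat_l; [apply Cmod_ge_0|]. apply Rmult_le_compat_r.
    + pose proof (Rinv_0_lt_compat v Hv). pose proof (pow_lt v N Hv). lra.
    + assert (AG : Rabs (v - 1) <= d + / d * (v - 1) ^ 2).
      { rewrite <- (pow2_abs (v - 1)). pose proof (Rabs_pos (v - 1)) as Q. set (t := Rabs (v - 1)) in *.
        apply Rmult_le_reg_l with d; auto.
        replace (d * (d + / d * t ^ 2)) with (d ^ 2 + t ^ 2) by (field; lra). nra. }
      exact AG.
Qed.

(** [Gamma(a + n) / (n^a Gamma(n))] with [n = p + 2]. *)
Definition Gratio (a : CC) (p : nat) : CC :=
  (CGamma (a + RtoC (INR (p + 2))) / (rpowC (INR (p + 2)) a * RtoC (INR (fact (p + 1)))))%C.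

Lemma is_Clim_Gratio (a : CC) : 0 < Re a -> is_Clim (Gratio a) 1.
Proof.
  intros Ha. destruct (nat_bound (Re a)) as [N HN].
  apply is_lim_seq_le_delta with (A := fun p => Cmod a * spread_A N p) (B := fun p => Cmod a * spread_B N p) (l := Cmod a * (1 + 1)).
  - intros n. apply Cmod_ge_0.
  - intros p d Hd. pose proof (CGamma_spread a N p d (conj Ha HN) Hd) as H.
    unfold Gratio. set (y := INR (p + 2)) in *.
    pose proof (INR_fact_lt_0 (p + 1)) as Hf.
    set (D := (rpowC y a * RtoC (INR (fact (p + 1))))%C) in *.
    assert (HD : Cmod D = Rpower y (Re a) * INR (fact (p + 1))).
    { unfold D. rewrite Cmod_mult, Cmod_rpowC, Cmod_R, Rabs_pos_eq; lra. }
    assert (PD : 0 < Cmod D) by (rewrite HD; apply Rmult_lt_0_compat; [apply exp_pos | auto]).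
    assert (D0 : D <> 0) by (apply Cmod_gt_0; auto).
    replace (CGamma (a + RtoC y) / D - 1)%C with ((CGamma (a + RtoC y) - D) / D)%C by (field; auto).
    rewrite Cmod_div by auto. apply Rmult_le_reg_r with (Cmod D); auto.
    replace (Cmod (CGamma (a + RtoC y) - D)%C / Cmod D * Cmod D) with (Cmod (CGamma (a + RtoC y) - D)%C) by (field; lra).
    eapply Rle_trans; [exact H|]. right. rewrite HD. ring.
  - apply (is_lim_seq_scal_l _ (Cmod a) (1 + 1)). apply is_lim_seq_plus'; [apply is_lim_seq_mom_m1 | apply is_lim_seq_mom].
  - replace (Finite 0) with (Rbar_mult (Cmod a) (1 - 2 * 1 + 1 + (1 - 2 * 1 + 1))) by (simpl; f_equal; ring).
    apply is_lim_seq_scal_l. unfold spread_B.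
    pose proof (fun k => is_lim_seq_scal_l _ 2 1 (is_lim_seq_mom k)) as M2.
    apply is_lim_seq_plus'; (apply is_lim_seq_plus'; [|apply is_lim_seq_mom || apply is_lim_seq_mom_m1]);
      (apply is_lim_seq_minus'; [apply is_lim_seq_mom | apply M2]).
Qed.

(** By the functional equation a zero at [a] would be a zero at every [a + n], so [Gratio a] would
    vanish identically instead of tending to 1. *)
Lemma CGamma_neq0 (a : CC) : 0 < Re a -> CGamma a <> 0.
Proof.
  intros Ha E.
  assert (Z : forall n, CGamma (a + RtoC (INR n))%C = 0).
  { induction n as [|n IH].
    - rewrite <- E. f_equal. simpl. ring.
    - rewrite S_INR, RtoC_plus, Cplus_assoc, CGamma_S, IH; [ring|].
      pose proof (pos_INR n). unfold Re in *; simpl. lra. }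
  assert (H : is_Clim (Gratio a) 0).
  { apply is_lim_seq_ext with (fun _ => 0); [|apply is_lim_seq_const].
    intros n. unfold Gratio. rewrite Z. unfold Cdiv. rewrite Cmult_0_l.
    replace (0 - 0)%C with (RtoC 0) by ring. now rewrite Cmod_0. }
  pose proof (is_Clim_unique _ _ _ H (is_Clim_Gratio a Ha)) as F.
  apply (f_equal Re) in F. simpl in F. lra.
Qed.

(** * Integrals of powers of the sine *)

Lemma at_left_lt (a b : R) : a < b -> at_left b (fun x => a < x < b).
Proof.
  intros H. assert (P : 0 < b - a) by lra. exists (mkposreal _ P). intros x Hx Hb.
  unfold ball in Hx; simpl in Hx; unfold AbsRing_ball, abs, minus, plus, opp in Hx; simpl in Hx.
  apply Rabs_def2 in Hx. lra.
Qed.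

Lemma at_right_lt (a b : R) : a < b -> at_right a (fun x => a < x < b).
Proof.
  intros H. assert (P : 0 < b - a) by lra. exists (mkposreal _ P). intros x Hx Hb.
  unfold ball in Hx; simpl in Hx; unfold AbsRing_ball, abs, minus, plus, opp in Hx; simpl in Hx.
  apply Rabs_def2 in Hx. lra.
Qed.

Lemma filterlim_PI_minus : filterlim (fun x => PI - x) (at_left PI) (at_right 0).
Proof.
  intros P [eps HP]. exists eps. intros x Hx Hlt. apply HP; [|lra].
  unfold ball in *; simpl in *; unfold AbsRing_ball, abs, minus, plus, opp in *; simpl in *.
  replace (PI - x + - 0) with (- (x + - PI)) by ring. rewrite Rabs_Ropp. exact Hx.
Qed.

Lemma is_Cderive_rpowC_sin (s : CC) (x : R) :
  0 < x < PI -> is_Cderive (fun t => rpowC (sin t) s) x (RtoC (cos x) * (s * rpowC (sin x) (s - 1)))%C.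
Proof.
  intros H. apply (is_Cderive_comp (fun u => rpowC u s) sin).
  - apply is_Cderive_rpowC, sin_gt_0; lra.
  - auto_derive; auto. ring.
Qed.

Lemma sin_rpow_lim (q : R -> R) (M : R) (s : CC) :
  0 < Re s -> 0 <= M -> (forall x, Rabs (q x) <= M) ->
  filterlim (fun x => (RtoC (q x) * rpowC (sin x) s)%C) (at_right 0) (locally (RtoC 0 : C_R_NormedModule)) /\
  filterlim (fun x => (RtoC (q x) * rpowC (sin x) s)%C) (at_left PI) (locally (RtoC 0 : C_R_NormedModule)).
Proof.
  intros Hs HM Hq. split.
  - apply filterlim_C0 with (fun u => M * Rpower u (Re s)).
    + apply filter_imp with (2 := at_right_lt 0 PI PI_RGT_0). intros x Hx.
      rewrite Cmod_mult, Cmod_R, Cmod_rpowC. apply Rmult_le_compat; auto using Rabs_pos.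
      * left; apply exp_pos.
      * apply Rle_Rpower_l; [lra|]. split; [apply sin_gt_0; lra | left; apply sin_lt_x; lra].
    + apply filterlim_scal_0, filterlim_Rpower_0, Hs.
  - apply filterlim_C0 with (fun u => M * Rpower (PI - u) (Re s)).
    + apply filter_imp with (2 := at_left_lt 0 PI PI_RGT_0). intros x Hx.
      rewrite Cmod_mult, Cmod_R, Cmod_rpowC. apply Rmult_le_compat; auto using Rabs_pos.
      * left; apply exp_pos.
      * apply Rle_Rpower_l; [lra|]. split; [apply sin_gt_0; lra |].
        rewrite <- sin_PI_x. left; apply sin_lt_x; lra.
    + apply filterlim_scal_0.
      apply (filterlim_comp _ _ _ (fun x => PI - x) (fun u => Rpower u (Re s)) _ (at_right 0));
        [apply filterlim_PI_minus | apply filterlim_Rpower_0, Hs].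
Qed.

Notation is_psi_int f l := (is_Cint f (at_right 0) (at_left PI) l).

Lemma is_psi_int_ext (f g : R -> CC) (l : CC) :
  (forall x, 0 < x < PI -> f x = g x) -> is_psi_int f l -> is_psi_int g l.
Proof.
  apply is_Cint_ext.
  - apply is_interval_lt_lt.
  - apply at_right_lt, PI_RGT_0.
  - apply at_left_lt, PI_RGT_0.
Qed.

(** The integrand is the derivative of [q(x) sin^(mu+1) x], whose boundary values vanish since
    [Re mu + 1 > 0]. All recursions for sine integrals are instances; [ddq] supplies the continuity
    of the integrand. *)
Lemma sin_parts (q dq ddq : R -> R) (M : R) (mu : CC) :
  -1 < Re mu -> 0 <= M -> (forall x, Rabs (q x) <= M) ->
  (forall x, is_derive q x (dq x)) -> (forall x, is_derive dq x (ddq x)) ->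
  is_psi_int (fun x => ((RtoC (dq x * sin x) + (mu + 1) * RtoC (q x * cos x)) * rpowC (sin x) mu)%C) (RtoC 0).
Proof.
  intros Hmu HM Hq Hdq Hddq.
  destruct (sin_rpow_lim q M (mu + 1)%C) as [L0 L1]; auto.
  { unfold Re in *; simpl; lra. }
  replace (RtoC 0) with (0 - 0)%C at 1 by ring.
  apply (is_Cint_ftc (fun x => 0 < x < PI) (fun x => (RtoC (q x) * rpowC (sin x) (mu + 1))%C)); auto.
  - apply is_interval_lt_lt.
  - apply at_right_lt, PI_RGT_0.
  - apply at_left_lt, PI_RGT_0.
  - intros x Hx. assert (Sx : 0 < sin x) by (apply sin_gt_0; lra).
    eapply is_Cderive_eq.
    + apply is_Cderive_mult; [apply is_Cderive_RtoC, Hdq | apply is_Cderive_rpowC_sin, Hx].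
    + cbv beta. rewrite rpowC_add1 by auto. replace (mu + 1 - 1)%C with mu by ring. rewrite !RtoC_mult. ring.
  - intros x Hx. eexists. apply is_Cderive_mult; [|apply is_Cderive_rpowC_sin, Hx].
    apply is_Cderive_plus.
    + apply is_Cderive_RtoC. apply (is_derive_mult dq sin); [apply Hddq | apply is_derive_sin | intros; apply Rmult_comm].
    + apply is_Cderive_mult; [apply is_Cderive_const|]. apply is_Cderive_RtoC.
      apply (is_derive_mult q cos); [apply Hdq | apply is_derive_cos | intros; apply Rmult_comm].
Qed.

Definition Wint (mu : CC) : CC := CInt_gen (fun x => rpowC (sin x) mu) (at_right 0) (at_left PI).

(** [k = 0] gives the moments of the cosine, [k = 1] and [k = -1] the integrals of [(cos x + 1)^n]
    and [(cos x - 1)^n]. For [n = 0] the factor [INR n] removes the meaningless power [pred n]. *)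
Lemma cos_pow_parts (k : R) (n : nat) (mu : CC) :
  -1 < Re mu ->
  is_psi_int (fun x => ((RtoC (- INR n * (cos x + k) ^ pred n * sin x * sin x)
                         + (mu + 1) * RtoC ((cos x + k) ^ n * cos x)) * rpowC (sin x) mu)%C) (RtoC 0).
Proof.
  intros H.
  apply (sin_parts (fun x => (cos x + k) ^ n) (fun x => - INR n * (cos x + k) ^ pred n * sin x)
    (fun x => INR n * INR (pred n) * (cos x + k) ^ pred (pred n) * sin x * sin x - INR n * (cos x + k) ^ pred n * cos x)
    ((1 + Rabs k) ^ n)); auto.
  - apply pow_le. pose proof (Rabs_pos k). lra.
  - intros x. rewrite <- RPow_abs. apply pow_incr. split; [apply Rabs_pos|].
    eapply Rle_trans; [apply Rabs_triang|]. apply Rplus_le_compat_r, Rabs_le, COS_bound.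
  - intros x. auto_derive; auto. ring.
  - intros x. auto_derive; auto. ring.
Qed.

(** For [q = cos], the identity [(mu + 1) cos^2 - sin^2 = (mu + 1) - (mu + 2) sin^2] trades the
    exponent [mu + 2] for [mu], so convergence extends from [Re mu >= 0] to [-1 < Re mu]. *)
Lemma is_psi_int_sin_step (mu l : CC) :
  -1 < Re mu -> is_psi_int (fun x => rpowC (sin x) (mu + 2)%C) l ->
  is_psi_int (fun x => rpowC (sin x) mu) ((mu + 2) / (mu + 1) * l)%C.
Proof.
  intros H I.
  assert (H1 : (mu + 1)%C <> 0) by (apply Cneq0_Re; unfold Re in *; simpl; lra).
  pose proof (cos_pow_parts 0 1 mu H) as J.
  pose proof (is_Cint_mult (/ (mu + 1))%C _ _ (is_Cint_plus _ _ _ _ J (is_Cint_mult (mu + 2)%C _ _ I))) as K.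
  replace ((mu + 2) / (mu + 1) * l)%C with (/ (mu + 1) * (0 + (mu + 2) * l))%C by (field; auto).
  revert K. apply is_psi_int_ext. intros x Hx.
  assert (Sx : 0 < sin x) by (apply sin_gt_0; lra).
  replace (mu + 2)%C with (mu + 1 + 1)%C at 2 by ring. rewrite !rpowC_add1 by auto.
  pose proof (sin2_cos2 x) as SC. unfold Rsqr in SC.
  replace ((cos x + 0) ^ 1 * cos x) with (1 - sin x * sin x) by (simpl; lra).
  replace (- INR 1 * (cos x + 0) ^ pred 1 * sin x * sin x) with (- (sin x * sin x)) by (simpl; lra).
  rewrite RtoC_minus, RtoC_opp, RtoC_mult. field; auto.
Qed.

Lemma is_psi_int_sin_ge0 (mu : CC) : 0 <= Re mu -> exists l, is_psi_int (fun x => rpowC (sin x) mu) l.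
Proof.
  intros H.
  apply (is_Cint_dominated (fun x => 0 < x < PI) (fun x => rpowC (sin x) mu) (fun x => x) (fun _ => 1) 0 PI).
  - apply is_interval_lt_lt.
  - apply at_right_lt, PI_RGT_0.
  - apply at_left_lt, PI_RGT_0.
  - intros x Hx. eexists. apply is_Cderive_rpowC_sin, Hx.
  - intros x Hx. assert (Sx : 0 < sin x) by (apply sin_gt_0; lra). rewrite Cmod_rpowC.
    replace 1 with (Rpower 1 (Re mu)).
    + apply Rle_Rpower_l; [lra|]. pose proof (SIN_bound x); lra.
    + unfold Rpower. rewrite ln_1, Rmult_0_r. apply exp_0.
  - intros x Hx. apply (is_derive_id (K:=R_AbsRing)).
  - intros x Hx. apply continuous_const.
  - apply (filterlim_at_right_continuous (fun x => x) 0), continuous_id.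
  - apply (filterlim_at_left_continuous (fun x => x) PI), continuous_id.
Qed.

Lemma is_psi_int_sin (mu : CC) : -1 < Re mu -> is_psi_int (fun x => rpowC (sin x) mu) (Wint mu).
Proof.
  intros H.
  assert (E : exists l, is_psi_int (fun x => rpowC (sin x) mu) l).
  { destruct (is_psi_int_sin_ge0 (mu + 2)%C) as [l Hl]; [unfold Re in *; simpl; lra|].
    exists ((mu + 2) / (mu + 1) * l)%C. apply is_psi_int_sin_step; auto. }
  destruct E as [l Hl]. unfold Wint. rewrite (is_Cint_unique _ l); auto.
Qed.

Lemma Wint_step (mu : CC) : -1 < Re mu -> Wint (mu + 2)%C = ((mu + 1) / (mu + 2) * Wint mu)%C.
Proof.
  intros H.
  assert (H1 : (mu + 1)%C <> 0) by (apply Cneq0_Re; unfold Re in *; simpl; lra).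
  assert (H2 : (mu + 2)%C <> 0) by (apply Cneq0_Re; unfold Re in *; simpl; lra).
  assert (I : is_psi_int (fun x => rpowC (sin x) (mu + 2)%C) (Wint (mu + 2)%C)).
  { apply is_psi_int_sin. unfold Re in *; simpl; lra. }
  apply is_psi_int_sin_step in I; auto.
  pose proof (is_Cint_unique _ _ I : Wint mu = _) as E.
  rewrite E. field; auto.
Qed.

(** The moments of [cos^i x] against [sin^mu x] on [(0, pi)]. The first one vanishes because
    [cos x sin^mu x] has the primitive [sin^(mu+1) x / (mu + 1)]; the others follow by parts, with
    ratio [(i+1) / (i+2+mu)] from [i] to [i + 2]. The recursive form makes the comparison with
    Bessel coefficients purely algebraic. *)
Fixpoint wc (mu : CC) (i : nat) : CC :=
  match i with
  | O => Wint mu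
  | S O => RtoC 0
  | S (S i' as k) => (RtoC (INR k) / (RtoC (INR k + 1) + mu) * wc mu i')%C
  end.

Lemma is_psi_int_wc (mu : CC) (i : nat) :
  -1 < Re mu -> is_psi_int (fun x => (RtoC (cos x ^ i) * rpowC (sin x) mu)%C) (wc mu i).
Proof.
  intros H.
  assert (H1 : (mu + 1)%C <> 0) by (apply Cneq0_Re; unfold Re in *; simpl; lra).
  enough (G : is_psi_int (fun x => (RtoC (cos x ^ i) * rpowC (sin x) mu)%C) (wc mu i) /\
              is_psi_int (fun x => (RtoC (cos x ^ S i) * rpowC (sin x) mu)%C) (wc mu (S i))) by apply G.
  induction i as [|i [IH1 IH2]]; split; auto.
  - pose proof (is_psi_int_sin mu H) as I. revert I. apply is_psi_int_ext. intros x _. simpl. ring.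
  - pose proof (is_Cint_mult (/ (mu + 1))%C _ _ (cos_pow_parts 0 0 mu H)) as I.
    simpl wc. replace (RtoC 0) with (/ (mu + 1) * 0)%C by ring.
    revert I. apply is_psi_int_ext. intros x _.
    replace (- INR 0 * (cos x + 0) ^ pred 0 * sin x * sin x) with 0 by (simpl; ring).
    replace ((cos x + 0) ^ 0 * cos x) with (cos x ^ 1) by (simpl; ring). field; auto.
  - assert (H2 : (RtoC (INR (S i) + 1) + mu)%C <> 0).
    { apply Cneq0_Re. pose proof (pos_INR (S i)). change (INR (S i) + 1 + Re mu <> 0). lra. }
    pose proof (cos_pow_parts 0 (S i) mu H) as J.
    pose proof (is_Cint_mult (/ (RtoC (INR (S i) + 1) + mu))%C _ _ (is_Cint_plus _ _ _ _ J (is_Cint_mult (RtoC (INR (S i))) _ _ IH1))) as K.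
    change (wc mu (S (S i))) with (RtoC (INR (S i)) / (RtoC (INR (S i) + 1) + mu) * wc mu i)%C.
    replace (RtoC (INR (S i)) / (RtoC (INR (S i) + 1) + mu) * wc mu i)%C
      with (/ (RtoC (INR (S i) + 1) + mu) * (0 + RtoC (INR (S i)) * wc mu i))%C by (field; auto).
    revert K. apply is_psi_int_ext. intros x Hx.
    pose proof (sin2_cos2 x) as SC. unfold Rsqr in SC.
    rewrite Rplus_0_r. change (pred (S i)) with i.
    replace (- INR (S i) * cos x ^ i * sin x * sin x) with (INR (S i) * (cos x ^ S (S i) - cos x ^ i)).
    2:{ replace (- INR (S i) * cos x ^ i * sin x * sin x) with (- INR (S i) * cos x ^ i * (sin x * sin x)) by ring.
        replace (sin x * sin x) with (1 - cos x * cos x) by lra. simpl pow. ring. }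
    replace (cos x ^ S i * cos x) with (cos x ^ S (S i)) by (simpl; ring).
    rewrite RtoC_mult, RtoC_minus, RtoC_plus. field. rewrite RtoC_plus in H2; exact H2.
Qed.

(** The integral of [(cos x + k)^n cos^i x sin^mu x]. The second index lets one factor [cos x + k]
    be expanded at a time; for [k = -1] the recursion is the finite difference of the moments, as in
    [iterdiff]. *)
Fixpoint cosdiff (mu : CC) (k : R) (n i : nat) : CC :=
  match n with
  | O => wc mu i
  | S m => (cosdiff mu k m (S i) + RtoC k * cosdiff mu k m i)%C
  end.

Lemma is_psi_int_cosdiff (mu : CC) (k : R) (n i : nat) :
  -1 < Re mu ->
  is_psi_int (fun x => (RtoC ((cos x + k) ^ n * cos x ^ i) * rpowC (sin x) mu)%C) (cosdiff mu k n i).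
Proof.
  intros H. revert i. induction n as [|n IH]; intros i.
  - pose proof (is_psi_int_wc mu i H) as I. revert I. apply is_psi_int_ext. intros x _. simpl. f_equal. f_equal. ring.
  - pose proof (is_Cint_plus _ _ _ _ (IH (S i)) (is_Cint_mult (RtoC k) _ _ (IH i))) as I.
    simpl cosdiff. revert I. apply is_psi_int_ext. intros x _.
    replace ((cos x + k) ^ S n * cos x ^ i) with ((cos x + k) ^ n * cos x ^ S i + k * ((cos x + k) ^ n * cos x ^ i)) by (simpl; ring).
    rewrite RtoC_plus, (RtoC_mult k). ring.
Qed.

(** When [k^2 = 1], [sin^2 = (k - cos)(k + cos)] restores the power lost by differentiating
    [(cos + k)^n], so the integration by parts closes into a recursion with a single preceding
    term. *)
Lemma cosdiff_step (mu : CC) (k : R) (n : nat) :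
  -1 < Re mu -> k * k = 1 ->
  ((RtoC (INR n) + mu + 1) * cosdiff mu k (S n) 0 = RtoC k * (2 * RtoC (INR n) + mu + 1) * cosdiff mu k n 0)%C.
Proof.
  intros H Hk.
  pose proof (cos_pow_parts k n mu H) as J.
  pose proof (is_psi_int_cosdiff mu k (S n) 0 H) as I1. pose proof (is_psi_int_cosdiff mu k n 0 H) as I0.
  pose proof (is_Cint_plus _ _ _ _ (is_Cint_mult (RtoC (INR n) + mu + 1)%C _ _ I1)
                (is_Cint_mult (- (RtoC k * (2 * RtoC (INR n) + mu + 1)))%C _ _ I0)) as K.
  cut (RtoC 0 = ((RtoC (INR n) + mu + 1) * cosdiff mu k (S n) 0 + - (RtoC k * (2 * RtoC (INR n) + mu + 1)) * cosdiff mu k n 0)%C).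
  { intros E. apply Ceq_minus. rewrite E. ring. }
  rewrite <- (is_Cint_unique _ _ J). apply is_Cint_unique. revert K. apply is_psi_int_ext. intros x _.
  pose proof (sin2_cos2 x) as SC. unfold Rsqr in SC.
  replace (- INR n * (cos x + k) ^ pred n * sin x * sin x) with (INR n * ((cos x + k) ^ n * (cos x - k))).
  2:{ destruct n as [|n]; [simpl; ring|].
      replace (- INR (S n) * (cos x + k) ^ pred (S n) * sin x * sin x)
        with (- INR (S n) * (cos x + k) ^ n * (sin x * sin x)) by (simpl; ring).
      replace (sin x * sin x) with (k * k - cos x * cos x) by lra. simpl pow. ring. }
  simpl pow. rewrite !Rmult_1_r. repeat (rewrite RtoC_mult || rewrite RtoC_minus || rewrite RtoC_plus). ring.
Qed.

(* pi - x exchanges the two integrals; the recursion gives this without a change of variable. *)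
Lemma cosdiff_m1 (mu : CC) (n : nat) :
  -1 < Re mu -> cosdiff mu (-1) n 0 = (RtoC ((-1) ^ n) * cosdiff mu 1 n 0)%C.
Proof.
  intros H. induction n as [|n IH]; [simpl; ring|].
  assert (H1 : (RtoC (INR n) + mu + 1)%C <> 0).
  { apply Cneq0_Re. pose proof (pos_INR n). unfold Re in *; simpl. lra. }
  pose proof (cosdiff_step mu (-1) n H ltac:(ring)) as E1. pose proof (cosdiff_step mu 1 n H ltac:(ring)) as E2.
  rewrite IH in E1.
  replace (cosdiff mu (-1) (S n) 0) with (/ (RtoC (INR n) + mu + 1) * ((RtoC (INR n) + mu + 1) * cosdiff mu (-1) (S n) 0))%C by (field; auto).
  replace (cosdiff mu 1 (S n) 0) with (/ (RtoC (INR n) + mu + 1) * ((RtoC (INR n) + mu + 1) * cosdiff mu 1 (S n) 0))%C by (field; auto).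
  rewrite E1, E2. simpl pow. rewrite RtoC_mult. field. auto.
Qed.

(** * The Beta identity *)

Definition omega (k : nat) : R := Re (Wint (RtoC (INR k))).

Lemma is_RInt_gen_omega (k : nat) : is_RInt_gen (fun x => sin x ^ k) (at_right 0) (at_left PI) (omega k).
Proof.
  assert (H : -1 < Re (RtoC (INR k))) by (simpl; pose proof (pos_INR k); lra).
  pose proof (is_Cint_Re _ _ (is_psi_int_sin _ H)) as E.
  revert E. apply is_RInt_gen_ext.
  exists (fun x => 0 < x < PI) (fun x => 0 < x < PI); [apply at_right_lt, PI_RGT_0 | apply at_left_lt, PI_RGT_0 |].
  intros a b Ha Hb x Hx. simpl in Hx. assert (Hx0 : 0 < x < PI) by (apply (is_interval_lt_lt 0 PI a b); auto; lra).
  rewrite rpowC_INR by (apply sin_gt_0; lra). reflexivity.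
Qed.

Lemma Wint_1 : Wint 1 = RtoC 2.
Proof.
  unfold Wint; apply is_Cint_unique.
  assert (E : is_RInt_gen sin (at_right 0) (at_left PI) (1 - (- 1))).
  { apply (is_RInt_gen_ftc (V:=R_CompleteNormedModule) (fun x => 0 < x < PI) (fun x => - cos x)).
    - apply is_interval_lt_lt.
    - apply at_right_lt, PI_RGT_0.
    - apply at_left_lt, PI_RGT_0.
    - intros x Hx. auto_derive; auto. ring.
    - intros x Hx. apply continuous_sin.
    - replace (- 1) with ((fun x => - cos x) 0) by (simpl; rewrite cos_0; ring).
      apply (filterlim_at_right_continuous (fun x => - cos x) 0).
      apply (ex_derive_continuous (V:=R_NormedModule) (fun x => - cos x) 0). auto_derive; auto.
    - replace 1 with ((fun x => - cos x) PI) by (simpl; rewrite cos_PI; ring).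
      apply (filterlim_at_left_continuous (fun x => - cos x) PI).
      apply (ex_derive_continuous (V:=R_NormedModule) (fun x => - cos x) PI). auto_derive; auto. }
  apply is_Cint_RtoC in E. replace (1 - - 1) with 2 in E by ring.
  revert E. apply is_psi_int_ext. intros x Hx. rewrite rpowC_1; auto. apply sin_gt_0; lra.
Qed.

Lemma omega_step (k : nat) : omega (k + 2) = (INR k + 1) / (INR k + 2) * omega k.
Proof.
  assert (H : -1 < Re (RtoC (INR k))) by (simpl; pose proof (pos_INR k); lra).
  pose proof (pos_INR k).
  unfold omega. rewrite plus_INR. simpl (INR 2). rewrite RtoC_plus.
  change (RtoC (1 + 1)) with (RtoC 2). rewrite (Wint_step _ H).
  replace ((RtoC (INR k) + 1) / (RtoC (INR k) + 2))%C with (RtoC ((INR k + 1) / (INR k + 2))).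
  - unfold Re; simpl. ring.
  - unfold Rdiv. rewrite RtoC_mult, RtoC_inv, !RtoC_plus by lra. reflexivity.
Qed.

(** The weights [sin^(2n-1)] have odd exponent, so the recursion starts from the elementary value of
    [Wint_1]. *)
Lemma omega_odd_pos (p : nat) : 0 < omega (2 * p + 1).
Proof.
  induction p as [|p IH].
  - unfold omega. simpl (INR (2 * 0 + 1)). rewrite Wint_1. simpl. lra.
  - replace (2 * S p + 1)%nat with (2 * p + 1 + 2)%nat by lia. rewrite omega_step.
    pose proof (pos_INR (2 * p + 1)). apply Rmult_lt_0_compat; auto. apply Rdiv_lt_0_compat; lra.
Qed.

(** For [s = sin x], [|s^(2a) - 1| <= 2 |a| |ln s| <= |a| (s^(-2) - 1)]. Multiplied by [s^(2p+3)]
    this is a difference of consecutive odd powers, and [omega_step] shows that its integral is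
    smaller than [omega (2p+3)] by the factor [1 / (2p+2)]. *)
Lemma Wint_omega (a : CC) (p : nat) :
  0 < Re a ->
  Cmod (Wint (2 * a + RtoC (INR (2 * p + 3))) - RtoC (omega (2 * p + 3)))%C
  <= Cmod a * (/ INR (2 * p + 2) * omega (2 * p + 3)).
Proof.
  intros Ha.
  set (k := INR (2 * p + 3)).
  assert (Hk : 0 <= k) by apply pos_INR.
  assert (I1 : is_psi_int (fun x => rpowC (sin x) (2 * a + RtoC k)) (Wint (2 * a + RtoC k))).
  { apply is_psi_int_sin. unfold Re in *; simpl. lra. }
  pose proof (is_Cint_mult (-(1))%C _ _ (is_Cint_RtoC _ _ (is_RInt_gen_omega (2 * p + 3)))) as I2.
  pose proof (is_Cint_plus _ _ _ _ I1 I2) as I.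
  replace (Wint (2 * a + RtoC k) - RtoC (omega (2 * p + 3)))%C
    with (Wint (2 * a + RtoC k) + - (1) * RtoC (omega (2 * p + 3)))%C by ring.
  pose proof (is_RInt_gen_Rscal (Cmod a) _ _ (is_RInt_gen_Rplus _ _ _ _ (is_RInt_gen_omega (2 * p + 1))
    (is_RInt_gen_Rscal (-1) _ _ (is_RInt_gen_omega (2 * p + 3))))) as B.
  replace (/ INR (2 * p + 2) * omega (2 * p + 3)) with (omega (2 * p + 1) + -1 * omega (2 * p + 3)).
  2:{ replace (2 * p + 3)%nat with (2 * p + 1 + 2)%nat by lia. rewrite omega_step.
      assert (E : INR (2 * p + 2) = INR (2 * p + 1) + 1) by (rewrite <- S_INR; f_equal; lia).
      rewrite E. pose proof (pos_INR (2 * p + 1)). field. lra. }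
  revert I B. apply (is_Cint_norm (fun x => 0 < x < PI)).
  - apply is_interval_lt_lt.
  - apply at_right_lt, PI_RGT_0.
  - apply at_left_lt, PI_RGT_0.
  - exists (fun x => 0 < x < PI / 2) (fun x => PI / 2 < x < PI); [apply at_right_lt | apply at_left_lt |];
      try (pose proof PI_RGT_0; lra). intros; simpl; lra.
  - intros x Hx. assert (Sx : 0 < sin x) by (apply sin_gt_0; lra).
    pose proof (SIN_bound x) as SB.
    assert (Hw : 0 < sin x ^ (2 * p + 1)) by (apply pow_lt; auto).
    replace (rpowC (sin x) (2 * a + RtoC k) + - (1) * RtoC (sin x ^ (2 * p + 3)))%C
      with ((rpowC (sin x) (2 * a) - 1) * RtoC (sin x ^ 2 * sin x ^ (2 * p + 1)))%C.
    2:{ unfold k. rewrite rpowC_plus, rpowC_INR by auto. rewrite <- pow_add.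
        replace (2 + (2 * p + 1))%nat with (2 * p + 3)%nat by lia. ring. }
    rewrite Cmod_mult, Cmod_R, Rabs_pos_eq by (apply Rmult_le_pos; [apply pow2_ge_0 | lra]).
    replace (2 * p + 3)%nat with (2 + (2 * p + 1))%nat by lia. rewrite (pow_add _ 2).
    replace (Cmod a * (sin x ^ (2 * p + 1) + -1 * (sin x ^ 2 * sin x ^ (2 * p + 1))))
      with (Cmod a * (/ sin x ^ 2 - 1) * (sin x ^ 2 * sin x ^ (2 * p + 1))) by (field; lra).
    apply Rmult_le_compat_r; [apply Rmult_le_pos; [apply pow2_ge_0 | lra]|].
    assert (Ln : ln (sin x) <= 0) by (rewrite <- ln_1; apply ln_le; lra).
    unfold rpowC. eapply Rle_trans.
    + apply Cmod_Cexp_sub_1 with (M := 1); [lra|].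
      replace (Re (2 * a * RtoC (ln (sin x)))%C) with (2 * Re a * ln (sin x)) by (unfold Re; simpl; ring).
      rewrite <- exp_0. destruct (Rle_lt_or_eq_dec (2 * Re a * ln (sin x)) 0) as [L|L]; [nra | left; apply exp_increasing; auto | rewrite L; lra].
    + rewrite !Cmod_mult, !Cmod_R, Rmult_1_l, (Rabs_pos_eq 2), (Rabs_left1 (ln (sin x))) by lra.
      rewrite (Rmult_comm 2), Rmult_assoc. apply Rmult_le_compat_l; [apply Cmod_ge_0|].
      pose proof (exp_ineq1_le (2 * - ln (sin x))) as X.
      replace (exp (2 * - ln (sin x))) with (/ sin x ^ 2) in X; [lra|].
      replace (2 * - ln (sin x)) with (- (ln (sin x) + ln (sin x))) by ring.
      rewrite exp_Ropp, exp_plus, exp_ln by auto. f_equal. ring.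
Qed.

(** With [n = p + 2], the exponents are [2(a + n) - 1] and [2n - 1]. *)
Definition Wratio (a : CC) (p : nat) : CC := (Wint (2 * a + RtoC (INR (2 * p + 3))) / RtoC (omega (2 * p + 3)))%C.

Lemma is_Clim_Wratio (a : CC) : 0 < Re a -> is_Clim (Wratio a) 1.
Proof.
  intros Ha.
  apply is_lim_seq_le_le with (fun _ => 0) (fun p => Cmod a * / INR (p + 2)).
  - intros p. split; [apply Cmod_ge_0|].
    assert (Po : 0 < omega (2 * p + 3)) by (replace (2 * p + 3)%nat with (2 * (p + 1) + 1)%nat by lia; apply omega_odd_pos).
    assert (O0 : RtoC (omega (2 * p + 3)) <> 0) by (apply RtoC_neq0; lra).
    unfold Wratio. replace (Wint (2 * a + RtoC (INR (2 * p + 3))) / RtoC (omega (2 * p + 3)) - 1)%C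
      with ((Wint (2 * a + RtoC (INR (2 * p + 3))) - RtoC (omega (2 * p + 3))) / RtoC (omega (2 * p + 3)))%C by (field; auto).
    rewrite Cmod_div, Cmod_R, Rabs_pos_eq by (auto; lra).
    apply Rmult_le_reg_r with (omega (2 * p + 3)); auto.
    unfold Rdiv. rewrite Rmult_assoc, Rinv_l, Rmult_1_r by lra.
    eapply Rle_trans; [apply Wint_omega; auto|].
    rewrite <- Rmult_assoc. apply Rmult_le_compat_r; [lra|]. apply Rmult_le_compat_l; [apply Cmod_ge_0|].
    apply Rinv_le_contravar; [apply lt_0_INR; lia | apply le_INR; lia].
  - apply is_lim_seq_const.
  - replace (Finite 0) with (Rbar_mult (Cmod a) 0) by (simpl; f_equal; ring).
    apply is_lim_seq_scal_l, is_lim_seq_inv_INR_2.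
Qed.

(* The identity holds up to a factor which is 1-periodic in a and tends to a constant. *)
Definition beta_ratio (a : CC) : CC := (CGamma (a + / 2) * Wint (2 * a - 1) / CGamma a)%C.

Lemma beta_ratio_S (a : CC) : 0 < Re a -> beta_ratio (a + 1)%C = beta_ratio a.
Proof.
  intros Ha. unfold beta_ratio.
  assert (R2 : Re (/ 2)%C = / 2) by (unfold Re; simpl; field).
  assert (Ra : Re (a + / 2)%C = Re a + / 2) by (change (Re (a + / 2)%C) with (Re a + Re (/ 2)%C); lra).
  replace (a + 1 + / 2)%C with (a + / 2 + 1)%C by ring.
  rewrite !CGamma_S by (rewrite ?Ra; lra).
  replace (2 * (a + 1) - 1)%C with (2 * a - 1 + 2)%C by ring.
  rewrite Wint_step by (unfold Re in *; simpl; lra).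
  assert (a <> 0) by (apply Cneq0_Re; lra).
  assert (CGamma a <> 0) by (apply CGamma_neq0; auto).
  assert ((2 * a + 1)%C <> 0) by (apply Cneq0_Re; unfold Re in *; simpl; lra).
  field. repeat split; auto. replace (2 * a - 1 + 2)%C with (2 * a + 1)%C by ring; auto.
Qed.

Lemma beta_ratio_shift (a : CC) (n : nat) : 0 < Re a -> beta_ratio (a + RtoC (INR n))%C = beta_ratio a.
Proof.
  intros Ha. induction n as [|n IH].
  - f_equal. simpl. ring.
  - rewrite S_INR, RtoC_plus, Cplus_assoc, beta_ratio_S; [exact IH|].
    pose proof (pos_INR n). unfold Re in *; simpl; lra.
Qed.

(** Evaluate [beta_ratio] at [a + n] with [n = p + 2] and factor out the asymptotics of each term.
    What remains, [sqrt n] times [omega (2n - 1)], is free of [a]. *)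
Lemma beta_ratio_eq (a : CC) (p : nat) : 0 < Re a ->
  (beta_ratio a * Gratio a p = Gratio (a + / 2) p * Wratio a p * (rpowC (INR (p + 2)) (/ 2) * RtoC (omega (2 * p + 3))))%C.
Proof.
  intros Ha. rewrite <- (beta_ratio_shift a (p + 2) Ha).
  assert (Po : 0 < omega (2 * p + 3)) by (replace (2 * p + 3)%nat with (2 * (p + 1) + 1)%nat by lia; apply omega_odd_pos).
  assert (O0 : RtoC (omega (2 * p + 3)) <> 0) by (apply RtoC_neq0; lra).
  unfold beta_ratio, Gratio, Wratio. rewrite rpowC_plus.
  replace (a + RtoC (INR (p + 2)) + / 2)%C with (a + / 2 + RtoC (INR (p + 2)))%C by ring.
  replace (2 * (a + RtoC (INR (p + 2))) - 1)%C with (2 * a + RtoC (INR (2 * p + 3)))%C.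
  2:{ replace (INR (2 * p + 3)) with (2 * INR (p + 2) - 1).
      - rewrite RtoC_minus, RtoC_mult. ring.
      - rewrite !plus_INR, mult_INR. simpl. ring. }
  field. repeat split; auto using rpowC_neq0.
  - apply RtoC_neq0, INR_fact_neq_0.
  - apply CGamma_neq0. unfold Re in *; simpl. pose proof (pos_INR (p + 2)). lra.
Qed.

(** Cross multiplication of [beta_ratio_eq] for [a] and [b] eliminates the common factor [sqrt n]
    times [omega (2n - 1)], whose limit is thus never computed; the remaining ratios all tend to
    1. *)
Lemma beta_ratio_const (a b : CC) : 0 < Re a -> 0 < Re b -> beta_ratio a = beta_ratio b.
Proof.
  intros Ha Hb.
  assert (L : forall a b, 0 < Re a -> 0 < Re b -> is_Clim (fun p => (beta_ratio a * (Gratio a p * (Gratio (b + / 2) p * Wratio b p)))%C) (beta_ratio a)).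
  { intros c d Hc Hd. replace (beta_ratio c) with (beta_ratio c * (1 * (1 * 1)))%C at 1 by ring.
    apply is_Clim_mult; [apply is_Clim_const|]. apply is_Clim_mult; [apply is_Clim_Gratio, Hc|].
    apply is_Clim_mult; [|apply is_Clim_Wratio, Hd]. apply is_Clim_Gratio.
    unfold Re in *; simpl. assert (2 / (2 * (2 * 1) + 0 * (0 * 1)) = / 2) by field. lra. }
  apply is_Clim_unique with (1 := L a b Ha Hb). apply is_lim_seq_ext with (2 := L b a Hb Ha).
  intros p. apply (f_equal (fun z => Cmod (z - beta_ratio b)%C)). rewrite !Cmult_assoc, !beta_ratio_eq by auto. ring.
Qed.

(** The constant is read off at [a = 1], where the sine integral is 2 and
    [Gamma(3/2) = Gamma(1/2) / 2]. *)
Lemma Wint_Gamma (mu : CC) : -1 < Re mu ->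
  (Wint mu * CGamma (mu / 2 + 1) = CGamma ((mu + 1) / 2) * CGamma (/ 2))%C.
Proof.
  intros H. set (a := ((mu + 1) / 2)%C).
  assert (R2 : Re (/ 2)%C = / 2) by (unfold Re; simpl; field).
  assert (Ha : 0 < Re a).
  { unfold a. replace ((mu + 1) / 2)%C with (RtoC (/ 2) * (mu + 1))%C by (rewrite RtoC_inv by lra; field).
    unfold Re in *; simpl. lra. }
  assert (E : beta_ratio a = beta_ratio 1) by (apply beta_ratio_const; auto; simpl; lra).
  unfold beta_ratio in E at 2. rewrite CGamma_1 in E.
  replace (1 + / 2)%C with (/ 2 + 1)%C in E by ring. rewrite CGamma_S in E by lra.
  replace (2 * 1 - 1)%C with (RtoC 1) in E by ring. rewrite Wint_1 in E.
  unfold beta_ratio in E.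
  replace (a + / 2)%C with (mu / 2 + 1)%C in E by (unfold a; field).
  replace (2 * a - 1)%C with mu in E by (unfold a; field).
  assert (CGamma a <> 0) by (apply CGamma_neq0; auto).
  replace (Wint mu * CGamma (mu / 2 + 1))%C with (CGamma a * (CGamma (mu / 2 + 1) * Wint mu / CGamma a))%C by (field; auto).
  rewrite E. field.
Qed.

(** * Finite sums and binomial coefficients with complex upper argument *)

Lemma Csum_ext (a b : nat -> CC) (n : nat) : (forall k, (k <= n)%nat -> a k = b k) -> Csum a n = Csum b n.
Proof.
  induction n as [|n IH]; intros H; simpl; [apply H; lia|].
  rewrite IH, (H (S n)) by (intros; try apply H; lia). reflexivity.
Qed.

Lemma Csum_plus (a b : nat -> CC) (n : nat) : Csum (fun k => (a k + b k)%C) n = (Csum a n + Csum b n)%C.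
Proof. induction n as [|n IH]; simpl; [reflexivity | rewrite IH; ring]. Qed.

Lemma Csum_mult_l (z : CC) (a : nat -> CC) (n : nat) : Csum (fun k => (z * a k)%C) n = (z * Csum a n)%C.
Proof. induction n as [|n IH]; simpl; [reflexivity | rewrite IH; ring]. Qed.

Lemma Csum_S_l (a : nat -> CC) (n : nat) : Csum a (S n) = (a 0%nat + Csum (fun k => a (S k)) n)%C.
Proof. induction n as [|n IH]; [reflexivity|]. simpl in *. rewrite IH. ring. Qed.

(** Adds a sum to one shifted by an index, as happens when one term of a derivative raises the power
    of [x] and the other does not. *)
Lemma Csum_merge (a b r : nat -> CC) (n : nat) :
  r 0%nat = a 0%nat -> (forall i, (i < n)%nat -> r (S i) = (a (S i) + b i)%C) -> r (S n) = b n ->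
  Csum r (S n) = (Csum a n + Csum b n)%C.
Proof.
  intros H0 H1 H2.
  assert (E : forall k, (k <= n)%nat -> (Csum r k + b k = Csum a k + Csum b k)%C).
  { induction k as [|k IH]; intros Hk; simpl; [rewrite H0; ring|].
    rewrite H1 by lia. specialize (IH ltac:(lia)).
    transitivity (Csum r k + b k + a (S k) + b (S k))%C; [ring | rewrite IH; ring]. }
  simpl. rewrite H2. apply E. lia.
Qed.

Lemma RtoC_INR_S_neq0 (n : nat) : RtoC (INR (S n)) <> RtoC 0.
Proof. apply RtoC_neq0, not_0_INR. lia. Qed.

Lemma RtoC_fact_neq0 (n : nat) : RtoC (INR (fact n)) <> RtoC 0.
Proof. apply RtoC_neq0, INR_fact_neq_0. Qed.

Lemma RtoC_fact_S (n : nat) : RtoC (INR (fact (S n))) = (RtoC (INR (S n)) * RtoC (INR (fact n)))%C.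
Proof. rewrite fact_simpl, mult_INR, RtoC_mult. reflexivity. Qed.

Lemma binomC_0 (z : CC) : binomC z 0 = RtoC 1.
Proof. unfold binomC. simpl. field. Qed.

Lemma binomC_S (z : CC) (m : nat) :
  (RtoC (INR (S m)) * binomC z (S m) = (z - RtoC (INR m)) * binomC z m)%C.
Proof.
  unfold binomC. rewrite RtoC_fact_S. simpl fallC.
  field. split; [apply RtoC_fact_neq0 | apply RtoC_INR_S_neq0].
Qed.

Lemma fallC_S_l (z : CC) (m : nat) : fallC (z + 1)%C (S m) = ((z + 1) * fallC z m)%C.
Proof.
  induction m as [|m IH]; [simpl; ring|].
  change (fallC (z + 1)%C (S (S m))) with (fallC (z + 1)%C (S m) * (z + 1 - RtoC (INR (S m))))%C.
  rewrite IH, S_INR, RtoC_plus. simpl fallC. ring.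
Qed.

Lemma binomC_pascal (z : CC) (m : nat) : binomC (z + 1)%C (S m) = (binomC z (S m) + binomC z m)%C.
Proof.
  unfold binomC. rewrite fallC_S_l, RtoC_fact_S. simpl fallC. rewrite !S_INR, !RtoC_plus.
  field. split; [apply RtoC_fact_neq0|]. pose proof (RtoC_INR_S_neq0 m) as H. rewrite S_INR, RtoC_plus in H. exact H.
Qed.

(** * Exponential generating series with bounded coefficients *)

Definition Rbounded (c : nat -> R) : Prop := exists B, forall n, Rabs (c n) <= B.

(** In exponential normalization differentiation is the index shift, and bounded coefficients
    already give an infinite radius of convergence. *)
Definition egf (c : nat -> R) (n : nat) : R := c n / INR (fact n).

Lemma CV_radius_egf (c : nat -> R) (x : R) : Rbounded c -> Rbar_lt (Rabs x) (CV_radius (egf c)).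
Proof.
  intros [B HB]. pose proof (Rabs_pos x) as Hx.
  destruct (CV_radius_bounded (egf c)) as [U _].
  eapply Rbar_lt_le_trans; [|apply (U (Rabs x + 1))].
  - simpl. lra.
  - exists (B * exp (Rabs x + 1)). intros n. unfold egf.
    pose proof (INR_fact_lt_0 n) as F. pose proof (pow_le_fact_exp (Rabs x + 1) n ltac:(lra)) as P.
    rewrite Rabs_mult, Rabs_div, (Rabs_pos_eq (INR (fact n))), (Rabs_pos_eq ((Rabs x + 1) ^ n)) by (try apply pow_le; lra).
    replace (Rabs (c n) / INR (fact n) * (Rabs x + 1) ^ n) with (Rabs (c n) * ((Rabs x + 1) ^ n / INR (fact n))) by (field; lra).
    apply Rmult_le_compat; auto using Rabs_pos.
    + apply Rdiv_le_0_compat; [apply pow_le|]; lra.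
    + apply Rmult_le_reg_r with (INR (fact n)); auto.
      replace ((Rabs x + 1) ^ n / INR (fact n) * INR (fact n)) with ((Rabs x + 1) ^ n) by (field; lra). lra.
Qed.

Lemma is_derive_egf (c : nat -> R) (x : R) : Rbounded c ->
  is_derive (PSeries (egf c)) x (PSeries (egf (fun n => c (S n))) x).
Proof.
  intros H. evar_last. { apply is_derive_PSeries, CV_radius_egf, H. }
  apply PSeries_ext. intros n. unfold PS_derive, egf. rewrite fact_simpl, mult_INR.
  field. split; [apply INR_fact_neq_0 | apply not_0_INR; lia].
Qed.

Definition Cbounded (c : nat -> CC) : Prop := exists B, forall n, Cmod (c n) <= B.

Lemma Cbounded_Re (c : nat -> CC) : Cbounded c -> Rbounded (fun n => Re (c n)).
Proof. intros [B H]; exists B; intros n. eapply Rle_trans; [apply re_le_Cmod | apply H]. Qed.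

Lemma Cbounded_Im (c : nat -> CC) : Cbounded c -> Rbounded (fun n => Im (c n)).
Proof. intros [B H]; exists B; intros n. eapply Rle_trans; [apply im_le_Cmod | apply H]. Qed.

Definition Cegf (c : nat -> CC) (w : R) : CC :=
  (PSeries (egf (fun n => Re (c n))) w, PSeries (egf (fun n => Im (c n))) w).

Lemma is_Cderive_Cegf (c : nat -> CC) (w : R) : Cbounded c ->
  is_Cderive (Cegf c) w (Cegf (fun n => c (S n)) w).
Proof.
  intros H; split.
  - exact (is_derive_egf _ w (Cbounded_Re c H)).
  - exact (is_derive_egf _ w (Cbounded_Im c H)).
Qed.

Lemma Cegf_minus (c d : nat -> CC) (w : R) : Cbounded c -> Cbounded d ->
  Cegf (fun n => (c n - d n)%C) w = (Cegf c w - Cegf d w)%C.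
Proof.
  intros Hc Hd.
  assert (K : forall a b : nat -> R, Rbounded a -> Rbounded b ->
     PSeries (egf (fun n => a n - b n)) w = PSeries (egf a) w - PSeries (egf b) w).
  { intros a b Ha Hb. rewrite <- PSeries_minus by (apply CV_radius_inside, CV_radius_egf; auto).
    apply PSeries_ext. intros n. unfold PS_minus, PS_plus, PS_opp, egf, plus, opp; simpl. unfold Rdiv; ring. }
  apply C_eq_parts; [apply (K (fun n => Re (c n)) (fun n => Re (d n))) | apply (K (fun n => Im (c n)) (fun n => Im (d n)))];
    auto using Cbounded_Re, Cbounded_Im.
Qed.

Lemma Cegf_0 (c : nat -> CC) : Cegf c 0 = c 0%nat.
Proof. unfold Cegf. rewrite !PSeries_0. unfold egf. apply C_eq_parts; simpl; field. Qed.

(** Differentiating [e^(-w) Cegf c w] replaces [c] by this sequence, the factor [e^(-w)]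
    contributing the subtracted term. *)
Definition diffseq (c : nat -> CC) (n : nat) : CC := (c (S n) - c n)%C.

Lemma Cbounded_shift (c : nat -> CC) : Cbounded c -> Cbounded (fun n => c (S n)).
Proof. intros [B H]; exists B; auto. Qed.

Lemma Cbounded_diffseq (c : nat -> CC) : Cbounded c -> Cbounded (diffseq c).
Proof.
  intros [B H]; exists (B + B); intros n. unfold diffseq, Cminus.
  eapply Rle_trans; [apply Cmod_triangle|]. rewrite Cmod_opp. apply Rplus_le_compat; apply H.
Qed.

Fixpoint iterdiff (n : nat) (c : nat -> CC) : nat -> CC :=
  match n with O => c | S m => iterdiff m (diffseq c) end.

Lemma iterdiff_S (n : nat) (c : nat -> CC) (i : nat) :
  iterdiff (S n) c i = (iterdiff n c (S i) - iterdiff n c i)%C.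
Proof.
  revert c. induction n as [|n IH]; intros c; [reflexivity|].
  change (iterdiff (S (S n)) c i) with (iterdiff (S n) (diffseq c) i). rewrite IH. reflexivity.
Qed.

(** * Successive derivatives in t *)

(** An explicit chain of successive derivatives on [t < 1], an open set containing 0. It identifies
    the iterated derivative without separate differentiability conditions at each order. *)
Definition tower (f : nat -> R -> CC) : Prop :=
  forall k t, t < 1 -> is_Cderive (f k) t (f (S k) t).

Lemma tower_CDerive_n (f : nat -> R -> CC) (n : nat) (t : R) :
  tower f -> t < 1 -> CDerive_n (f 0%nat) n t = f n t.
Proof.
  intros H.
  assert (L : forall t, t < 1 -> locally t (fun y => y < 1)).
  { intros u Hu. apply (locally_open (fun y => y < 1)); auto. apply open_lt. }
  assert (E : forall n t, t < 1 -> Derive_n (fun s => Re (f 0%nat s)) n t = Re (f n t) /\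
                            Derive_n (fun s => Im (f 0%nat s)) n t = Im (f n t)).
  { induction n0 as [|m IH]; intros u Hu; [split; reflexivity|].
    destruct (H m u Hu) as [D1 D2]. simpl. split.
    - rewrite <- (is_derive_unique _ _ _ D1). apply Derive_ext_loc.
      generalize (L u Hu). apply filter_imp. intros y Hy. apply IH, Hy.
    - rewrite <- (is_derive_unique _ _ _ D2). apply Derive_ext_loc.
      generalize (L u Hu). apply filter_imp. intros y Hy. apply IH, Hy. }
  intros Ht. destruct (E n t Ht) as [E1 E2]. unfold CDerive_n. rewrite E1, E2. now destruct (f n t).
Qed.

Lemma CDerive_n_ext_loc (f g : R -> CC) (n : nat) (t : R) :
  locally t (fun s => f s = g s) -> CDerive_n f n t = CDerive_n g n t.
Proof.
  intros H. unfold CDerive_n. f_equal; apply Derive_n_ext_loc; revert H; apply filter_imp; intros s ->; reflexivity.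
Qed.

Lemma tower_mult_l (z : CC) (f : nat -> R -> CC) : tower f -> tower (fun k t => (z * f k t)%C).
Proof. intros H k t Ht. apply is_Cderive_mult_l, H, Ht. Qed.

Lemma tower_Csum (f : nat -> nat -> R -> CC) (n : nat) :
  (forall i, tower (f i)) -> tower (fun k t => Csum (fun i => f i k t) n).
Proof.
  intros H. induction n as [|n IH]; intros k t Ht; simpl.
  - apply H, Ht.
  - apply is_Cderive_plus; [apply IH, Ht | apply H, Ht].
Qed.

Definition Tfun (x : R) (g : CC) (c : nat -> CC) (t : R) : CC :=
  (rpowC (1 - t) (- g) * (RtoC (exp (- (x * t / (1 - t)))) * Cegf c (x * t / (1 - t))))%C.

(** With [w = x t / (1 - t)], [w' = x / (1 - t)^2]: differentiating the power of [1 - t] raises [g]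
    by 1, differentiating the function of [w] raises it by 2 and takes a difference of [c]. The
    family is thus closed under differentiation. *)
Lemma is_Cderive_Tfun (x : R) (g : CC) (c : nat -> CC) (t : R) :
  Cbounded c -> t < 1 ->
  is_Cderive (Tfun x g c) t (g * Tfun x (g + 1) c t + RtoC x * Tfun x (g + 2) (diffseq c) t)%C.
Proof.
  intros Hc Ht.
  assert (P : 0 < 1 - t) by lra.
  assert (N : RtoC (1 - t) <> 0) by (apply RtoC_neq0; lra).
  assert (DW : is_derive (fun t => x * t / (1 - t)) t (x / ((1 - t) * (1 - t)))).
  { auto_derive; [lra | field; lra]. }
  assert (D1 : is_derive (fun t => 1 - t) t (-1)) by (auto_derive; auto; ring).
  unfold Tfun. eapply is_Cderive_eq.
  - apply is_Cderive_mult.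
    + apply (is_Cderive_comp (fun u => rpowC u (- g)) (fun t => 1 - t)).
      * apply is_Cderive_rpowC; auto.
      * exact D1.
    + apply is_Cderive_mult.
      * apply is_Cderive_RtoC. apply (is_derive_comp exp (fun t => - (x * t / (1 - t)))); [apply is_derive_exp|].
        apply (is_derive_opp (V:=R_NormedModule)), DW.
      * apply (is_Cderive_comp (Cegf c) (fun t => x * t / (1 - t))); [apply is_Cderive_Cegf, Hc | exact DW].
  - unfold diffseq. rewrite (Cegf_minus (fun n => c (S n)) c) by auto using Cbounded_shift.
    set (w := x * t / (1 - t)).
    assert (E1 : rpowC (1 - t) (- g) = (RtoC (1 - t) * RtoC (1 - t) * rpowC (1 - t) (- (g + 2)))%C).
    { replace (- g)%C with (- (g + 2) + 1 + 1)%C by ring. rewrite !rpowC_add1 by auto. ring. }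
    assert (E2 : rpowC (1 - t) (- (g + 1)) = (RtoC (1 - t) * rpowC (1 - t) (- (g + 2)))%C).
    { replace (- (g + 1))%C with (- (g + 2) + 1)%C by ring. rewrite !rpowC_add1 by auto. ring. }
    replace (- g - 1)%C with (- (g + 1))%C by ring. rewrite E2, E1.
    unfold scal; simpl; unfold mult; simpl. unfold opp; simpl.
    unfold Rdiv. rewrite !RtoC_mult, !RtoC_opp, !RtoC_mult, !RtoC_inv, !RtoC_mult by nra. field. auto.
Qed.

(** The recursion changes the parameters [g] and [c] rather than the function of [t], so the order
    [n] derivative is a combination of [Tfun] with shifted parameters. *)
Fixpoint Tder (x : R) (n : nat) (g : CC) (c : nat -> CC) (t : R) : CC :=
  match n with
  | O => Tfun x g c t
  | S m => (g * Tder x m (g + 1)%C c t + RtoC x * Tder x m (g + 2)%C (diffseq c) t)%C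
  end.

Lemma tower_Tder (x : R) (g : CC) (c : nat -> CC) : Cbounded c -> tower (fun n => Tder x n g c).
Proof.
  intros Hc k. revert g c Hc. induction k as [|k IH]; intros g c Hc t Ht.
  - apply is_Cderive_Tfun; auto.
  - change (Tder x (S (S k)) g c t) with (g * Tder x (S k) (g + 1)%C c t + RtoC x * Tder x (S k) (g + 2)%C (diffseq c) t)%C.
    change (Tder x (S k) g c) with (fun t => (g * Tder x k (g + 1)%C c t + RtoC x * Tder x k (g + 2)%C (diffseq c) t)%C).
    apply is_Cderive_plus.
    + apply is_Cderive_mult_l, IH; auto.
    + apply is_Cderive_mult_l, IH; auto using Cbounded_diffseq.
Qed.

(** Behind the formula is [e^(-w) Cegf c w = sum_i (iterdiff i c 0) w^i / i!], together with the
    coefficient of [t^(n-i)] in [(1 - t)^(-g-i)], which is [binom(g+n-1, n-i)]. The proof is an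
    induction on [n] that stays with binomial coefficients. *)
Lemma Tder_0 (x : R) (n : nat) (g : CC) (c : nat -> CC) :
  Tder x n g c 0 =
  Csum (fun i => (RtoC (INR (fact n) / INR (fact i) * x ^ i) * (iterdiff i c 0%nat * binomC (g + RtoC (INR n) - 1) (n - i)))%C) n.
Proof.
  revert g c. induction n as [|n IH]; intros g c.
  - simpl. unfold Tfun. replace (x * 0 / (1 - 0)) with 0 by field.
    rewrite Ropp_0, exp_0, Cegf_0, Rminus_0_r, binomC_0. unfold rpowC. rewrite ln_1.
    rewrite Cmult_0_r, Cexp_RtoC, exp_0. replace (1 / 1 * 1) with 1 by field. ring.
  - change (Tder x (S n) g c 0) with (g * Tder x n (g + 1)%C c 0 + RtoC x * Tder x n (g + 2)%C (diffseq c) 0)%C.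
    rewrite !IH, <- !Csum_mult_l. symmetry.
    set (N := (g + RtoC (INR n))%C).
    replace (g + RtoC (INR (S n)) - 1)%C with N by (unfold N; rewrite S_INR, RtoC_plus; ring).
    replace (g + 1 + RtoC (INR n) - 1)%C with N by (unfold N; ring).
    replace (g + 2 + RtoC (INR n) - 1)%C with (N + 1)%C by (unfold N; ring).
    assert (F : forall i, INR (fact i) <> 0) by apply INR_fact_neq_0.
    assert (D : forall i, iterdiff i (diffseq c) 0%nat = iterdiff (S i) c 0%nat) by reflexivity.
    apply Csum_merge.
    + pose proof (binomC_S N n) as B. rewrite !Nat.sub_0_r.
      replace (RtoC (INR (fact (S n)) / INR (fact 0) * x ^ 0))
        with (RtoC (INR (S n)) * RtoC (INR (fact n) / INR (fact 0) * x ^ 0))%C.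
      2:{ rewrite <- RtoC_mult, fact_simpl, mult_INR. f_equal. field. apply F. }
      transitivity (RtoC (INR (fact n) / INR (fact 0) * x ^ 0) * (iterdiff 0 c 0%nat * (RtoC (INR (S n)) * binomC N (S n))))%C; [ring|].
      rewrite B. unfold N. ring.
    + intros i Hi. rewrite D. set (m := (n - S i)%nat).
      replace (S n - S i)%nat with (S m) by lia. replace (n - i)%nat with (S m) by lia.
      rewrite binomC_pascal. pose proof (binomC_S N m) as B.
      replace (RtoC (INR (fact (S n)) / INR (fact (S i)) * x ^ S i))
        with (RtoC (INR (S n)) * RtoC (INR (fact n) / INR (fact (S i)) * x ^ S i))%C.
      2:{ rewrite <- RtoC_mult, (fact_simpl n), mult_INR. f_equal. field. apply F. }
      replace (RtoC x * (RtoC (INR (fact n) / INR (fact i) * x ^ i) * (iterdiff (S i) c 0%nat * (binomC N (S m) + binomC N m))))%C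
        with (RtoC (INR (S i)) * RtoC (INR (fact n) / INR (fact (S i)) * x ^ S i) * (iterdiff (S i) c 0%nat * (binomC N (S m) + binomC N m)))%C.
      2:{ replace (RtoC (INR (S i)) * RtoC (INR (fact n) / INR (fact (S i)) * x ^ S i))%C
            with (RtoC x * RtoC (INR (fact n) / INR (fact i) * x ^ i))%C; [ring|].
          rewrite <- !RtoC_mult, fact_simpl, mult_INR. f_equal. simpl pow. field. split; [apply F | apply not_0_INR; lia]. }
      set (q := RtoC (INR (fact n) / INR (fact (S i)) * x ^ S i)).
      (* Here [n + 1 = (m + 1) + (i + 1)]. The first part is lowered by [binomC_S], where
         [N - m = g + (i + 1)]; the [g] term belongs to the parameter [g + 1], and the two terms
         with factor [i + 1] recombine by Pascal's rule for [g + 2]. *)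
      transitivity (q * (iterdiff (S i) c 0%nat * (RtoC (INR (S m)) * binomC N (S m) + RtoC (INR (S i)) * binomC N (S m))))%C.
      { replace (INR (S n)) with (INR (S m) + INR (S i)) by (rewrite <- plus_INR; f_equal; lia). rewrite RtoC_plus. ring. }
      rewrite B. unfold N at 1.
      replace (INR n) with (INR m + INR (S i)) by (rewrite <- plus_INR; f_equal; lia). rewrite RtoC_plus. ring.
    + rewrite !Nat.sub_diag, !binomC_0, D.
      replace (RtoC (INR (fact (S n)) / INR (fact (S n)) * x ^ S n)) with (RtoC x * RtoC (INR (fact n) / INR (fact n) * x ^ n))%C; [ring|].
      rewrite <- RtoC_mult. f_equal. simpl pow. field. split; apply F.
Qed.

(** * The function I-tilde *)

(** Each recursion factor [k / (k + 1 + mu)] has modulus at most 1 because [Re mu + 1 > 0]. This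
    boundedness makes the exponential series usable. *)
Lemma Cmod_wc (mu : CC) (i : nat) : -1 < Re mu -> Cmod (wc mu i) <= Cmod (Wint mu).
Proof.
  intros H.
  enough (G : Cmod (wc mu i) <= Cmod (Wint mu) /\ Cmod (wc mu (S i)) <= Cmod (Wint mu)) by apply G.
  induction i as [|i [IH1 IH2]]; split; auto.
  - simpl. lra.
  - simpl wc. rewrite Cmod_0. apply Cmod_ge_0.
  - change (wc mu (S (S i))) with (RtoC (INR (S i)) / (RtoC (INR (S i) + 1) + mu) * wc mu i)%C.
    set (k := INR (S i)). assert (Hk : 0 <= k) by apply pos_INR.
    set (d := (RtoC (k + 1) + mu)%C).
    assert (Rd : Re d = k + 1 + Re mu) by reflexivity.
    assert (Hd : k <= Cmod d).
    { eapply Rle_trans; [|apply (re_le_Cmod d)]. rewrite Rd. eapply Rle_trans; [|apply Rle_abs]. lra. }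
    assert (D0 : d <> 0) by (apply Cneq0_Re; lra).
    assert (Pd : 0 < Cmod d) by (apply Cmod_gt_0; auto).
    rewrite Cmod_mult, Cmod_div, Cmod_R, Rabs_pos_eq by auto.
    assert (k / Cmod d <= 1) by (apply Rle_div_l; lra).
    assert (0 <= k / Cmod d) by (apply Rdiv_le_0_compat; lra).
    pose proof (Cmod_ge_0 (wc mu i)). nra.
Qed.

Lemma wc_odd (mu : CC) (k : nat) : wc mu (2 * k + 1) = 0.
Proof.
  induction k as [|k IH]; [reflexivity|].
  replace (2 * S k + 1)%nat with (S (S (2 * k + 1))) by lia.
  change (wc mu (S (S (2 * k + 1)))) with (RtoC (INR (S (2 * k + 1))) / (RtoC (INR (S (2 * k + 1)) + 1) + mu) * wc mu (2 * k + 1))%C.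
  rewrite IH. ring.
Qed.

(** Poisson's integral for the Bessel function, read coefficient by coefficient: the induction
    starts at [Wint_Gamma], and both sides obey the same ratio in [k]. *)
Lemma wc_even (mu : CC) (k : nat) : -1 < Re mu ->
  (wc mu (2 * k) * CGamma (RtoC (INR k + 1) + mu / 2) * RtoC (4 ^ k * INR (fact k))
   = RtoC (INR (fact (2 * k))) * (CGamma (/ 2) * CGamma ((mu + 1) / 2)))%C.
Proof.
  intros H. induction k as [|k IH].
  - simpl (2 * 0)%nat. simpl wc. simpl (INR 0). rewrite Rplus_0_l.
    replace (1 + mu / 2)%C with (mu / 2 + 1)%C by ring.
    rewrite Wint_Gamma by auto. simpl. rewrite Rmult_1_r. ring.
  - replace (2 * S k)%nat with (S (S (2 * k))) by lia.
    change (wc mu (S (S (2 * k)))) with (RtoC (INR (S (2 * k))) / (RtoC (INR (S (2 * k)) + 1) + mu) * wc mu (2 * k))%C.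
    pose proof (pos_INR k) as Pk.
    assert (Rm : Re (mu / 2)%C = Re mu / 2).
    { replace (mu / 2)%C with (RtoC (/ 2) * mu)%C by (rewrite RtoC_inv by lra; field). unfold Re; simpl; field. }
    replace (RtoC (INR (S k) + 1) + mu / 2)%C with (RtoC (INR k + 1) + mu / 2 + 1)%C by (rewrite S_INR, !RtoC_plus; ring).
    rewrite CGamma_S by (change (0 < INR k + 1 + Re (mu / 2)%C); lra).
    rewrite !RtoC_fact_S.
    set (X := CGamma (RtoC (INR k + 1) + mu / 2)) in *.
    transitivity (RtoC (INR (S (S (2 * k)))) * RtoC (INR (S (2 * k))) * (wc mu (2 * k) * X * RtoC (4 ^ k * INR (fact k))))%C.
    + assert (D0 : (RtoC (INR (S (2 * k)) + 1) + mu)%C <> 0).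
      { apply Cneq0_Re. change (INR (S (2 * k)) + 1 + Re mu <> 0). pose proof (pos_INR (S (2 * k))). lra. }
      assert (E : RtoC (INR (S (2 * k))) = (2 * RtoC (INR k) + 1)%C) by (rewrite S_INR, mult_INR, RtoC_plus, RtoC_mult; simpl (INR 2); reflexivity).
      assert (E2 : RtoC (INR (S (S (2 * k)))) = (2 * RtoC (INR k) + 2)%C).
      { rewrite S_INR, RtoC_plus, E. ring. }
      rewrite RtoC_plus, E in D0. rewrite fact_simpl, mult_INR, (S_INR k). simpl pow.
      rewrite E2, !RtoC_mult, !RtoC_plus, E. field. auto.
    + rewrite IH. ring.
Qed.

(** Moments normalized so that they are the exponential coefficients of [Itilde (mu / 2)]; the odd
    ones vanish. *)
Definition Icoef (mu : CC) (i : nat) : CC := (/ (CGamma (/ 2) * CGamma ((mu + 1) / 2)) * wc mu i)%C.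

Lemma Cbounded_Icoef (mu : CC) : -1 < Re mu -> Cbounded (Icoef mu).
Proof.
  intros H. exists (Cmod (/ (CGamma (/ 2) * CGamma ((mu + 1) / 2)))%C * Cmod (Wint mu)). intros n.
  unfold Icoef. rewrite Cmod_mult. apply Rmult_le_compat_l; [apply Cmod_ge_0 | apply Cmod_wc, H].
Qed.

Lemma PSeries_egf_even (c : nat -> R) (z : R) : Rbounded c -> (forall k, c (2 * k + 1)%nat = 0) ->
  PSeries (egf c) z = Series (fun k => c (2 * k)%nat / INR (fact (2 * k)) * z ^ (2 * k)).
Proof.
  intros [B HB] Ho.
  assert (O : forall w, ex_pseries (fun n => egf c (2 * n + 1)) w /\ PSeries (fun n => egf c (2 * n + 1)) w = 0).
  { intros w. assert (I : is_pseries (fun n => egf c (2 * n + 1)) w 0).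
    { apply is_pseries_ext with (fun _ => 0).
      - intros n. unfold egf. rewrite Ho. match goal with |- @eq _ ?a ?b => change (@eq R a b) end. field. apply INR_fact_neq_0.
      - apply (is_series_ext (fun _ => 0)); [intros n; unfold scal; simpl; unfold mult; simpl; ring|].
        apply is_series_Reals. intros eps He. exists O. intros n _. rewrite sum_eq_R0; auto.
        unfold R_dist. rewrite Rminus_0_r, Rabs_R0. exact He. }
    split; [exists 0; exact I | apply is_pseries_unique, I]. }
  rewrite PSeries_odd_even.
  - rewrite (proj2 (O _)), Rmult_0_r, Rplus_0_r. apply Series_ext. intros k. unfold egf. rewrite pow_mult. reflexivity.
  - apply CV_radius_inside.
    (* In the variable [z^2] the coefficients are [c(2n) / (2n)!], that is, an exponential series
       with coefficients [c(2n) n! / (2n)!], again bounded by [B]. *)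
    rewrite (CV_radius_ext _ (egf (fun n => c (2 * n)%nat * (INR (fact n) / INR (fact (2 * n)))))).
    + apply CV_radius_egf. exists B. intros n. rewrite Rabs_mult.
      assert (0 < INR (fact n) <= INR (fact (2 * n))) by (split; [apply INR_fact_lt_0 | apply le_INR, fact_le; lia]).
      assert (0 <= INR (fact n) / INR (fact (2 * n)) <= 1).
      { split; [apply Rdiv_le_0_compat; lra | apply Rle_div_l; lra]. }
      rewrite (Rabs_pos_eq (_ / _)) by lra. pose proof (Rabs_pos (c (2 * n)%nat)). specialize (HB (2 * n)%nat). nra.
    + intros n. unfold egf. field. split; apply INR_fact_neq_0.
  - apply O.
Qed.

Lemma Itilde_egf (mu : CC) (z : R) : -1 < Re mu -> Itilde (mu / 2) z = Cegf (Icoef mu) z.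
Proof.
  intros H. unfold Itilde, CSeries, Cegf.
  assert (G0 : (CGamma (/ 2) * CGamma ((mu + 1) / 2))%C <> 0).
  { apply Cmult_neq_0; apply CGamma_neq0.
    - unfold Re; simpl. assert (2 / (2 * (2 * 1) + 0 * (0 * 1)) = / 2) by field. lra.
    - replace ((mu + 1) / 2)%C with (RtoC (/ 2) * (mu + 1))%C by (rewrite RtoC_inv by lra; field). unfold Re in *; simpl; lra. }
  assert (T : forall k, (RtoC ((z / 2) ^ (2 * k)) / (RtoC (INR (fact k)) * CGamma (RtoC (INR k + 1) + mu / 2)))%C
     = (RtoC (z ^ (2 * k) / INR (fact (2 * k))) * Icoef mu (2 * k))%C).
  { intros k. pose proof (wc_even mu k H) as E. unfold Icoef.
    assert (G1 : CGamma (RtoC (INR k + 1) + mu / 2)%C <> 0).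
    { apply CGamma_neq0. replace (mu / 2)%C with (RtoC (/ 2) * mu)%C by (rewrite RtoC_inv by lra; field).
      pose proof (pos_INR k). unfold Re in *; simpl; lra. }
    set (X := CGamma (RtoC (INR k + 1) + mu / 2)) in *. set (Y := (CGamma (/ 2) * CGamma ((mu + 1) / 2))%C) in *.
    assert (F4 : RtoC (4 ^ k) <> 0) by (apply RtoC_neq0, pow_nonzero; lra).
    rewrite RtoC_mult in E.
    replace ((z / 2) ^ (2 * k)) with (z ^ (2 * k) / 4 ^ k).
    2:{ unfold Rdiv. rewrite Rpow_mult_distr, (pow_mult (/ 2)). replace ((/ 2) ^ 2) with (/ 4) by field. now rewrite pow_inv. }
    unfold Rdiv. rewrite !RtoC_mult, !RtoC_inv by (try apply INR_fact_neq_0; apply pow_nonzero; lra).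
    pose proof (RtoC_fact_neq0 k) as Fk. pose proof (RtoC_fact_neq0 (2 * k)) as F2k.
    replace (wc mu (2 * k)) with (RtoC (INR (fact (2 * k))) * Y / (X * (RtoC (4 ^ k) * RtoC (INR (fact k)))))%C.
    - field. repeat split; auto.
    - rewrite <- E. field. repeat split; auto. }
  assert (P : forall (r : R) (z : CC), Re (RtoC r * z)%C = Re z * r /\ Im (RtoC r * z)%C = Im z * r).
  { intros r u. unfold Re, Im; simpl. split; ring. }
  f_equal.
  - rewrite PSeries_egf_even.
    + apply Series_ext. intros k. rewrite T, (proj1 (P _ _)). unfold Rdiv. ring.
    + apply Cbounded_Re, Cbounded_Icoef, H.
    + intros k. unfold Icoef. rewrite wc_odd, Cmult_0_r. reflexivity.
  - rewrite PSeries_egf_even.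
    + apply Series_ext. intros k. rewrite T, (proj2 (P _ _)). unfold Rdiv. ring.
    + apply Cbounded_Im, Cbounded_Icoef, H.
    + intros k. unfold Icoef. rewrite wc_odd, Cmult_0_r. reflexivity.
Qed.

(** Differencing the moments in [i] multiplies the integrand by [cos x - 1]. *)
Lemma iterdiff_Icoef (mu : CC) (n i : nat) :
  iterdiff n (Icoef mu) i = (/ (CGamma (/ 2) * CGamma ((mu + 1) / 2)) * cosdiff mu (-1) n i)%C.
Proof.
  revert i. induction n as [|n IH]; intros i; [reflexivity|].
  rewrite iterdiff_S, !IH. simpl cosdiff. ring.
Qed.

(** * Bessel functions of half-integer order *)

Lemma is_RInt_gen_subst {Fa Fb Ga Gb : (R -> Prop) -> Prop}
  {FFa : Filter Fa} {FFb : Filter Fb} {FGa : Filter Ga} {FGb : Filter Gb}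
  (D : R -> Prop) (f g dg : R -> R) (l : R) :
  is_interval D -> Fa D -> Fb D ->
  (forall x, D x -> is_derive g x (dg x)) -> (forall x, D x -> continuous dg x) ->
  (forall x, D x -> continuous f (g x)) ->
  filterlim g Fa Ga -> filterlim g Fb Gb ->
  is_RInt_gen f Ga Gb l -> is_RInt_gen (fun x => dg x * f (g x)) Fa Fb l.
Proof.
  intros HD Ha Hb Hg Hdg Hf La Lb I P HP.
  destruct (I P HP) as [Qa Qb HQa HQb HQ].
  specialize (La _ HQa). specialize (Lb _ HQb). unfold filtermap in La, Lb.
  exists (fun x => D x /\ Qa (g x)) (fun x => D x /\ Qb (g x)); try (apply filter_and; assumption).
  intros a b [Da A] [Db B]. destruct (HQ (g a) (g b) A B) as [y [Y1 Y2]]. exists y; split; [|exact Y2].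
  simpl in *. rewrite <- (is_RInt_unique (V:=R_CompleteNormedModule) _ _ _ _ Y1).
  apply (is_RInt_comp (V:=R_CompleteNormedModule) f g dg a b).
  - intros x Hx. apply Hf, (HD a b x); auto.
  - intros x Hx. split; [apply Hg | apply Hdg]; apply (HD a b x); auto.
Qed.

(** Bridges the two conventions for the lower limit: [BesselK] starts at the point 0, the Gamma
    integral on the right of 0. For continuous [f] the missing piece near 0 is arbitrarily small. *)
Lemma is_RInt_gen_at_right_point {Fb : (R -> Prop) -> Prop} {FFb : Filter Fb} (f : R -> R) (l : R) :
  (forall x, continuous f x) -> is_RInt_gen f (at_right 0) Fb l -> is_RInt_gen f (at_point 0) Fb l.
Proof.
  intros Hf I P [eps HP].
  assert (E2 : 0 < eps / 2) by (pose proof (cond_pos eps); lra).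
  destruct (I (ball l (mkposreal _ E2)) (locally_ball l _)) as [Qa Qb HQa HQb HQ].
  assert (Ex : forall a b, ex_RInt f a b) by (intros; apply (ex_RInt_continuous (V:=R_CompleteNormedModule)); auto).
  assert (C0 : continuous (fun x => RInt f 0 x) 0).
  { apply (ex_derive_continuous (V:=R_NormedModule)). exists (f 0). apply (is_derive_RInt (V:=R_NormedModule) f _ 0 0); auto.
    exists (mkposreal 1 Rlt_0_1). intros y _. apply (RInt_correct (V:=R_CompleteNormedModule)), Ex. }
  specialize (C0 (ball (RInt f 0 0) (mkposreal _ E2)) (locally_ball _ _)).
  assert (C1 : at_right 0 (fun x => ball (RInt f 0 0) (mkposreal _ E2) (RInt f 0 x))).
  { unfold at_right, within. revert C0. unfold filtermap. apply filter_imp. auto. }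
  destruct (filter_ex _ (filter_and _ _ HQa C1)) as [a [Aa Ba]].
  exists (fun x => x = 0) Qb; auto; [reflexivity|].
  intros x b -> Hb. simpl. exists (RInt f 0 b). split; [apply (RInt_correct (V:=R_CompleteNormedModule)), Ex|].
  destruct (HQ a b Aa Hb) as [y [Y1 Y2]]. simpl in Y1. apply HP.
  rewrite RInt_point in Ba. rewrite <- (RInt_Chasles f 0 a b) by auto. rewrite (is_RInt_unique _ _ _ _ Y1).
  unfold ball in *; simpl in *; unfold AbsRing_ball, abs, minus, plus, opp, zero in *; simpl in *.
  replace (RInt f 0 a + y + - l) with ((RInt f 0 a + - 0) + (y + - l)) by ring.
  eapply Rle_lt_trans; [apply Rabs_triang|]. lra.
Qed.

Lemma filterlim_at_point (g : R -> R) (a : R) : filterlim g (at_point a) (at_point (g a)).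
Proof. intros P HP. exact HP. Qed.

Lemma cosh_ge (s : R) : 1 + s <= 2 * cosh s.
Proof. unfold cosh. pose proof (exp_ineq1_le s). pose proof (exp_pos (- s)). lra. Qed.

Lemma cosh_half (s : R) : cosh s - 1 = 2 * sinh (s / 2) ^ 2.
Proof.
  unfold cosh, sinh. replace s with (s / 2 + s / 2) at 1 2 by field. rewrite Ropp_plus_distr, !exp_plus.
  replace (- s / 2) with (- (s / 2)) by field. rewrite exp_Ropp. pose proof (exp_pos (s / 2)). field. lra.
Qed.

Lemma sinh_half (s : R) : sinh s = 2 * sinh (s / 2) * cosh (s / 2).
Proof.
  unfold cosh, sinh. replace s with (s / 2 + s / 2) at 1 2 by field. rewrite Ropp_plus_distr, !exp_plus. field.
Qed.

Lemma sinh_sqr (s : R) : sinh s ^ 2 = (cosh s - 1) * (cosh s - 1 + 2).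
Proof.
  unfold cosh, sinh. rewrite exp_Ropp. pose proof (exp_pos s). field. lra.
Qed.

Lemma sinh_pos (s : R) : 0 < s -> 0 < sinh s.
Proof. intros H. unfold sinh. assert (exp (- s) < exp s) by (apply exp_increasing; lra). lra. Qed.

Lemma filterlim_cosh_infty (z : R) : 0 < z ->
  filterlim (fun s => z * (cosh s - 1)) (Rbar_locally p_infty) (Rbar_locally p_infty).
Proof.
  intros Hz P [M HM]. exists (2 * Rabs M / z + 1). intros s Hs. apply HM.
  pose proof (cosh_ge s). pose proof (Rle_abs M).
  assert (E : 2 * Rabs M / z * z = 2 * Rabs M) by (field; lra). nra.
Qed.

Lemma filterlim_cosh_0 (z : R) : 0 < z ->
  filterlim (fun s => z * (cosh s - 1)) (at_right 0) (at_right 0).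
Proof.
  intros Hz P HP. unfold filtermap.
  assert (L : at_right 0 (fun s => z * (cosh s - 1) > 0 -> P (z * (cosh s - 1)))).
  { pose proof (filterlim_at_right_continuous (fun s => z * (cosh s - 1)) 0) as C.
    cbv beta in C. replace (z * (cosh 0 - 1)) with 0 in C by (rewrite cosh_0; ring).
    apply (C ltac:(apply (ex_derive_continuous (V:=R_NormedModule)); auto_derive; auto) (fun u => u > 0 -> P u) HP). }
  generalize (filter_and _ _ L at_right_pos). apply filter_imp. intros s [A B]. apply A.
  rewrite cosh_half. pose proof (sinh_pos (s / 2) ltac:(lra)). apply Rmult_lt_0_compat; [auto|].
  apply Rmult_lt_0_compat; [lra | apply pow_lt; auto].
Qed.

Definition Kfun (nu z s : R) : R := exp (- z * cosh s) * cosh (nu * s).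

Notation is_K nu z l := (is_RInt_gen (Kfun nu z) (at_point 0) (Rbar_locally p_infty) l).

(** [Gamma(1/2)] as a real number, so that it can scale the real function [Ktilde]. *)
Definition sG : R := Re (CGamma (/ 2)).

Lemma Re_half : Re (/ 2)%C = / 2.
Proof. unfold Re; simpl; field. Qed.

Lemma is_RInt_gen_sG :
  is_RInt_gen (fun u => Rpower u (- / 2) * exp (- u)) (at_right 0) (Rbar_locally p_infty) sG.
Proof.
  assert (H : 0 < Re (/ 2)%C) by (rewrite Re_half; lra).
  pose proof (is_Cint_Re _ _ (is_Cint_gint _ H)) as I. revert I. apply is_RInt_gen_ext.
  exists (fun x => 0 < x) (fun x => 0 < x); [apply at_right_pos | apply p_infty_pos |].
  intros a b Ha Hb x Hx. unfold gint.
  replace (/ 2 - 1)%C with (RtoC (- / 2)) by (rewrite RtoC_opp, RtoC_inv by lra; field).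
  rewrite rpowC_RtoC, <- RtoC_mult. reflexivity.
Qed.

Lemma CGamma_half : CGamma (/ 2) = RtoC sG.
Proof.
  unfold CGamma; apply is_Cint_unique. pose proof (is_Cint_RtoC _ _ is_RInt_gen_sG) as I. revert I.
  apply is_Cint_ext with (fun x => 0 < x); [apply is_interval_gt | apply at_right_pos | apply p_infty_pos |].
  intros x Hx. replace (/ 2 - 1)%C with (RtoC (- / 2)) by (rewrite RtoC_opp, RtoC_inv by lra; field).
  rewrite rpowC_RtoC, <- RtoC_mult. reflexivity.
Qed.

Lemma Kfun_continuous (nu z s : R) : continuous (Kfun nu z) s.
Proof. apply (ex_derive_continuous (V:=R_NormedModule)). unfold Kfun. auto_derive; auto. Qed.

Lemma Rpower_half_sqr (x : R) : 0 < x -> Rpower x (/ 2) * Rpower x (/ 2) = x.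
Proof. intros H. rewrite <- Rpower_plus. replace (/ 2 + / 2) with 1 by field. apply Rpower_1, H. Qed.

(** Substitute [u = z (cosh s - 1) = 2 z sinh^2(s/2)] in the integral of [u^(-1/2) e^(-u)]: since
    [sinh s = 2 sinh(s/2) cosh(s/2)], the factor [sinh(s/2)] cancels and [cosh(s/2)] remains. *)
Lemma is_K_half (z : R) : 0 < z -> is_K (/ 2) z (sG * exp (- z) * / Rpower (2 * z) (/ 2)).
Proof.
  intros Hz. apply is_RInt_gen_at_right_point; [apply Kfun_continuous|].
  set (q := Rpower (2 * z) (/ 2)). assert (Pq : 0 < q) by apply exp_pos.
  assert (Q2 : q * q = 2 * z) by (apply Rpower_half_sqr; lra).
  pose proof (is_RInt_gen_subst (Fa := at_right 0) (Fb := Rbar_locally p_infty) (Ga := at_right 0) (Gb := Rbar_locally p_infty) (fun s => 0 < s)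
    (fun u => Rpower u (- / 2) * exp (- u)) (fun s => z * (cosh s - 1)) (fun s => z * sinh s) sG) as S.
  assert (I : is_RInt_gen (fun x => z * sinh x * (Rpower (z * (cosh x - 1)) (- / 2) * exp (- (z * (cosh x - 1))))) (at_right 0) (Rbar_locally p_infty) sG).
  { apply S.
    - apply is_interval_gt.
    - apply at_right_pos.
    - apply p_infty_pos.
    - intros x Hx. auto_derive; auto. ring.
    - intros x Hx. apply (ex_derive_continuous (V:=R_NormedModule)). auto_derive; auto.
    - intros x Hx. apply (ex_derive_continuous (V:=R_NormedModule) (fun u => Rpower u (- / 2) * exp (- u))).
      unfold Rpower. auto_derive. rewrite cosh_half. pose proof (sinh_pos (x / 2) ltac:(lra)).
      apply Rmult_lt_0_compat; [auto|]. apply Rmult_lt_0_compat; [lra | apply pow_lt; auto].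
    - apply filterlim_cosh_0, Hz.
    - apply filterlim_cosh_infty, Hz.
    - apply is_RInt_gen_sG. }
  apply (is_RInt_gen_Rscal (exp (- z) * / q)) in I.
  replace (sG * exp (- z) * / q) with (exp (- z) * / q * sG) by ring.
  revert I. apply is_RInt_gen_ext.
  exists (fun x => 0 < x) (fun x => 0 < x); [apply at_right_pos | apply p_infty_pos |].
  intros a b Ha Hb x Hx. simpl in Hx. assert (Hx0 : 0 < x) by (apply (is_interval_gt 0 a b); auto; lra).
  match goal with |- @eq _ ?a ?b => change (@eq R a b) end.
  pose proof (sinh_pos (x / 2) ltac:(lra)) as Sp.
  assert (EP : Rpower (z * (cosh x - 1)) (- / 2) = / (q * sinh (x / 2))).
  { rewrite Rpower_Ropp. f_equal. rewrite cosh_half.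
    replace (z * (2 * sinh (x / 2) ^ 2)) with (2 * z * (sinh (x / 2) ^ 2)) by ring.
    rewrite <- Rpower_mult_distr by (try apply pow_lt; lra). fold q. f_equal.
    rewrite <- Rpower_pow, Rpower_mult by auto. replace (INR 2 * / 2) with 1 by (simpl; field). apply Rpower_1, Sp. }
  rewrite EP, sinh_half. unfold Kfun.
  replace (- (z * (cosh x - 1))) with (- z * cosh x + z) by ring. rewrite exp_plus.
  assert (EZ : exp (- z) * exp z = 1) by (rewrite <- exp_plus, Rplus_opp_l; apply exp_0).
  replace (/ 2 * x) with (x / 2) by field.
  transitivity ((exp (- z) * exp z) * (2 * z) * / (q * q) * (exp (- z * cosh x) * cosh (x / 2))).
  - field. split; lra.
  - rewrite EZ, Q2. field. lra.
Qed.

Lemma Rabs_sinh_le (s : R) : 0 <= s -> Rabs (sinh s) <= exp s.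
Proof.
  intros H. unfold sinh. rewrite Rabs_pos_eq.
  - pose proof (exp_pos (- s)). pose proof (exp_pos s). lra.
  - assert (exp (- s) <= exp s) by (destruct (Rle_lt_or_eq_dec 0 s H) as [L|<-]; [left; apply exp_increasing; lra | rewrite Ropp_0; lra]). lra.
Qed.

Lemma Kfun_sinh_lim (nu z : R) : 0 <= nu -> 0 < z ->
  filterlim (fun s => exp (- z * cosh s) * sinh (nu * s)) (Rbar_locally p_infty) (locally 0).
Proof.
  intros Hn Hz. destruct (nat_bound (nu + 1)) as [N HN].
  (* With [x = (z/2) e^s], one has [e^(-z cosh s) <= e^(-x)] and [e^(nu s) = (2/z)^nu x^nu]; the
     bound [x^nu e^(-x) <= N! / x] and [1/x = (2/z) e^(-s)] then give [C e^(-s)]. *)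
  set (C := Rpower (2 / z) nu * INR (fact N) * (2 / z)).
  assert (L : filterlim (fun s => C * exp (- s)) (Rbar_locally p_infty) (locally 0)).
  { apply filterlim_scal_0. intros P HP. pose proof (is_lim_exp_m P HP) as [M HM].
    exists (- M). intros x Hx. apply HM. lra. }
  assert (Lm : filterlim (fun s => - (C * exp (- s))) (Rbar_locally p_infty) (locally 0)).
  { apply filterlim_ext with (fun s => -1 * (C * exp (- s))); [intros; ring|]. apply filterlim_scal_0, L. }
  change (locally 0) with (Rbar_locally (Finite 0)).
  apply filterlim_le_le with (fun s => - (C * exp (- s))) (fun s => C * exp (- s)); auto.
  exists (2 / z). intros s Hs.
  assert (H2z : 0 < 2 / z) by (apply Rdiv_lt_0_compat; lra).
  apply Rabs_le_between. rewrite Rabs_mult, (Rabs_pos_eq (exp _)) by (left; apply exp_pos).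
  assert (Hns : 0 <= nu * s) by (apply Rmult_le_pos; lra).
  pose proof (Rabs_sinh_le _ Hns) as H1.
  set (x := z / 2 * exp s).
  assert (Hx : 1 <= x).
  { unfold x. pose proof (exp_ineq1_le s). assert (E : z / 2 * (2 / z) = 1) by (field; lra). nra. }
  pose proof (Rpower_exp_le x nu N Hx HN) as H3.
  assert (E1 : exp (- z * cosh s) <= exp (- x)).
  { unfold x, cosh. pose proof (exp_pos (- s)).
    destruct (Rle_lt_or_eq_dec (- z * ((exp s + exp (- s)) / 2)) (- (z / 2 * exp s))) as [Q|Q]; [nra | left; apply exp_increasing; auto | rewrite Q; lra]. }
  assert (E2 : exp (nu * s) = Rpower (2 / z) nu * Rpower x nu).
  { rewrite Rpower_mult_distr by (lra || (unfold x; apply Rmult_lt_0_compat; [lra | apply exp_pos])).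
    replace (2 / z * x) with (exp s) by (unfold x; field; lra). unfold Rpower. rewrite ln_exp. reflexivity. }
  apply Rle_trans with (exp (- x) * (Rpower (2 / z) nu * Rpower x nu)).
  - rewrite <- E2. apply Rmult_le_compat; auto; [left; apply exp_pos | apply Rabs_pos].
  - replace (exp (- x) * (Rpower (2 / z) nu * Rpower x nu)) with (Rpower (2 / z) nu * (Rpower x nu * exp (- x))) by ring.
    unfold C. replace (Rpower (2 / z) nu * INR (fact N) * (2 / z) * exp (- s)) with (Rpower (2 / z) nu * (INR (fact N) * / x)).
    + apply Rmult_le_compat_l; [left; apply exp_pos | exact H3].
    + unfold x. rewrite exp_Ropp. field. split; [apply Rgt_not_eq, exp_pos | lra].
Qed.

(** [cosh((nu+1)s) - cosh((nu-1)s) = 2 sinh s sinh(nu s)], and [sinh s e^(-z cosh s)] is integrated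
    by parts against [sinh(nu s)]. *)
Lemma is_K_step (nu z k0 k1 : R) : 0 <= nu -> 0 < z ->
  is_K (nu - 1) z k0 -> is_K nu z k1 -> is_K (nu + 1) z (k0 + 2 * nu / z * k1).
Proof.
  intros Hn Hz I0 I1.
  assert (J : is_RInt_gen (fun s => exp (- z * cosh s) * (nu * cosh (nu * s) - z * sinh s * sinh (nu * s))) (at_point 0) (Rbar_locally p_infty) (0 - 0)).
  { apply (is_RInt_gen_ftc (V:=R_CompleteNormedModule) (fun _ => True) (fun s => exp (- z * cosh s) * sinh (nu * s))); [apply is_interval_True | exact Logic.I | apply filter_true | | | |].
    - intros x _. auto_derive; auto. ring.
    - intros x _. apply (ex_derive_continuous (V:=R_NormedModule)). auto_derive; auto.
    - intros P [eps HP]. apply HP. simpl. rewrite Rmult_0_r, sinh_0, Rmult_0_r. apply ball_center.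
    - apply Kfun_sinh_lim; auto. }
  pose proof (is_RInt_gen_Rplus _ _ _ _ I0 (is_RInt_gen_Rplus _ _ _ _ (is_RInt_gen_Rscal (2 * nu / z) _ _ I1) (is_RInt_gen_Rscal (- (2 / z)) _ _ J))) as K.
  replace (k0 + 2 * nu / z * k1) with (k0 + (2 * nu / z * k1 + - (2 / z) * (0 - 0))) by ring.
  revert K. apply is_RInt_gen_ext. apply filter_forall. intros ab x _.
  match goal with |- @eq _ ?a ?b => change (@eq R a b) end.
  unfold Kfun. assert (E : cosh ((nu + 1) * x) = cosh ((nu - 1) * x) + 2 * sinh x * sinh (nu * x)).
  { replace ((nu + 1) * x) with (nu * x + x) by ring. replace ((nu - 1) * x) with (nu * x + - x) by ring.
    unfold cosh, sinh. rewrite !Ropp_plus_distr, Ropp_involutive, !exp_plus. field. }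
  rewrite E. field. lra.
Qed.

(** * Laplace transforms of polynomials *)

Notation is_Lap f l := (is_RInt_gen f (at_point 0) (Rbar_locally p_infty) l).

Lemma exp_pow_lim (z : R) (n : nat) : 0 < z ->
  filterlim (fun v => exp (- z * v) * v ^ n) (Rbar_locally p_infty) (locally 0).
Proof.
  intros Hz. set (C := INR (fact (S n)) / z ^ S n).
  assert (L : filterlim (fun v => C * / v) (Rbar_locally p_infty) (locally 0)) by apply filterlim_scal_0, filterlim_inv_p_infty.
  change (locally 0) with (Rbar_locally (Finite 0)).
  apply filterlim_le_le with (fun _ => 0) (fun v => C * / v); auto.
  - exists 1. intros v Hv. assert (Pv : 0 < v ^ n) by (apply pow_lt; lra). pose proof (exp_pos (- z * v)).
    split; [apply Rmult_le_pos; lra|].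
    pose proof (pow_le_fact_exp (z * v) (S n) ltac:(nra)) as P. pose proof (exp_pos (z * v)).
    replace (- z * v) with (- (z * v)) by ring. rewrite exp_Ropp. rewrite Rpow_mult_distr in P.
    assert (Pz : 0 < z ^ S n) by (apply pow_lt; lra).
    apply Rmult_le_reg_r with (z ^ S n * v * exp (z * v)); [apply Rmult_lt_0_compat; [apply Rmult_lt_0_compat|]; lra|].
    replace (/ exp (z * v) * v ^ n * (z ^ S n * v * exp (z * v))) with (z ^ S n * v ^ S n) by (simpl; field; lra).
    unfold C. replace (INR (fact (S n)) / z ^ S n * / v * (z ^ S n * v * exp (z * v))) with (INR (fact (S n)) * exp (z * v)) by (field; lra).
    exact P.
  - apply filterlim_const.
Qed.

Lemma is_Lap_pow (z : R) (n : nat) : 0 < z -> is_Lap (fun v => exp (- z * v) * v ^ n) (INR (fact n) / z ^ S n).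
Proof.
  intros Hz. induction n as [|n IH].
  - replace (INR (fact 0) / z ^ 1) with (0 - - / z) by (simpl; field; lra).
    apply (is_RInt_gen_ftc (V:=R_CompleteNormedModule) (fun _ => True) (fun v => - / z * (exp (- z * v) * v ^ 0))); [apply is_interval_True | exact Logic.I | apply filter_true | | | |].
    + intros x _. auto_derive; auto. simpl. field. lra.
    + intros x _. apply (ex_derive_continuous (V:=R_NormedModule)). auto_derive; auto.
    + intros P [eps HP]. apply HP. replace (- / z * (exp (- z * 0) * 0 ^ 0)) with (- / z); [apply ball_center|].
      rewrite Rmult_0_r, exp_0. simpl. ring.
    + apply filterlim_scal_0, exp_pow_lim, Hz.
  - assert (J : is_Lap (fun v => exp (- z * v) * (INR (S n) * v ^ n - z * v ^ S n)) (0 - 0)).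
    { apply (is_RInt_gen_ftc (V:=R_CompleteNormedModule) (fun _ => True) (fun v => exp (- z * v) * v ^ S n)); [apply is_interval_True | exact Logic.I | apply filter_true | | | |].
      + intros x _. evar_last. { apply (is_derive_mult (fun v => exp (- z * v)) (fun v => v ^ S n)).
          - auto_derive; auto.
          - apply is_derive_pow. apply (is_derive_id (K:=R_AbsRing)).
          - intros; apply Rmult_comm. }
        unfold plus, mult, one; simpl. unfold one; simpl. change (match n with O => 1 | S _ => INR n + 1 end) with (INR (S n)). ring.
      + intros x _. apply (ex_derive_continuous (V:=R_NormedModule)). auto_derive; auto.
      + intros P [eps HP]. apply HP. simpl. rewrite Rmult_0_l, Rmult_0_r. apply ball_center.
      + apply exp_pow_lim, Hz. }
    pose proof (is_RInt_gen_Rplus _ _ _ _ (is_RInt_gen_Rscal (INR (S n) / z) _ _ IH) (is_RInt_gen_Rscal (- / z) _ _ J)) as K.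
    replace (INR (fact (S n)) / z ^ S (S n)) with (INR (S n) / z * (INR (fact n) / z ^ S n) + - / z * (0 - 0)).
    + revert K. apply is_RInt_gen_ext. apply filter_forall. intros ab x _.
      match goal with |- @eq _ ?a ?b => change (@eq R a b) end. simpl pow. field. lra.
    + rewrite fact_simpl, mult_INR. simpl pow. field. split; [apply pow_nonzero; lra | lra].
Qed.

Lemma is_RInt_gen_sum {Fa Fb} {FFa : Filter Fa} {FFb : Filter Fb} (f : nat -> R -> R) (l : nat -> R) (n : nat) :
  (forall i, is_RInt_gen (f i) Fa Fb (l i)) ->
  is_RInt_gen (fun x => sum_f_R0 (fun i => f i x) n) Fa Fb (sum_f_R0 l n).
Proof.
  intros H. induction n as [|n IH]; simpl; [apply H|]. apply is_RInt_gen_Rplus; auto.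
Qed.

Definition polyc (l i : nat) : R := Binomial.C l i * 2 ^ (l - i).

Lemma pow_polyc (l : nat) (v : R) : (v * (v + 2)) ^ l = sum_f_R0 (fun i => polyc l i * v ^ (l + i)) l.
Proof.
  rewrite Rpow_mult_distr, binomial, scal_sum. apply sum_eq. intros i Hi. unfold polyc. rewrite pow_add. ring.
Qed.

(** The Laplace transform of [(v (v+2))^l v^p] at [z]. It serves both sides of the identity: the
    [phi]-integrals for all [p], and K-tilde of order [l + 1/2] for [p = 0]. *)
Definition Jval (l p : nat) (z : R) : R :=
  sum_f_R0 (fun i => polyc l i * (INR (fact (l + i + p)) / z ^ S (l + i + p))) l.

Lemma is_Lap_Jval (l p : nat) (z : R) : 0 < z ->
  is_Lap (fun v => exp (- z * v) * ((v * (v + 2)) ^ l * v ^ p)) (Jval l p z).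
Proof.
  intros Hz.
  assert (I : is_Lap (fun v => sum_f_R0 (fun i => polyc l i * (exp (- z * v) * v ^ (l + i + p))) l) (Jval l p z)).
  { apply is_RInt_gen_sum. intros i. apply is_RInt_gen_Rscal, is_Lap_pow, Hz. }
  revert I. apply is_RInt_gen_ext. apply filter_forall. intros ab v _.
  match goal with |- @eq _ ?a ?b => change (@eq R a b) end.
  rewrite pow_polyc, (Rmult_comm _ (v ^ p)), <- Rmult_assoc, scal_sum. apply sum_eq. intros i _. rewrite !pow_add. ring.
Qed.

Lemma is_derive_Rmult (f g : R -> R) (x df dg : R) :
  is_derive f x df -> is_derive g x dg -> is_derive (fun t => f t * g t) x (df * g x + f x * dg).
Proof. intros A B. apply (is_derive_mult f g x df dg A B). intros; apply Rmult_comm. Qed.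

Lemma is_derive_Rplus (f g : R -> R) (x df dg : R) :
  is_derive f x df -> is_derive g x dg -> is_derive (fun t => f t + g t) x (df + dg).
Proof. exact (is_derive_plus (V:=R_NormedModule) f g x df dg). Qed.

(** For [P = v (v+2)], integrate by parts twice to turn [z^2 P^(l+2)] into its second derivative,
    then use [(2v+2)^2 = 4P + 4]. This is the recursion of [is_K_step] in another normalization. *)
Lemma Jval_step (l : nat) (z : R) : 0 < z ->
  z ^ 2 * Jval (S (S l)) 0 z = 4 * INR (S l) * INR (S (S l)) * Jval l 0 z + INR (S (S l)) * (4 * INR (S l) + 2) * Jval (S l) 0 z.
Proof.
  intros Hz. set (L := INR (S l)). assert (L2 : INR (S (S l)) = L + 1) by (unfold L; rewrite (S_INR (S l)); ring).
  rewrite L2.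
  (* [F = - e^(-zv) (z Q + Q')] with [Q = (v (v+2))^(l+2)], so that [F' = e^(-zv) (z^2 Q - Q'')].
     The exponents are large enough for [F] to vanish at 0. *)
  set (F := fun v => - exp (- z * v) * (z * (v * (v + 2)) ^ S (S l) + (L + 1) * ((v * (v + 2)) ^ S l * (2 * v + 2)))).
  assert (J : is_Lap (fun v => exp (- z * v) * (z ^ 2 * (v * (v + 2)) ^ S (S l) - (L + 1) * (L * (v * (v + 2)) ^ l * (2 * v + 2) ^ 2 + 2 * (v * (v + 2)) ^ S l))) (0 - 0)).
  { apply (is_RInt_gen_ftc (V:=R_CompleteNormedModule) (fun _ => True) F); [apply is_interval_True | exact Logic.I | apply filter_true | | | |].
    - intros x _. unfold F.
      assert (DP : forall m, is_derive (fun v => (v * (v + 2)) ^ S m) x (INR (S m) * (x * (x + 2)) ^ m * (2 * x + 2))).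
      { intros m. evar_last. { apply is_derive_pow. instantiate (1 := 2 * x + 2). auto_derive; auto. ring. }
        rewrite Rmult_comm. simpl pred. match goal with |- @eq _ ?a ?b => change (@eq R a b) end. ring. }
      assert (D0 : is_derive (fun v => - exp (- z * v)) x (z * exp (- z * x))) by (auto_derive; auto; ring).
      assert (D2 : is_derive (fun v => 2 * v + 2) x 2) by (auto_derive; auto; ring).
      assert (Dc : forall k, is_derive (fun _ : R => k) x 0) by (intros; auto_derive; auto).
      pose proof (is_derive_Rmult _ _ _ _ _ D0 (is_derive_Rplus _ _ _ _ _ (is_derive_Rmult _ _ _ _ _ (Dc z) (DP (S l)))
        (is_derive_Rmult _ _ _ _ _ (Dc (L + 1)) (is_derive_Rmult _ _ _ _ _ (DP l) D2)))) as D.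
      cbv beta in D. fold L in D. rewrite L2 in D.
      match type of D with is_derive _ _ ?d => match goal with |- is_derive _ _ ?e => replace e with d by (simpl pow; ring) end end.
      exact D.
    - intros x _. apply (ex_derive_continuous (V:=R_NormedModule)). auto_derive; auto.
    - intros P [eps HP]. apply HP. unfold F. simpl pow. replace (- exp (- z * 0) * _) with 0 by ring. apply ball_center.
    (* Expanded into monomials, each term decays by [exp_pow_lim]. *)
    - apply filterlim_ext with (fun v => sum_f_R0 (fun i => (- z * polyc (S (S l)) i) * (exp (- z * v) * v ^ (S (S l) + i))) (S (S l))
          + sum_f_R0 (fun i => (- (L + 1) * polyc (S l) i * 2) * (exp (- z * v) * v ^ (S l + i + 1)) + (- (L + 1) * polyc (S l) i * 2) * (exp (- z * v) * v ^ (S l + i))) (S l)).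
      { intros v. unfold F. rewrite !pow_polyc.
        replace (- exp (- z * v) * (z * sum_f_R0 (fun i => polyc (S (S l)) i * v ^ (S (S l) + i)) (S (S l)) +
            (L + 1) * (sum_f_R0 (fun i => polyc (S l) i * v ^ (S l + i)) (S l) * (2 * v + 2))))
          with ((- exp (- z * v) * z) * sum_f_R0 (fun i => polyc (S (S l)) i * v ^ (S (S l) + i)) (S (S l)) +
            (- exp (- z * v) * (L + 1) * (2 * v + 2)) * sum_f_R0 (fun i => polyc (S l) i * v ^ (S l + i)) (S l)) by ring.
        rewrite !scal_sum. f_equal; apply sum_eq; intros i _; rewrite ?pow_add; simpl pow; ring. }
      assert (Z2 : forall f g : R -> R, filterlim f (Rbar_locally p_infty) (locally 0) -> filterlim g (Rbar_locally p_infty) (locally 0) ->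
         filterlim (fun v => f v + g v) (Rbar_locally p_infty) (locally 0)).
      { intros f g Hf Hg. replace (locally 0) with (locally (0 + 0)) by (f_equal; ring).
        eapply filterlim_comp_2; [exact Hf | exact Hg | apply (filterlim_plus (V:=R_NormedModule) 0 0)]. }
      assert (Z : forall (f : nat -> R -> R) n, (forall i, filterlim (f i) (Rbar_locally p_infty) (locally 0)) ->
         filterlim (fun v => sum_f_R0 (fun i => f i v) n) (Rbar_locally p_infty) (locally 0)).
      { intros f n Hf. induction n as [|n IH]; simpl; [apply Hf|]. apply Z2; auto. }
      apply Z2; apply Z; intros i; [|apply Z2]; apply filterlim_scal_0, exp_pow_lim, Hz. }
  pose proof (fun m => is_Lap_Jval m 0 z Hz) as I.
  pose proof (is_RInt_gen_Rplus _ _ _ _ J (is_RInt_gen_Rplus _ _ _ _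
     (is_RInt_gen_Rscal (4 * L * (L + 1)) _ _ (I l)) (is_RInt_gen_Rscal ((L + 1) * (4 * L + 2)) _ _ (I (S l))))) as K.
  pose proof (is_RInt_gen_Rscal (z ^ 2) _ _ (I (S (S l)))) as K2.
  rewrite <- (is_RInt_gen_unique (V:=R_CompleteNormedModule) _ _ K2).
  replace (4 * L * (L + 1) * Jval l 0 z + (L + 1) * (4 * L + 2) * Jval (S l) 0 z) with
    (0 - 0 + (4 * L * (L + 1) * Jval l 0 z + (L + 1) * (4 * L + 2) * Jval (S l) 0 z)) by ring.
  apply (is_RInt_gen_unique (V:=R_CompleteNormedModule)).
  revert K. apply is_RInt_gen_ext. apply filter_forall. intros ab v _.
  match goal with |- @eq _ ?a ?b => change (@eq R a b) end. simpl pow. ring.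
Qed.

Lemma Jval_0 (z : R) : 0 < z -> Jval 0 0 z = / z.
Proof. intros Hz. unfold Jval, polyc, Binomial.C. simpl. field. lra. Qed.

Lemma Jval_1 (z : R) : 0 < z -> Jval 1 0 z = 2 / z ^ 2 + 2 / z ^ 3.
Proof. intros Hz. unfold Jval, polyc, Binomial.C. simpl. field. lra. Qed.

Definition Kval (l : nat) (z : R) : R :=
  Rpower (z / 2) (INR l + / 2) * (sG / INR (fact l) * exp (- z) * Jval l 0 z).

(** Both sides obey the same second order recursion in [l], so the induction carries two consecutive
    orders, starting from 1/2 and 3/2. *)
Lemma is_K_Kval (l : nat) (z : R) : 0 < z -> is_K (INR l + / 2) z (Kval l z).
Proof.
  intros Hz.
  assert (Q : Rpower (2 * z) (/ 2) = 2 * Rpower (z / 2) (/ 2)).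
  { replace (2 * z) with (2 * 2 * (z / 2)) by field. rewrite <- Rpower_mult_distr by lra. f_equal.
    rewrite <- Rpower_mult_distr, Rpower_half_sqr by lra. reflexivity. }
  assert (Pr : 0 < Rpower (z / 2) (/ 2)) by apply exp_pos.
  assert (R2 : Rpower (z / 2) (/ 2) * Rpower (z / 2) (/ 2) = z / 2) by (apply Rpower_half_sqr; lra).
  (* Writing [z = 2 r^2] turns the identities for the two starting orders into rational ones in
     [r]. *)
  remember (Rpower (z / 2) (/ 2)) as r eqn:Hr.
  pose proof (is_K_half z Hz) as H0. rewrite Q in H0.
  assert (H0' : is_K (INR 0 + / 2) z (Kval 0 z)).
  { simpl (INR 0). rewrite Rplus_0_l. unfold Kval. simpl (INR 0). rewrite Rplus_0_l, <- Hr. rewrite Jval_0 by auto.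
    replace (r * (sG / INR (fact 0) * exp (- z) * / z)) with (sG * exp (- z) * / (2 * r)); [exact H0|].
    simpl (INR (fact 0)). generalize (exp (- z)). intros e. clear - R2 Pr Hz. assert (Ez : z = 2 * (r * r)) by lra. subst z. field. lra. }
  (* Evenness of [cosh] gives order -1/2 from order 1/2, and with it the recursion reaches order
     3/2. *)
  assert (Hm : is_K (/ 2 - 1) z (sG * exp (- z) * / (2 * r))).
  { revert H0. apply is_RInt_gen_ext. apply filter_forall. intros ab x _. unfold Kfun. f_equal.
    replace ((/ 2 - 1) * x) with (- (/ 2 * x)) by field. unfold cosh. rewrite Ropp_involutive. f_equal. apply Rplus_comm. }
  enough (G : is_K (INR l + / 2) z (Kval l z) /\ is_K (INR (S l) + / 2) z (Kval (S l) z)) by apply G.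
  induction l as [|l [IH1 IH2]]; split; auto.
  - pose proof (is_K_step (/ 2) z _ _ ltac:(lra) Hz Hm H0) as K.
    replace (INR 1 + / 2) with (/ 2 + 1) by (simpl; ring).
    replace (Kval 1 z) with (sG * exp (- z) * / (2 * r) + 2 * / 2 / z * (sG * exp (- z) * / (2 * r))); [exact K|].
    unfold Kval. rewrite Jval_1 by auto. simpl (INR 1). rewrite Rpower_plus, Rpower_1 by lra. rewrite <- Hr.
    simpl (INR (fact 1)). generalize (exp (- z)). intros e. clear - R2 Pr Hz. assert (Ez : z = 2 * (r * r)) by lra. subst z. field. lra.
  - rewrite (S_INR (S l)). replace (INR (S l) + 1 + / 2) with (INR (S l) + / 2 + 1) by ring.
    assert (Pl := pos_INR l).
    replace (Kval (S (S l)) z) with (Kval l z + 2 * (INR (S l) + / 2) / z * Kval (S l) z).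
    + apply is_K_step; auto; [rewrite S_INR; lra|].
      replace (INR (S l) + / 2 - 1) with (INR l + / 2) by (rewrite S_INR; ring). exact IH1.
    + unfold Kval. pose proof (Jval_step l z Hz) as E.
      replace (Jval (S (S l)) 0 z) with (/ z ^ 2 * (4 * INR (S l) * INR (S (S l)) * Jval l 0 z + INR (S (S l)) * (4 * INR (S l) + 2) * Jval (S l) 0 z)).
      2:{ rewrite <- E. field. lra. }
      assert (S1 : INR (S l) <> 0) by (apply not_0_INR; lia).
      assert (S2 : INR (S (S l)) <> 0) by (apply not_0_INR; lia).
      rewrite !fact_simpl, !mult_INR. rewrite (S_INR (S l)) in *. rewrite (S_INR l) in *.
      replace (INR l + 1 + 1 + / 2) with (INR l + / 2 + 1 + 1) by ring.
      replace (INR l + 1 + / 2) with (INR l + / 2 + 1) by ring.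
      rewrite !(Rpower_plus _ 1), !Rpower_1 by lra.
      field. repeat split; auto; try lra. apply INR_fact_neq_0.
Qed.

Lemma Ktilde_Jval (l : nat) (z : R) : 0 < z ->
  Ktilde (INR l + / 2) z = sG / INR (fact l) * exp (- z) * Jval l 0 z.
Proof.
  intros Hz. unfold Ktilde, BesselK.
  change (fun s => exp (- z * cosh s) * cosh ((INR l + / 2) * s)) with (Kfun (INR l + / 2) z).
  rewrite (is_RInt_gen_unique (V:=R_CompleteNormedModule) _ _ (is_K_Kval l z Hz)). unfold Kval.
  rewrite <- Rmult_assoc, <- Rpower_plus, Rplus_opp_l, Rpower_O by lra. ring.
Qed.

(** * Rearrangement of finite sums and a binomial convolution *)

Lemma Csum_swap (f : nat -> nat -> CC) (n m : nat) :
  Csum (fun i => Csum (fun k => f i k) m) n = Csum (fun k => Csum (fun i => f i k) n) m.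
Proof. induction n as [|n IH]; simpl; [reflexivity|]. rewrite IH, <- Csum_plus. reflexivity. Qed.

Lemma Csum_triangle (f : nat -> nat -> CC) (j : nat) :
  Csum (fun k => Csum (fun n => f n (k - n)%nat) k) j = Csum (fun n => Csum (fun p => f n p) (j - n)) j.
Proof.
  induction j as [|j IH]; [reflexivity|].
  change (Csum (fun k => Csum (fun n => f n (k - n)%nat) k) (S j))
    with (Csum (fun k => Csum (fun n => f n (k - n)%nat) k) j + Csum (fun n => f n (S j - n)%nat) (S j))%C.
  rewrite IH.
  change (Csum (fun n => f n (S j - n)%nat) (S j)) with (Csum (fun n => f n (S j - n)%nat) j + f (S j) (S j - S j)%nat)%C.
  change (Csum (fun n => Csum (fun p => f n p) (S j - n)) (S j))
    with (Csum (fun n => Csum (fun p => f n p) (S j - n)) j + Csum (fun p => f (S j) p) (S j - S j))%C.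
  rewrite Nat.sub_diag. simpl (Csum _ 0). rewrite Cplus_assoc, <- Csum_plus. f_equal.
  apply Csum_ext. intros n Hn. replace (S j - n)%nat with (S (j - n)) by lia. reflexivity.
Qed.

Lemma Csum_RtoC (a : nat -> R) (n : nat) : RtoC (sum_f_R0 a n) = Csum (fun k => RtoC (a k)) n.
Proof. induction n as [|n IH]; simpl; [reflexivity|]. rewrite RtoC_plus, IH. reflexivity. Qed.

Lemma Csum_only_0 (a : nat -> CC) (n : nat) : (forall k, (0 < k <= n)%nat -> a k = 0) -> Csum a n = a 0%nat.
Proof.
  induction n as [|n IH]; intros H; simpl; [reflexivity|].
  rewrite IH by (intros; apply H; lia). rewrite (H (S n)) by lia. ring.
Qed.

Lemma Csum_only_last (a : nat -> CC) (n : nat) : (forall k, (k < n)%nat -> a k = 0) -> Csum a n = a n.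
Proof.
  destruct n as [|n]; intros H; [reflexivity|]. simpl.
  assert (E : forall m, (m <= n)%nat -> Csum a m = 0).
  { induction m as [|m IH]; intros Hm; simpl; [apply H; lia|]. rewrite IH, H by lia. ring. }
  rewrite E by lia. ring.
Qed.

Lemma is_Cint_Csum {Fa Fb} {FFa : Filter Fa} {FFb : Filter Fb} (f : nat -> R -> CC) (l : nat -> CC) (n : nat) :
  (forall i, is_Cint (f i) Fa Fb (l i)) -> is_Cint (fun x => Csum (fun i => f i x) n) Fa Fb (Csum l n).
Proof. intros H. induction n as [|n IH]; simpl; [apply H | apply is_Cint_plus; auto]. Qed.

(** Arises from the Laplace transforms: [(l+i+p)! / p!] is [(l+i)!] times this number with
    [m = l + i]. *)
Definition multichoose (m p : nat) : R := INR (fact (m + p)) / (INR (fact m) * INR (fact p)).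

Lemma multichoose_0 (m : nat) : multichoose m 0 = 1.
Proof. unfold multichoose. rewrite Nat.add_0_r. simpl. field. apply INR_fact_neq_0. Qed.

Lemma multichoose_S (m p : nat) : multichoose (S m) (S p) = multichoose m (S p) + multichoose (S m) p.
Proof.
  unfold multichoose. replace (S m + S p)%nat with (S (m + S p)) by lia.
  replace (S m + p)%nat with (m + S p)%nat by lia.
  rewrite !fact_simpl, !mult_INR. rewrite (S_INR (m + S p)), plus_INR, !S_INR.
  pose proof (pos_INR m). pose proof (pos_INR p). field.
  repeat split; try apply INR_fact_neq_0; lra.
Qed.

(* Coefficient form of (1 + t)^N * (1 + t)^(-m-1). *)
Lemma multichoose_convolution (N : CC) (m q : nat) :
  Csum (fun p => (RtoC ((-1) ^ p * multichoose m p) * binomC N (q - p))%C) q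
  = binomC (N - RtoC (INR m) - 1)%C q.
Proof.
  (* Multiplication of the generating series by [1 + t], with [c] the new coefficients up to sign:
     they are those of [m - 1] when [m > 0], and those of the constant 1 when [m = 0]. *)
  assert (Rec : forall m q c, (forall p, c (S p) = multichoose m (S p) - multichoose m p) -> c 0%nat = 1 ->
    (Csum (fun p => (RtoC ((-1) ^ p * multichoose m p) * binomC N (S q - p))%C) (S q)
     + Csum (fun p => (RtoC ((-1) ^ p * multichoose m p) * binomC N (q - p))%C) q
     = Csum (fun p => (RtoC ((-1) ^ p * c p) * binomC N (S q - p))%C) (S q))%C).
  { clear m q. intros m q c Hc H0. rewrite !Csum_S_l, <- Cplus_assoc, <- Csum_plus, H0, multichoose_0. f_equal.
    apply Csum_ext. intros p Hp. rewrite Hc. change (S q - S p)%nat with (q - p)%nat.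
    replace ((-1) ^ S p * (multichoose m (S p) - multichoose m p)) with ((-1) ^ S p * multichoose m (S p) + (-1) ^ p * multichoose m p) by (simpl; ring).
    rewrite (RtoC_plus ((-1) ^ S p * multichoose m (S p))). ring. }
  assert (Step : forall M q, binomC M (S q) = (binomC (M + 1) (S q) - binomC M q)%C).
  { intros M k. rewrite binomC_pascal. ring. }
  revert q. induction m as [|m IHm]; intros q; induction q as [|q IHq].
  - simpl Csum. rewrite multichoose_0, !binomC_0. simpl. rewrite Rmult_1_l. ring.
  - pose proof (Rec 0%nat q (fun p => match p with O => 1 | S _ => 0 end)) as E.
    rewrite IHq in E. rewrite Step.
    replace (N - RtoC (INR 0) - 1 + 1)%C with N by (simpl; ring).
    assert (E2 : Csum (fun p => (RtoC ((-1) ^ p * match p with O => 1 | S _ => 0 end) * binomC N (S q - p))%C) (S q) = binomC N (S q)).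
    { rewrite Csum_only_0; [simpl pow; rewrite Nat.sub_0_r, Rmult_1_l; ring|].
      intros [|k] Hk; [lia|]. rewrite Rmult_0_r. ring. }
    rewrite E2 in E. rewrite <- E; [ring | | reflexivity].
    intros p. unfold multichoose. simpl (0 + _)%nat. simpl (INR (fact 0)).
    field. split; apply INR_fact_neq_0.
  - simpl Csum. rewrite multichoose_0, !binomC_0. simpl. rewrite Rmult_1_l. ring.
  - pose proof (Rec (S m) q (multichoose m)) as E. rewrite IHq, IHm in E. rewrite Step.
    replace (N - RtoC (INR (S m)) - 1 + 1)%C with (N - RtoC (INR m) - 1)%C by (rewrite S_INR, RtoC_plus; ring).
    rewrite <- E; [ring | | apply multichoose_0]. intros p. rewrite multichoose_S. ring.
Qed.

(** * The double integral *)

(** Substitution [v = cosh s - 1]: since [sinh^2 s = v (v+2)], the odd power of [sinh] becomes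
    [(v (v+2))^l dv]. The factor 1 in the substitution allows [filterlim_cosh_infty] to be
    reused. *)
Lemma is_RInt_gen_phi (l p : nat) (x : R) : 0 < x ->
  is_RInt_gen (fun s => exp (- x * (cosh s - 1)) * sinh s ^ (2 * l + 1) * (cosh s - 1) ^ p)
    (at_point 0) (Rbar_locally p_infty) (Jval l p x).
Proof.
  intros Hx.
  assert (I : is_RInt_gen (fun s => sinh s * (exp (- x * (1 * (cosh s - 1))) * ((1 * (cosh s - 1) * (1 * (cosh s - 1) + 2)) ^ l * (1 * (cosh s - 1)) ^ p)))
     (at_point 0) (Rbar_locally p_infty) (Jval l p x)).
  { apply (is_RInt_gen_subst (Fa := at_point 0) (Fb := Rbar_locally p_infty) (Ga := at_point 0) (Gb := Rbar_locally p_infty) (fun _ => True)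
      (fun v => exp (- x * v) * ((v * (v + 2)) ^ l * v ^ p)) (fun s => 1 * (cosh s - 1)) sinh).
    - apply is_interval_True.
    - exact Logic.I.
    - apply filter_true.
    - intros s _. auto_derive; auto. ring.
    - intros s _. apply (ex_derive_continuous (V:=R_NormedModule)). auto_derive; auto.
    - intros s _. apply (ex_derive_continuous (V:=R_NormedModule) (fun v => exp (- x * v) * ((v * (v + 2)) ^ l * v ^ p))). auto_derive; auto.
    - pose proof (filterlim_at_point (fun s => 1 * (cosh s - 1)) 0) as L. cbv beta in L.
      replace (1 * (cosh 0 - 1)) with 0 in L by (rewrite cosh_0; ring). exact L.
    - apply filterlim_cosh_infty. lra.
    - apply is_Lap_Jval, Hx. }
  revert I. apply is_RInt_gen_ext. apply filter_forall. intros ab s _.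
  match goal with |- @eq _ ?a ?b => change (@eq R a b) end.
  rewrite Rmult_1_l, <- sinh_sqr, <- pow_mult, pow_add. ring.
Qed.

Definition Vint (mu : CC) (n : nat) : CC := cosdiff mu 1 n 0.

Definition Fcoef (mu : CC) (l j n i : nat) : CC :=
  (RtoC (polyc l i * INR (fact (l + i))) *
    (RtoC ((-1) ^ n / INR (fact n)) * Vint mu n *
     binomC (RtoC (INR j) + (RtoC (INR l) + (mu + 1) / 2) - RtoC (INR (l + i)) - 1) (j - n)))%C.

Definition Fval (mu : CC) (l j : nat) (x : R) : CC :=
  Csum (fun n => Csum (fun i => (Fcoef mu l j n i * RtoC (x ^ (n + (l - i))))%C) l) j.

Lemma Ffun_Csum (mu : CC) (l j : nat) (x : R) : -1 < Re mu -> 0 < x ->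
  Ffun mu l j x =
  (RtoC (x ^ (2 * l + 1)) *
   Csum (fun k => Csum (fun n =>
     RtoC ((- x) ^ k / INR (fact k) * Binomial.C k n) *
     binomC (RtoC (INR j) + (RtoC (INR l) + (mu + 1) / 2)) (j - k) * RtoC (Jval l (k - n) x) * Vint mu n)%C k) j)%C.
Proof.
  intros Hmu Hx. unfold Ffun. f_equal.
  set (b := fun k => binomC (RtoC (INR j) + (RtoC (INR l) + (mu + 1) / 2)) (j - k)).
  set (w := fun k n => (RtoC ((- x) ^ k / INR (fact k) * Binomial.C k n) * b k * RtoC (Jval l (k - n) x))%C).
  assert (Inner : forall psi,
     CInt_gen (fun phi => (RtoC (exp (- x * (cosh phi - 1)) * sinh phi ^ (2 * l + 1)) *
        (Laguerre j (RtoC (INR l) + (mu + 1) / 2) (x * (cos psi + cosh phi)) * rpowC (sin psi) mu))%C)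
        (at_point 0) (Rbar_locally p_infty)
     = Csum (fun k => Csum (fun n => (w k n * (RtoC ((cos psi + 1) ^ n * cos psi ^ 0) * rpowC (sin psi) mu))%C) k) j).
  { intros psi. apply is_Cint_unique.
    assert (I : is_Cint (fun phi => Csum (fun k => Csum (fun n =>
       (RtoC ((- x) ^ k / INR (fact k) * Binomial.C k n) * b k * (RtoC ((cos psi + 1) ^ n * cos psi ^ 0) * rpowC (sin psi) mu)
        * RtoC (exp (- x * (cosh phi - 1)) * sinh phi ^ (2 * l + 1) * (cosh phi - 1) ^ (k - n)))%C) k) j)
       (at_point 0) (Rbar_locally p_infty)
       (Csum (fun k => Csum (fun n => (RtoC ((- x) ^ k / INR (fact k) * Binomial.C k n) * b k * (RtoC ((cos psi + 1) ^ n * cos psi ^ 0) * rpowC (sin psi) mu)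
          * RtoC (Jval l (k - n) x))%C) k) j)).
    { apply is_Cint_Csum; intros k. apply is_Cint_Csum; intros n. apply is_Cint_mult, is_Cint_RtoC, is_RInt_gen_phi, Hx. }
    match goal with |- is_Cint _ _ _ ?r => match type of I with is_Cint _ _ _ ?v => replace r with v end end.
    2:{ apply Csum_ext; intros k _. apply Csum_ext; intros n _. unfold w. ring. }
    revert I. apply (is_Cint_ext (fun _ => True)); [apply is_interval_True | exact Logic.I | apply filter_true |].
    intros phi _. unfold Laguerre.
    rewrite (Cmult_comm (Csum _ j)), Cmult_assoc, <- Csum_mult_l. apply Csum_ext; intros k _.
    replace (x * (cos psi + cosh phi)) with (x * ((cos psi + 1) + (cosh phi - 1))) by ring.
    rewrite (Rpow_mult_distr x), binomial. fold (b k).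
    replace ((-1) ^ k / INR (fact k) * (x ^ k * sum_f_R0 (fun i => Binomial.C k i * (cos psi + 1) ^ i * (cosh phi - 1) ^ (k - i)) k))
      with ((- x) ^ k / INR (fact k) * sum_f_R0 (fun i => Binomial.C k i * (cos psi + 1) ^ i * (cosh phi - 1) ^ (k - i)) k).
    2:{ replace (- x) with (-1 * x) by ring. rewrite (Rpow_mult_distr (-1)). unfold Rdiv. ring. }
    rewrite (RtoC_mult ((- x) ^ k / INR (fact k))), Csum_RtoC.
    match goal with |- _ = (?u * (?a * Csum ?f k * ?c))%C => transitivity ((u * a * c) * Csum f k)%C; [|ring] end.
    rewrite <- Csum_mult_l. apply Csum_ext; intros n _.
    rewrite !RtoC_mult. simpl (cos psi ^ 0). ring. }
  unfold CInt_gen at 1.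
  assert (O : is_psi_int (fun psi => Csum (fun k => Csum (fun n => (w k n * (RtoC ((cos psi + 1) ^ n * cos psi ^ 0) * rpowC (sin psi) mu))%C) k) j)
      (Csum (fun k => Csum (fun n => (w k n * Vint mu n)%C) k) j)).
  { apply is_Cint_Csum; intros k. apply is_Cint_Csum; intros n. apply is_Cint_mult, is_psi_int_cosdiff, Hmu. }
  apply (is_Cint_unique (Fa := at_right 0) (Fb := at_left PI)). revert O. apply is_psi_int_ext. intros psi _. symmetry. apply Inner.
Qed.

(** Set [k = n + p]. The powers of [x] in [Jval] cancel [x^p] and part of [x^(2l+1)], leaving
    [x^(n+l-i)], so the sum over [p] is free of [x] and [multichoose_convolution] evaluates it. *)
Lemma Ffun_Fval (mu : CC) (l j : nat) (x : R) : -1 < Re mu -> 0 < x -> Ffun mu l j x = Fval mu l j x.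
Proof.
  intros Hmu Hx. rewrite Ffun_Csum by auto.
  set (N := (RtoC (INR j) + (RtoC (INR l) + (mu + 1) / 2))%C).
  set (f := fun n p => (RtoC ((- x) ^ (n + p) / (INR (fact n) * INR (fact p))) * binomC N (j - n - p) * RtoC (Jval l p x) * Vint mu n)%C).
  rewrite (Csum_ext _ (fun k => Csum (fun n => f n (k - n)%nat) k)).
  2:{ intros k Hk. apply Csum_ext; intros n Hn. unfold f.
      replace (n + (k - n))%nat with k by lia. replace (j - n - (k - n))%nat with (j - k)%nat by lia.
      do 3 f_equal. f_equal. unfold Binomial.C. field. repeat split; apply INR_fact_neq_0. }
  rewrite Csum_triangle, <- Csum_mult_l. unfold Fval. apply Csum_ext; intros n Hn.
  set (g := fun p i => (RtoC (polyc l i * INR (fact (l + i)) * (x ^ (n + (l - i)))) * (RtoC ((-1) ^ n / INR (fact n)) * Vint mu n)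
     * (RtoC ((-1) ^ p * multichoose (l + i) p) * binomC N (j - n - p)))%C).
  rewrite <- Csum_mult_l, (Csum_ext _ (fun p => Csum (fun i => g p i) l)).
  - rewrite Csum_swap. apply Csum_ext; intros i Hi. unfold g. rewrite Csum_mult_l, multichoose_convolution.
    unfold Fcoef. fold N. rewrite (RtoC_mult (polyc l i * INR (fact (l + i)))). ring.
  - intros p Hp. unfold f, Jval. rewrite Csum_RtoC.
    match goal with |- (?u * (?a * ?b * Csum ?h l * ?c))%C = _ => transitivity ((u * a * b * c) * Csum h l)%C; [ring|] end.
    rewrite <- Csum_mult_l. apply Csum_ext; intros i Hi. unfold g.
    match goal with |- (RtoC ?u * RtoC ?a * ?b * ?c * RtoC ?d)%C = (RtoC ?p1 * (RtoC ?p2 * _) * (RtoC ?p3 * _))%C =>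
      transitivity (RtoC (u * a * d) * (b * c))%C; [rewrite !RtoC_mult; ring|];
      transitivity (RtoC (p1 * p2 * p3) * (b * c))%C; [|rewrite !RtoC_mult; ring] end.
    f_equal. f_equal. unfold multichoose.
    replace (2 * l + 1)%nat with ((l - i) + S (l + i))%nat by lia.
    replace (S (l + i + p)) with (S (l + i) + p)%nat by lia.
    replace (- x) with (-1 * x) by ring. rewrite Rpow_mult_distr, !pow_add.
    assert (forall m, x ^ m <> 0) by (intros; apply pow_nonzero; lra).
    field. repeat split; auto using INR_fact_neq_0.
Qed.

(** * The generating function *)

(** At argument [2x] the Bessel arguments are [x/(1-t)] and [w = x t/(1-t)]. Since
    [x - x/(1-t) = -w], the factor [e^x] and the exponential in K-tilde combine into the [e^(-w)] of
    [Tfun], while each inverse power in [Jval] contributes [(1-t)^(l+i+1)]. *)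
Lemma Gfun_Tfun (mu : CC) (l : nat) (x t : R) : -1 < Re mu -> 0 < x -> t < 1 ->
  Gfun mu l t (2 * x) =
  Csum (fun i => (RtoC (sG / INR (fact l) * (polyc l i * INR (fact (l + i))) * x ^ (l - i)) *
     Tfun x (RtoC (INR l) + (mu + 1) / 2 - RtoC (INR (l + i))) (Icoef mu) t)%C) l.
Proof.
  intros Hmu Hx Ht. unfold Gfun.
  assert (P : 0 < 1 - t) by lra.
  set (y := 1 - t) in *.
  replace (2 * x / 2) with x by field.
  replace (2 * x / (2 * y)) with (x / y) by (field; lra).
  replace (t * (2 * x) / (2 * y)) with (x * t / y) by (field; lra).
  rewrite Itilde_egf by auto. rewrite Ktilde_Jval by (apply Rdiv_lt_0_compat; auto).
  set (E := Cegf (Icoef mu) (x * t / y)).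
  unfold Jval.
  rewrite scal_sum, Csum_RtoC.
  set (s := (RtoC (INR l) + (mu + 3) / 2)%C).
  assert (Es : (/ rpowC y s)%C = rpowC y (- s)).
  { assert (Q : (rpowC y s * rpowC y (- s))%C = 1) by (rewrite <- rpowC_plus; replace (s + - s)%C with (RtoC 0) by ring; apply rpowC_0).
    transitivity (/ rpowC y s * (rpowC y s * rpowC y (- s)))%C; [rewrite Q; ring | field; apply rpowC_neq0]. }
  rewrite Es.
  match goal with |- (?a * (?b * (?c * Csum ?f l)))%C = _ => transitivity ((a * b * c) * Csum f l)%C; [ring|] end.
  rewrite <- Csum_mult_l. apply Csum_ext; intros i Hi. unfold Tfun. fold y. fold E.
  set (q := (l + i + 0)%nat). assert (Eq : q = (l + i)%nat) by (unfold q; lia). rewrite Eq.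
  replace (- (RtoC (INR l) + (mu + 1) / 2 - RtoC (INR (l + i))))%C with (- s + RtoC (INR (S (l + i))))%C.
  2:{ unfold s. rewrite S_INR, RtoC_plus. field. }
  rewrite rpowC_plus, rpowC_INR by auto.
  match goal with |- (?a * RtoC ?b * ?c * RtoC ?d)%C = (RtoC ?p1 * (_ * RtoC ?p2 * (RtoC ?p3 * _)))%C =>
      transitivity (RtoC (b * d) * (a * c))%C; [rewrite !RtoC_mult; ring|];
      transitivity (RtoC (p1 * p2 * p3) * (a * c))%C; [|rewrite !RtoC_mult; ring] end.
  f_equal. f_equal.
  replace (- (x * t / y)) with (x + - (x / y)) by (unfold y in *; field; lra). rewrite exp_plus.
  replace (2 * l + 1)%nat with ((l - i) + S (l + i))%nat by lia. rewrite (pow_add _ (l - i)).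
  replace ((x / y) ^ S (l + i)) with (x ^ S (l + i) / y ^ S (l + i)) by (unfold Rdiv; now rewrite Rpow_mult_distr, pow_inv).
  assert (forall m, x ^ m <> 0) by (intros; apply pow_nonzero; lra).
  assert (forall m, y ^ m <> 0) by (intros; apply pow_nonzero; lra).
  field. repeat split; auto using INR_fact_neq_0; lra.
Qed.

(** Term by term in [n] and [i] this matches [Fcoef]: the differences of [Icoef] give
    [(-1)^n Vint mu n] by [cosdiff_m1], and [sG] cancels against the normalization of [Icoef]. *)
Lemma CDerive_n_Gfun (mu : CC) (l j : nat) (x : R) : -1 < Re mu -> 0 < x ->
  CDerive_n (fun t => Gfun mu l t (2 * x)) j 0
  = (RtoC (INR (fact j)) / (RtoC (INR (fact l)) * CGamma ((mu + 1) / 2)) * Fval mu l j x)%C.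
Proof.
  intros Hmu Hx.
  assert (Ga : CGamma ((mu + 1) / 2)%C <> 0).
  { apply CGamma_neq0. replace ((mu + 1) / 2)%C with (RtoC (/ 2) * (mu + 1))%C by (rewrite RtoC_inv by lra; field). unfold Re in *; simpl; lra. }
  assert (Gs : RtoC sG <> 0) by (rewrite <- CGamma_half; apply CGamma_neq0; rewrite Re_half; lra).
  set (T := fun k t => Csum (fun i => (RtoC (sG / INR (fact l) * (polyc l i * INR (fact (l + i))) * x ^ (l - i)) *
     Tder x k (RtoC (INR l) + (mu + 1) / 2 - RtoC (INR (l + i))) (Icoef mu) t)%C) l).
  rewrite (CDerive_n_ext_loc _ (T 0%nat)).
  2:{ generalize (locally_open (fun y => y < 1) (fun y => y < 1) (open_lt 1) (fun y h => h) 0 Rlt_0_1).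
      apply filter_imp. intros t Ht. apply Gfun_Tfun; auto. }
  rewrite (tower_CDerive_n T).
  2:{ apply (tower_Csum (fun i k t => (RtoC (sG / INR (fact l) * (polyc l i * INR (fact (l + i))) * x ^ (l - i)) *
         Tder x k (RtoC (INR l) + (mu + 1) / 2 - RtoC (INR (l + i))) (Icoef mu) t)%C)).
      intros i. apply (tower_mult_l _ (fun k t => Tder x k (RtoC (INR l) + (mu + 1) / 2 - RtoC (INR (l + i))) (Icoef mu) t)).
      apply tower_Tder, Cbounded_Icoef, Hmu. }
  2:{ lra. }
  unfold T, Fval. rewrite Csum_swap, <- Csum_mult_l. apply Csum_ext; intros i Hi.
  rewrite Tder_0, <- !Csum_mult_l. apply Csum_ext; intros n Hn.
  rewrite iterdiff_Icoef, cosdiff_m1, CGamma_half by auto. unfold Fcoef, Vint.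
  replace (RtoC (INR l) + (mu + 1) / 2 - RtoC (INR (l + i)) + RtoC (INR j) - 1)%C
    with (RtoC (INR j) + (RtoC (INR l) + (mu + 1) / 2) - RtoC (INR (l + i)) - 1)%C by ring.
  set (B := binomC _ _). set (V := cosdiff mu 1 n 0). set (G := CGamma ((mu + 1) / 2)) in *.
  unfold Rdiv. rewrite pow_add, !RtoC_mult, !RtoC_inv by apply INR_fact_neq_0.
  field. repeat split; auto using RtoC_fact_neq0.
Qed.

(** * Degree *)

(** [lead] may be zero, so that lower order terms can be added without a case distinction; the exact
    degree follows once the total leading coefficient is known. *)
Definition is_Cpoly (N : nat) (lead : CC) (f : R -> CC) : Prop :=
  exists c : nat -> CC, c N = lead /\ forall x, 0 < x -> f x = Csum (fun k => (c k * RtoC (x ^ k))%C) N.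

Lemma is_Cpoly_Csum (N : nat) (lead : nat -> CC) (f : nat -> R -> CC) (n : nat) :
  (forall i, (i <= n)%nat -> is_Cpoly N (lead i) (f i)) ->
  is_Cpoly N (Csum lead n) (fun x => Csum (fun i => f i x) n).
Proof.
  induction n as [|n IH]; intros H; simpl; [apply H; lia|].
  destruct IH as [c [C1 C2]]; [intros; apply H; lia|]. destruct (H (S n)) as [d [D1 D2]]; [lia|].
  exists (fun k => (c k + d k)%C). split; [congruence|]. intros x Hx. rewrite C2, D2, <- Csum_plus by auto.
  apply Csum_ext; intros k _. ring.
Qed.

Lemma is_Cpoly_monomial (N k : nat) (z : CC) : (k <= N)%nat ->
  is_Cpoly N (if Nat.eqb k N then z else RtoC 0) (fun x => (z * RtoC (x ^ k))%C).
Proof.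
  intros Hk. exists (fun m => if Nat.eqb k m then z else RtoC 0). split; [reflexivity|]. intros x _.
  assert (E : forall m, Csum (fun i => ((if Nat.eqb k i then z else RtoC 0) * RtoC (x ^ i))%C) m = if Nat.leb k m then (z * RtoC (x ^ k))%C else RtoC 0).
  { induction m as [|m IH].
    - simpl. destruct k; simpl; ring.
    - change (Csum (fun i => ((if Nat.eqb k i then z else RtoC 0) * RtoC (x ^ i))%C) (S m)) with
       (Csum (fun i => ((if Nat.eqb k i then z else RtoC 0) * RtoC (x ^ i))%C) m + (if Nat.eqb k (S m) then z else RtoC 0) * RtoC (x ^ S m))%C.
      rewrite IH. destruct (Nat.eqb_spec k (S m)) as [->|H1]; destruct (Nat.leb_spec k m) || destruct (Nat.leb_spec (S m) m); 
        destruct (Nat.leb_spec k (S m)) || destruct (Nat.leb_spec (S m) (S m)); try lia; ring. }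
  rewrite E. destruct (Nat.leb_spec k N); [reflexivity | lia].
Qed.

Lemma Vint_neq0 (mu : CC) (n : nat) : -1 < Re mu -> Vint mu n <> 0.
Proof.
  intros H. unfold Vint. induction n as [|n IH].
  - simpl. intros E. pose proof (Wint_Gamma mu H) as W. rewrite E, Cmult_0_l in W.
    symmetry in W. revert W. apply Cmult_neq_0; apply CGamma_neq0.
    + replace ((mu + 1) / 2)%C with (RtoC (/ 2) * (mu + 1))%C by (rewrite RtoC_inv by lra; field). unfold Re in *; simpl; lra.
    + rewrite Re_half; lra.
  - intros E. pose proof (cosdiff_step mu 1 n H ltac:(ring)) as S. rewrite E, Cmult_0_r in S.
    symmetry in S. revert S. pose proof (pos_INR n). apply Cmult_neq_0; [apply Cmult_neq_0|exact IH].
    + apply RtoC_neq0; lra.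
    + apply Cneq0_Re. unfold Re in *; simpl. lra.
Qed.

Theorem theorem2p7 (mu : CC) (l j : nat) (Hmu : -1 < Re mu) :
  (exists c : nat -> CC,
      c (j + l)%nat <> RtoC 0 /\
      forall x : R, 0 < x ->
        Ffun mu l j x = Csum (fun k => Cmult (c k) (RtoC (x ^ k))) (j + l)) /\
  (forall x : R, 0 < x ->
     Ffun mu l j x =
     Cmult (Cdiv (Cmult (rpowC 2 mu)
                   (Cmult (RtoC (INR (fact l)))
                     (Cmult (CGamma (Cdiv (Cplus mu 1) 2))
                            (CGamma (Cplus (RtoC (INR j)) (Cdiv (Cplus mu 1) 2))))))
                 (CGamma (Cplus (RtoC (INR j)) (Cplus mu 1))))
           (Mfun mu l j (2 * x))).
Proof.
  split.
  - assert (P : is_Cpoly (j + l) (Fcoef mu l j j 0) (Fval mu l j)).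
    (* The exponent [n + l - i] with [n <= j] reaches [j + l] only for [n = j] and [i = 0]. *)
    { replace (Fcoef mu l j j 0) with
        (Csum (fun n => Csum (fun i => if Nat.eqb (n + (l - i)) (j + l) then Fcoef mu l j n i else RtoC 0) l) j).
      - apply (is_Cpoly_Csum (j + l) _ (fun n x => Csum (fun i => (Fcoef mu l j n i * RtoC (x ^ (n + (l - i))))%C) l)). intros n Hn.
        apply (is_Cpoly_Csum (j + l) _ (fun i x => (Fcoef mu l j n i * RtoC (x ^ (n + (l - i))))%C)). intros i Hi.
        apply is_Cpoly_monomial. lia.
      - rewrite Csum_only_last.
        + rewrite Csum_only_0.
          * replace (j + (l - 0))%nat with (j + l)%nat by lia. rewrite Nat.eqb_refl. reflexivity.
          * intros i Hi. destruct (Nat.eqb_spec (j + (l - i)) (j + l)); [lia | reflexivity].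
        + intros n Hn. rewrite Csum_only_0; (destruct (Nat.eqb_spec (n + (l - 0)) (j + l)); [lia|]); [reflexivity|].
          intros i Hi. destruct (Nat.eqb_spec (n + (l - i)) (j + l)); [lia | reflexivity]. }
    destruct P as [c [C1 C2]]. exists c. split.
    + rewrite C1. unfold Fcoef. rewrite Nat.sub_diag, binomC_0, Cmult_1_r.
      repeat apply Cmult_neq_0.
      * apply RtoC_neq0. apply Rmult_integral_contrapositive_currified; [|apply INR_fact_neq_0].
        unfold polyc, Binomial.C. rewrite Nat.sub_0_r. simpl (fact 0).
        apply Rmult_integral_contrapositive_currified; [|apply pow_nonzero; lra].
        pose proof (INR_fact_lt_0 l). apply Rgt_not_eq. apply Rdiv_lt_0_compat; simpl; lra.
      * apply RtoC_neq0. apply Rmult_integral_contrapositive_currified; [apply pow_nonzero; lra | apply Rinv_neq_0_compat, INR_fact_neq_0].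
      * apply Vint_neq0, Hmu.
    + intros x Hx. rewrite Ffun_Fval by auto. apply C2, Hx.
  - intros x Hx. rewrite Ffun_Fval by auto. unfold Mfun. rewrite CDerive_n_Gfun by auto.
    pose proof (pos_INR j) as Pj.
    assert (Ra : Re ((mu + 1) / 2)%C = (Re mu + 1) / 2).
    { replace ((mu + 1) / 2)%C with (RtoC (/ 2) * (mu + 1))%C by (rewrite RtoC_inv by lra; field). unfold Re; simpl; field. }
    assert (G1 : CGamma ((mu + 1) / 2)%C <> 0) by (apply CGamma_neq0; lra).
    assert (G2 : CGamma (RtoC (INR j) + (mu + 1) / 2)%C <> 0).
    { apply CGamma_neq0. change (0 < INR j + Re ((mu + 1) / 2)%C). lra. }
    assert (G3 : CGamma (RtoC (INR j) + (mu + 1))%C <> 0).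
    { apply CGamma_neq0. change (0 < INR j + (Re mu + 1)). lra. }
    (* The prefactor of [Mfun] is inverted here, which rests on the nonvanishing of the three Gamma
       values [G1], [G2], [G3]. *)
    field. repeat split; auto using RtoC_fact_neq0, rpowC_neq0.
Qed.
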